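(* Let $\lambda$ be a frequency satisfying (NC) and let $(G,\beta)$ be a $\lambda$-Dirichlet group. For every $u>0$ there exists a constant $C=C(u,\lambda)$ such that, for all $1\le p\le+\infty$ and all $f\in H_p^\lambda(G)$, $$\left\|\sup_{\sigma\ge u}\ \sup_{N\ge1}\left|\sum_{n=1}^N\widehat f(h_{\lambda_n})e^{-\sigma\lambda_n}h_{\lambda_n}\right|\right\|_p\le C\|f\|_p .$$ In particular, for every $u>0$ (and every such $f$), the series $\sum_{n=1}^{+\infty}\widehat f(h_{\lambda_n})e^{-u\lambda_n}h_{\lambda_n}$ converges almost everywhere on $G$.
   Context: A frequency is a (strictly) increasing sequence $\lambda=(\lambda_n)_{n\ge1}$ of nonnegative real numbers tending to $+\infty$. Condition (NC): for every $\delta>0$ there exists $C>0$ such that for every $n\ge1$ there exists $m>n$ with $$\log\left(\frac{\lambda_m+\lambda_n}{\lambda_m-\lambda_n}\right)+(m-n)\le Ce^{\delta\lambda_n}.$$ Let $G$ be a compact abelian group (with normalized Haar measure and dual group $\widehat G$) and $\beta:(\mathbb R,+)\to G$ a continuous homomorphism with dense range. $(G,\beta)$ is a $\lambda$-Dirichlet group if for every $n$ there exists $h_{\lambda_n}\in\widehat G$ (necessarily unique) with $h_{\lambda_n}(\beta(t))=e^{-i\lambda_n t}$ for all $t\in\mathbb R$. For $p\in[1,+\infty]$, $H_p^\lambda(G)$ is the subspace of $L_p(G)$ of functions $f$ whose Fourier transform $\widehat f$ is supported in $\{h_{\lambda_n}:n\in\mathbb N\}$; $\|\cdot\|_p$ is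 the $L_p(G)$-norm. *)

(* Defs.v *)
From HB Require Import structures.
From mathcomp Require Import all_boot all_order all_algebra complex.
From mathcomp Require Import all_classical all_reals all_analysis.

Set Implicit Arguments.
Unset Strict Implicit.
Unset Printing Implicit Defensive.

Import Order.TTheory GRing.Theory Num.Theory.
Import numFieldNormedType.Exports.

Local Open Scope classical_set_scope.
Local Open Scope ring_scope.
Local Open Scope complex_scope.

(* Sequences indexed by n >= 1 on paper are indexed by n >= 0 here:
   [lam n] is the (n+1)-st frequency. *)
Section frequency.
Context {R : realType}.
Implicit Types lam : nat -> R.

Definition frequency lam : Prop :=
  [/\ forall n, 0 <= lam n,
      {homo lam : m n / (m < n)%N >-> m < n} &
      lam n @[n --> \oo] --> +oo].

Definition condition_NC lam : Prop :=
  forall delta : R, 0 < delta -> exists C : R, 0 < C /\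
    forall n, exists m, (n < m)%N /\
      ln ((lam m + lam n) / (lam m - lam n)) + (m%:R - n%:R)
        <= C * expR (delta * lam n).

End frequency.

(* [g_sigma_algebraType] needs a pointed type; the point plays no other role. *)
Definition pointed0 (G : zmodType) : Type := G.
HB.instance Definition _ (G : zmodType) := Choice.on (pointed0 G).
HB.instance Definition _ (G : zmodType) := isPointed.Build (pointed0 G) (0 : G).

Notation borel G :=
  (@g_sigma_algebraType (pointed0 G) (@open G : set (set (pointed0 G)))).

Section compact_abelian_group.
Context {R : realType} {G : topologicalZmodType}.
Implicit Types (mu : probability (borel G) R) (chi : G -> R[i]).

(* Regularity is not automatic, as G need not be metrizable. *)
Definition haar_probability mu : Prop :=
  [/\ forall (x : G) (A : set (borel G)), measurable A ->
        mu [set x + y | y in A] = mu A,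
      forall A : set (borel G), measurable A ->
        mu A = ereal_inf [set mu U | U in [set U : set G | open U /\ A `<=` U]]
    & forall U : set G, open U ->
        mu U = ereal_sup [set mu K | K in [set K : set G | compact K /\ K `<=` U]]].

(* [R[i]^o] is R[i] with its norm topology. *)
Definition character chi : Prop :=
  [/\ continuous (chi : G -> R[i]^o), {morph chi : x y / x + y >-> x * y} &
      forall x, `|chi x| = 1].

Definition dirichlet_character (beta : R -> G) (l : R) chi : Prop :=
  character chi /\
  forall t, chi (beta t) = cos (l * t) -i* sin (l * t).

Definition dirichlet_group (lam : nat -> R) (beta : R -> G) : Prop :=
  [/\ compact [set: G] /\ hausdorff_space G,
      continuous beta, {morph beta : s t / s + t}, dense (range beta) &
      forall n, exists chi, dirichlet_character beta (lam n) chi].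

Definition cintegral mu (f : G -> R[i]) : R[i] :=
  Rintegral mu setT (@complex.Re R \o f) +i* Rintegral mu setT (@complex.Im R \o f).

Definition fourier mu (f : G -> R[i]) chi : R[i] :=
  cintegral mu (fun x => f x * (chi x)^*).

Definition cLnorm mu (p : \bar R) (f : G -> R[i]) : \bar R :=
  Lnorm mu p (fun x => (Normc.normc (f x))%:E).

(* Membership does not depend on the representative of an a.e. class. *)
Definition in_Lp mu (p : \bar R) (f : G -> R[i]) : Prop :=
  [/\ measurable_fun [set: borel G] (@complex.Re R \o f : borel G -> R),
      measurable_fun [set: borel G] (@complex.Im R \o f : borel G -> R) &
      (cLnorm mu p f < +oo)%E].

Definition in_Hp mu (h : nat -> G -> R[i]) (p : \bar R) (f : G -> R[i]) : Prop :=
  in_Lp mu p f /\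
  forall chi, character chi -> fourier mu f chi != 0 -> exists n, chi = h n.

Definition partial_sum mu (lam : nat -> R) (h : nat -> G -> R[i])
    (f : G -> R[i]) (s : R) (N : nat) (x : G) : R[i] :=
  \sum_(n < N) fourier mu f (h n) * (expR (- (s * lam n)))%:C * h n x.

Definition maximal_function mu (lam : nat -> R) (h : nat -> G -> R[i])
    (f : G -> R[i]) (u : R) (x : G) : \bar R :=
  ereal_sup [set
    ereal_sup [set (Normc.normc (partial_sum mu lam h f s N x))%:E
              | N in [set N | (1 <= N)%N]]
    | s in [set s | u <= s]].

End compact_abelian_group.

(* Main.v *)
(* Averaging f along the flow x |-> x + beta t against an even kernel multiplies
   the Fourier coefficient at h_n by the cosine transform of the kernel at lam n.
   The kernel whose transform is the trapezoid equal to 1 on [0, lam n] and to 0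
   beyond lam m turns f into the n-th partial sum plus at most m - n further
   terms. With m given by (NC), exp (- v lam n) times that kernel is dominated by
   an integrable weight that depends on neither n nor f. Hence all partial sums,
   damped by exp (- v lam n), lie below one averaged copy of |f| plus a multiple
   of the L^1 norm of f, which is bounded on every L^p by Jensen's inequality.
   Abel summation with v = u / 2 then gives the maximal inequality and the
   convergence.

   Identifying the average with its Fourier series requires that an integrable
   function all of whose Fourier coefficients vanish is zero almost everywhere.
   If a nonzero continuous function is orthogonal to all characters, powers of
   its autocorrelation converge to an even idempotent K of the convolution
   algebra; choosing K (0) nearly minimal makes K proportional to any even D with
   D * K = D, so K / K (0) satisfies d'Alembert's equation and is therefore the
   real part of a character, a contradiction. *)

Require Import Defs.
From mathcomp Require Import all_boot all_order all_algebra complex.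
From mathcomp Require Import all_classical all_reals all_analysis.
From mathcomp Require Import measurable_realfun ess_sup_inf ring lra.

Set Implicit Arguments.
Unset Strict Implicit.
Unset Printing Implicit Defensive.

Import Order.TTheory GRing.Theory Num.Theory.
Import numFieldNormedType.Exports.

Local Open Scope classical_set_scope.
Local Open Scope ring_scope.
Local Open Scope complex_scope.

(** * Borel measurability and means of continuous functions *)

(** Subtraction on G x G need not be product measurable: without a countable base of G the Borel
    sets of G x G can exceed the product sigma-algebra. Convolution is therefore used only with a
    continuous kernel, and rough functions are averaged only along the real line, whose countable
    base restores joint measurability. An L^1 bound for each kernel would control each partial sum
    but not their supremum; one integrable majorant of all damped kernels is needed. With a = lam n
    and d = min (lam m - lam n, 1), the kernel is of order 1 / t up to t about 1 / d and of order 1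
    / (d t^2) after that. (NC) gives ln (1 / d) <= C exp (delta a) for an adjusted C, so where only
    1 / t is available, ln t is at most of order exp (delta a). Damping by exp (- 2 delta a)
    therefore supplies the factor 1 / ln^2 t that makes 1 / t integrable at infinity, which is why
    (NC) is applied with delta = v / 2. *)

Lemma openX (X Y : topologicalType) (U : set X) (V : set Y) :
  open U -> open V -> open (U `*` V).
Proof.
move=> oU oV; rewrite openE => -[x y] [/= Ux Vy].
by exists (U, V) => //; split; exact: open_nbhs_nbhs.
Qed.

Lemma compact_directed_cover (X : topologicalType) (K : set X) (D : set (set X)) :
  compact K -> D !=set0 -> (forall U V, D U -> D V -> D (U `|` V)) ->
  (forall U, D U -> open U) -> (forall x, K x -> exists2 U, D U & U x) ->
  exists2 U, D U & K `<=` U.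
Proof.
move=> /compact_near_coveringP cK [U0 DU0] DU oD cov.
(* Near [F] means for all large enough members of [D], directed by inclusion; the near-covering form
   of compactness then yields one member that serves every point of [K]. *)
pose F := filter_from D (fun U => [set W | U `<=` W]).
have FF : Filter F.
  apply: filter_from_filter; first by exists U0.
  move=> U V DU' DV; exists (U `|` V); first exact: DU.
  by move=> W UVW; split => x ?; apply: UVW; [left|right].
have [U DU1 UK] : \near F, K `<=` [set x | F x].
  apply: (cK _ F (fun W x => W x) FF) => x Kx.
  have [U DU1 Ux] := cov x Kx.
  exists (U, [set W | U `<=` W]) => /=.
    by split; [apply: open_nbhs_nbhs; split=> //; exact: oD|exists U].
  by move=> [y W] /= [Uy UW]; exact: UW.
by exists U => //; exact: UK.
Qed.

Lemma Rintegral_Fubini d1 d2 (T1 : measurableType d1) (T2 : measurableType d2)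
    (R : realType) (m1 : {sigma_finite_measure set T1 -> \bar R})
    (m2 : {sigma_finite_measure set T2 -> \bar R}) (f : T1 * T2 -> R) :
  (m1 \x m2)%E.-integrable setT (EFin \o f) ->
  Rintegral m1 setT (fun x => Rintegral m2 setT (fun y => f (x, y))) =
  Rintegral m2 setT (fun y => Rintegral m1 setT (fun x => f (x, y))).
Proof.
move=> fi; rewrite /Rintegral; congr fine.
have := Fubini fi => /=.
rewrite -/(fubini_F m2 (EFin \o f)) -/(fubini_G m1 (EFin \o f)).
have iF := ae_integrable1 fi; have iG := ae_integrable2 fi.
(* Sections are integrable only almost everywhere; on the exceptional null set [fine] may alter the
   inner integral, which the outer integral does not see. *)
move=> FG; transitivity (\int[m1]_x fubini_F m2 (EFin \o f) x)%E.
  apply: ae_eq_integral => //.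
  - apply/measurable_EFinP; apply: measurableT_comp; first exact: fine_measurable.
    exact: (measurable_fubini_F fi).
  - exact: (measurable_fubini_F fi).
  - apply: filterS iF => x h _.
    by rewrite fineK//; exact: integrable_fin_num.
rewrite FG; apply/esym/ae_eq_integral => //.
- apply/measurable_EFinP; apply: measurableT_comp; first exact: fine_measurable.
  exact: (measurable_fubini_G fi).
- exact: (measurable_fubini_G fi).
- apply: filterS iG => x h _.
  by rewrite fineK//; exact: integrable_fin_num.
Qed.

Section borel_measurability.
Context {R : realType} {G : topologicalZmodType}.

Lemma open_borel_measurable (U : set G) : open U ->
  measurable (U : set (borel G)).
Proof. by move=> oU; exact: sub_sigma_algebra. Qed.

Lemma measurable_fun_borel d (T : measurableType d) (f : T -> G) :
  (forall U : set G, open U -> measurable (f @^-1` U)) ->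
  measurable_fun setT (f : T -> borel G).
Proof.
move=> mf; apply: (measurability (@open G : set (set (borel G)))) => //.
by move=> _ [U oU <-]; rewrite setTI; exact: mf.
Qed.

Lemma continuous_borel_measurable_fun (f : G -> R) : continuous f ->
  measurable_fun setT (f : borel G -> R).
Proof.
move=> /continuousP cf; apply: (measurability _ (RGenOInfty.measurableE R)) => //.
move=> _ [_ [x ->] <-]; rewrite setTI; apply: open_borel_measurable.
by apply: cf; exact: interval_open.
Qed.

Lemma continuous_borel_measurable_map (f : G -> G) : continuous f ->
  measurable_fun setT (f : borel G -> borel G).
Proof.
move=> /continuousP cf; apply: measurable_fun_borel => U oU.
by apply: open_borel_measurable; exact: cf.
Qed.

(** An open subset of G x G need not lie in the product sigma-algebra. A compact set inside it is
    still covered by finitely many open boxes contained in it, and their union is product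
    measurable. *)
Lemma compact_open_measurable_between (K O : set (G * G)) :
  compact K -> open O -> K `<=` O ->
  exists2 M : set (borel G * borel G), measurable M & K `<=` M /\ M `<=` O.
Proof.
move=> cK oO KO.
pose D := [set W : set (G * G) |
  [/\ open W, measurable (W : set (borel G * borel G)) & W `<=` O]].
have [] := @compact_directed_cover _ K D cK.
- by exists set0; split => //; exact: open0.
- move=> U V [oU mU UO] [oV mV VO]; split; first exact: openU.
    exact: measurableU.
  by rewrite subUset.
- by move=> U [].
- move=> z /KO Oz.
  have [[U V] /= [Uz Vz] UVO] : nbhs z O by exact: open_nbhs_nbhs.
  move: Uz Vz; rewrite !nbhsE => -[U' [oU' U'z] U'U] [V' [oV' V'z] V'V].
  exists (U' `*` V') => //; split.
  + by apply: openX.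
  + by apply: measurableX; exact: open_borel_measurable.
  + by move=> x [? ?]; apply: UVO; split; [exact: U'U|exact: V'V].
- by move=> M [oM mM MO] KM; exists M.
Qed.

Lemma continuous_prod_borel_measurable_fun (k : G * G -> R) :
  compact [set: G] -> continuous k ->
  measurable_fun setT (k : borel G * borel G -> R).
Proof.
move=> cG ck; have /continuousP ck' := ck.
apply: (measurability _ (RGenOInfty.measurableE R)) => //.
move=> _ [_ [a ->] <-]; rewrite setTI.
have cGG : compact [set: G * G] by rewrite -setXTT; exact: compact_setX.
(* The open set where k > a is the union of the compact sets [K n], hence also of the measurable
   sets squeezed between each [K n] and it. *)
pose K n := k @^-1` [set t | a + n.+1%:R^-1 <= t].
have cK n : compact (K n).
  apply: (subclosed_compact _ cGG) => //.
  by apply: (preimage_closed _ (@closed_ge _ _)) => z _; exact: ck.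
have oO : open (k @^-1` `]a, +oo[) by apply: ck'; exact: interval_open.
have KO n : K n `<=` k @^-1` `]a, +oo[.
  move=> z; rewrite /K/= in_itv/= andbT; apply: lt_le_trans.
  by rewrite ltrDl invr_gt0.
pose M n := sval (cid2 (compact_open_measurable_between (cK n) oO (KO n))).
have mM n : measurable (M n) by rewrite /M; case: cid2.
have KM n : K n `<=` M n by rewrite /M; case: cid2 => ? ? [].
have MO n : M n `<=` k @^-1` `]a, +oo[ by rewrite /M; case: cid2 => ? ? [].
rewrite (_ : k @^-1` _ = \bigcup_n M n); first exact: bigcupT_measurable.
apply/seteqP; split => [z|z [n _]]; last exact: MO.
rewrite /= in_itv/= andbT => az.
have [n nz] := ltr_add_invr az.
by exists n => //; apply: KM; rewrite /K/=; exact: ltW.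
Qed.

End borel_measurability.

Section continuity.
Context {R : realType} {X : topologicalType}.
Implicit Types f g : X -> R.

Lemma contD f g : continuous f -> continuous g -> continuous (fun x => f x + g x).
Proof. by move=> cf cg x; apply: cvgD; [exact: cf|exact: cg]. Qed.

Lemma contN f : continuous f -> continuous (fun x => - f x).
Proof. by move=> cf x; apply: cvgN; exact: cf. Qed.

Lemma contB f g : continuous f -> continuous g -> continuous (fun x => f x - g x).
Proof. by move=> cf cg; apply: contD => //; exact: contN. Qed.

Lemma contM f g : continuous f -> continuous g -> continuous (fun x => f x * g x).
Proof. by move=> cf cg x; apply: cvgM; [exact: cf|exact: cg]. Qed.

Lemma contX f n : continuous f -> continuous (fun x => f x ^+ n).
Proof.
move=> cf; elim: n => [|n IH]; first exact: cst_continuous.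
rewrite (_ : (fun x => _) = fun x => f x * f x ^+ n); first exact: contM.
by apply/funext => x; rewrite exprS.
Qed.

Lemma contC (a : R) : continuous (fun _ : X => a).
Proof. exact: cst_continuous. Qed.

Lemma open_gt_fun f (a : R) : continuous f -> open [set x | a < f x].
Proof.
move=> /continuousP cf; rewrite (_ : mkset _ = f @^-1` `]a, +oo[).
  by apply: cf; exact: interval_open.
by apply/seteqP; split => x /=; rewrite in_itv/= andbT.
Qed.

End continuity.

Lemma contcomp (X Y Z : topologicalType) (f : Y -> Z) (g : X -> Y) :
  continuous f -> continuous g -> continuous (fun x => f (g x)).
Proof. by move=> cf cg x; apply: continuous_comp; [exact: cg|exact: cf]. Qed.

Section group_continuity.
Context {G : topologicalZmodType} {X : topologicalType}.
Implicit Types f g : X -> G.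

Lemma gcontD f g : continuous f -> continuous g -> continuous (fun x => f x + g x).
Proof.
move=> cf cg x; apply: (@continuous2_cvg _ _ _ _ _ _ f g (fun a b : G => a + b)).
- exact: (@add_continuous G (f x, g x)).
- exact: cf.
- exact: cg.
Qed.

Lemma gcontN f : continuous f -> continuous (fun x => - f x).
Proof. by move=> cf; apply: contcomp => //; exact: opp_continuous. Qed.

Lemma gcontB f g : continuous f -> continuous g -> continuous (fun x => f x - g x).
Proof. by move=> cf cg; apply: gcontD => //; exact: gcontN. Qed.

End group_continuity.

Lemma contid (X : topologicalType) : continuous (fun x : X => x).
Proof. by move=> x; exact: cvg_id. Qed.

Lemma contfst (X Y : topologicalType) : continuous (fun x : X * Y => x.1).
Proof. by move=> x; exact: cvg_fst. Qed.

Lemma contsnd (X Y : topologicalType) : continuous (fun x : X * Y => x.2).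
Proof. by move=> x; exact: cvg_snd. Qed.

Lemma contpair (X Y Z : topologicalType) (f : X -> Y) (g : X -> Z) :
  continuous f -> continuous g -> continuous (fun x => (f x, g x)).
Proof. by move=> cf cg x; apply: cvg_pair; [exact: cf|exact: cg]. Qed.

Ltac gcont := try assumption;
  lazymatch goal with
  | |- forall x, continuous_at _ (fun t => t) => exact: contid
  | |- forall x, continuous_at _ (fun t => t.1) => exact: contfst
  | |- forall x, continuous_at _ (fun t => t.2) => exact: contsnd
  | |- forall x, continuous_at _ (fun _ => ?c) => exact: cst_continuous
  | |- forall x, continuous_at _ (fun t => (@?a t - @?b t)%R) =>
      apply: (@gcontB _ _ a b); gcont
  | |- forall x, continuous_at _ (fun t => (@?a t + @?b t)%R) =>
      apply: (@gcontD _ _ a b); gcont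
  | |- forall x, continuous_at _ (fun t => (- @?a t)%R) =>
      apply: (@gcontN _ _ a); gcont
  | |- forall x, continuous_at _ (fun t => (@?a t, @?b t)) =>
      apply: (@contpair _ _ _ a b); gcont
  end.

Ltac cont := try assumption;
  lazymatch goal with
  | |- forall x, continuous_at _ (fun _ => ?c) => exact: cst_continuous
  | |- forall x, continuous_at _ (fun t => (@?a t - @?b t)%R) =>
      apply: (@contB _ _ a b); cont
  | |- forall x, continuous_at _ (fun t => (@?a t + @?b t)%R) =>
      apply: (@contD _ _ a b); cont
  | |- forall x, continuous_at _ (fun t => (- @?a t)%R) =>
      apply: (@contN _ _ a); cont
  | |- forall x, continuous_at _ (fun t => (@?a t * @?b t)%R) =>
      apply: (@contM _ _ a b); cont
  | |- forall x, continuous_at _ (fun t => (@?a t ^+ ?n)%R) =>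
      apply: (@contX _ _ a n); cont
  | |- forall x, continuous_at _ (fun t => ?f (@?a t)) =>
      apply: (@contcomp _ _ _ f a); [try assumption|gcont]
  | |- _ => idtac
  end.

Section mean.
Context {R : realType} {G : topologicalZmodType}.
Variable mu : probability (borel G) R.
Hypothesis cG : compact [set: G].
Implicit Types f g k : G -> R.

Definition mean f : R := Rintegral mu setT (f : borel G -> R).

Lemma mu_fin : (mu setT < +oo)%E.
Proof. by rewrite (le_lt_trans (probability_le1 _ _))// ltry. Qed.

Lemma mu_setT : mu setT = 1%E.
Proof. exact: probability_setT. Qed.

Lemma continuous_bounded f : continuous f ->
  exists2 M, 0 <= M & forall x, `|f x| <= M.
Proof.
move=> cf.
have : compact (f @` [set: G]).
  by apply: continuous_compact => //; apply: continuous_subspaceT.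
move=> /compact_bounded [M [Mr fM]]; exists (`|M| + 1) => [|x].
  by rewrite addr_ge0.
by apply: fM; [rewrite (le_lt_trans (ler_norm _))// ltrDl|exists x].
Qed.

Lemma bounded_integrable f (M : R) :
  measurable_fun setT (f : borel G -> R) -> (forall x, `|f x| <= M) ->
  mu.-integrable setT (EFin \o f : borel G -> _).
Proof.
move=> mf fM; apply: measurable_bounded_integrable => //; first exact: mu_fin.
exists M; split=> [|N MN x _]; first exact: num_real.
by apply: (le_trans (fM x)); exact: ltW.
Qed.

Lemma continuous_integrable f : continuous f ->
  mu.-integrable setT (EFin \o f : borel G -> _).
Proof.
move=> cf; have [M _ fM] := continuous_bounded cf.
exact: bounded_integrable (continuous_borel_measurable_fun cf) fM.
Qed.

Lemma meanD f g : continuous f -> continuous g ->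
  mean (fun x => f x + g x) = mean f + mean g.
Proof. by move=> cf cg; rewrite /mean RintegralD//; exact: continuous_integrable. Qed.

Lemma meanB f g : continuous f -> continuous g ->
  mean (fun x => f x - g x) = mean f - mean g.
Proof. by move=> cf cg; rewrite /mean RintegralB//; exact: continuous_integrable. Qed.

Lemma meanZ (a : R) f : continuous f -> mean (fun x => a * f x) = a * mean f.
Proof. by move=> cf; rewrite /mean RintegralZl//; exact: continuous_integrable. Qed.

Lemma mean_cst (a : R) : mean (fun=> a) = a.
Proof.
rewrite /mean (Rintegral_cst mu measurableT a) [X in fine X](_ : _ = 1%E) ?mulr1//.
exact: mu_setT.
Qed.

Lemma eq_mean f g : f =1 g -> mean f = mean g.
Proof. by move=> /funext ->. Qed.

Lemma le_mean f g : continuous f -> continuous g -> (forall x, f x <= g x) ->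
  mean f <= mean g.
Proof.
by move=> cf cg fg; apply: le_Rintegral => //; exact: continuous_integrable.
Qed.

Lemma mean_ge0 f : (forall x, 0 <= f x) -> 0 <= mean f.
Proof. by move=> f0; apply: Rintegral_ge0 => x _; exact: f0. Qed.

Lemma norm_mean_le f M : continuous f -> (forall x, `|f x| <= M) ->
  `|mean f| <= M.
Proof.
move=> cf fM; rewrite ler_norml -{1}(mean_cst (- M)) -{2}(mean_cst M).
by apply/andP; split; apply: le_mean => //; try exact: cst_continuous;
  move=> x; have := fM x; rewrite ler_norml => /andP[].
Qed.

Lemma mean_sqM_le f g : continuous f -> continuous g ->
  mean (fun x => f x * g x) ^+ 2 <= mean (fun x => f x ^+ 2) * mean (fun x => g x ^+ 2).
Proof.
move=> cf cg.
set A := mean (fun x => f x ^+ 2); set B := mean (fun x => g x ^+ 2).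
set C := mean _.
have key s t : 0 <= s ^+ 2 * A + 2 * s * t * C + t ^+ 2 * B.
  have -> : s ^+ 2 * A + 2 * s * t * C + t ^+ 2 * B =
            mean (fun x => (s * f x + t * g x) ^+ 2).
    rewrite /A /B /C -!meanZ; cont.
    by rewrite -!meanD; cont; apply: eq_mean => x; ring.
  by apply: mean_ge0 => x; exact: sqr_ge0.
have A0 : 0 <= A by apply: mean_ge0 => x; exact: sqr_ge0.
have B0 : 0 <= B by apply: mean_ge0 => x; exact: sqr_ge0.
(* At s = - C and t = A the form in [key] equals A (A B - C^2). *)
have [A_gt0|A_le0] := ltP 0 A.
  have := key (- C) A.
  rewrite (_ : _ + _ = A * (A * B - C ^+ 2)); last by ring.
  by rewrite pmulr_rge0// subr_ge0.
have A00 : A = 0 by apply/eqP; rewrite eq_le A0 A_le0.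
have [->|C0] := eqVneq C 0; first by rewrite expr0n /= A00 mul0r.
(* With A = 0 the form is affine in s at t = 1, and this s gives it the value -1. *)
have := key (- (B + 1) / (2 * C)) 1; rewrite A00 => h.
suff : 0 <= - (1 : R) by lra.
by apply: (le_trans h); rewrite le_eqVlt; apply/orP; left; apply/eqP; field.
Qed.

(** Continuity gives a box around (x, y) for each y, and compactness in y leaves one neighbourhood
    of x that serves all y. This carries continuity through integration in y. *)
Lemma near_uniform_dist_le (k : G * G -> R) x (e : R) : continuous k -> 0 < e ->
  \forall x' \near x, forall y, `|k (x, y) - k (x', y)| <= e.
Proof.
move=> ck e0.
suff : \forall x' \near x, [set: G] `<=` (fun y => `|k (x, y) - k (x', y)| <= e).
  by apply: filterS => x' kx' y; exact: kx'.
apply: (proj1 (compact_near_coveringP [set: G]) cG) => y _.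
have e20 : 0 < e / 2 by rewrite divr_gt0.
have /cvgrPdist_le/(_ _ e20) [[U V] /= [Ux Vy] UV] := ck (x, y).
exists (V, U) => // -[y' x'] /= [Vy' Ux'].
have := UV (x, y') (conj (nbhs_singleton Ux) Vy').
have := UV (x', y') (conj Ux' Vy').
move=> /= h1 h2; rewrite distrC in h2.
by rewrite (le_trans (ler_distD (k (x, y)) _ _))// (splitr e) lerD.
Qed.

Lemma continuous_mean (k : G * G -> R) : continuous k ->
  continuous (fun x => mean (fun y => k (x, y))).
Proof.
move=> ck x; apply/cvgrPdist_le => /= e e0.
have ckl x' : continuous (fun y => k (x', y)).
  by apply: contcomp => // y; apply: cvg_pair; [exact: cvg_cst|exact: cvg_id].
apply: filterS (near_uniform_dist_le x ck e0) => x' kx'; rewrite -meanB//.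
apply: norm_mean_le; first by cont.
by move=> y; exact: kx'.
Qed.

Lemma continuous_prod_bounded (k : G * G -> R) : continuous k ->
  exists2 M, 0 <= M & forall z, `|k z| <= M.
Proof.
move=> ck.
have : compact (k @` [set: G * G]).
  apply: continuous_compact; first exact: continuous_subspaceT.
  by rewrite -setXTT; exact: compact_setX.
move=> /compact_bounded [M [Mr fM]]; exists (`|M| + 1) => [|x].
  by rewrite addr_ge0.
by apply: fM; [rewrite (le_lt_trans (ler_norm _))// ltrDl|exists x].
Qed.

Lemma mean_fubini (k : G * G -> R) : continuous k ->
  mean (fun x => mean (fun y => k (x, y))) = mean (fun y => mean (fun x => k (x, y))).
Proof.
move=> ck; have [M M0 kM] := continuous_prod_bounded ck.
apply: (@Rintegral_Fubini _ _ _ _ _ mu mu k).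
apply: measurable_bounded_integrable => //.
- rewrite -setXTT (_ : _ (_ `*` _) = 1%E) ?ltry//.
  apply: (etrans (product_measure1E mu mu measurableT measurableT)).
  have mu1 : mu setT = 1%E := mu_setT.
  by rewrite [X in (X * _)%E]mu1 [X in (_ * X)%E]mu1 mule1.
- exact: continuous_prod_borel_measurable_fun.
- exists M; split=> [|N MN x _]; first exact: num_real.
  by apply: (le_trans (kM x)); exact: ltW.
Qed.

End mean.

(** * Invariance and full support of Haar measure *)

Section haar.
Context {R : realType} {G : topologicalZmodType}.
Variable mu : probability (borel G) R.
Hypothesis cG : compact [set: G].
Hypothesis hG : hausdorff_space G.
Hypothesis haar : haar_probability mu.
Implicit Types f g k : G -> R.

Definition translate (y : G) : borel G -> borel G := fun x => (x : G) + y.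

Lemma measurable_translate (y : G) : measurable_fun setT (translate y).
Proof. by apply: continuous_borel_measurable_map; rewrite /translate; gcont. Qed.

Lemma haar_translate (y : G) (A : set (borel G)) : measurable A ->
  mu (translate y @^-1` A) = mu A.
Proof.
move=> mA; have [tr _ _] := haar.
have mB : measurable (translate y @^-1` A).
  by rewrite -[X in measurable X]setTI; apply: measurable_translate.
rewrite -[LHS](tr y)//; congr (mu _); apply/seteqP; split => [_ [x Ax <-]|x Ax].
  by rewrite addrC.
by exists ((x : G) - y); rewrite /= /translate ?subrK// addrC subrK.
Qed.

Lemma ge0_integral_translate (y : G) (f : G -> \bar R) :
  measurable_fun setT (f : borel G -> _) -> (forall x, (0 <= f x)%E) ->
  (\int[mu]_x f (translate y x) = \int[mu]_x f x)%E.
Proof.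
move=> mf f0.
transitivity (\int[pushforward mu (translate y)]_x f x)%E.
  by rewrite (ge0_integral_pushforward (measurable_translate y)).
apply: eq_measure_integral => [|? A mA _]; first exact: measurable_translate.
rewrite /= /pushforward; exact: haar_translate.
Qed.

Lemma integrable_translate (y : G) f :
  mu.-integrable setT (EFin \o f : borel G -> _) ->
  mu.-integrable setT (EFin \o (fun x => f (x + y)) : borel G -> _).
Proof.
move=> /integrableP[mf fi]; apply/integrableP; split.
  exact: (measurableT_comp mf (measurable_translate y)).
rewrite (_ : integral _ _ _ = \int[mu]_x `|(f x)%:E|)%E//.
apply: (@ge0_integral_translate y (abse \o (EFin \o f))) => //.
  by apply: measurableT_comp => //; exact: mf.
by move=> x; exact: abse_ge0.
Qed.

Lemma Rintegral_translate (y : G) f :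
  mu.-integrable setT (EFin \o f : borel G -> _) ->
  mean mu (fun x => f (x + y)) = mean mu f.
Proof.
move=> fi; rewrite /mean /Rintegral; congr fine.
transitivity (\int[pushforward mu (translate y)]_x (f x)%:E)%E.
  rewrite (integral_pushforward (measurable_translate y))//.
    exact: measurable_int fi.
  exact: integrable_translate.
apply: eq_measure_integral => [|? A mA _]; first exact: measurable_translate.
rewrite /= /pushforward; exact: haar_translate.
Qed.

Lemma mean_translate (y : G) f : continuous f ->
  mean mu (fun x => f (x + y)) = mean mu f.
Proof. by move=> cf; apply: Rintegral_translate; exact: continuous_integrable. Qed.

(** Invariance under inversion is derived from that under translation: in the double mean of f (x -
    y), integrating in y first gives the left side and integrating in x first gives the right
    side. *)
Lemma mean_inv f : continuous f -> mean mu (fun x => f (- x)) = mean mu f.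
Proof.
move=> cf; transitivity (mean mu (fun x => mean mu (fun y => f (x - y)))).
  rewrite -[LHS](mean_cst mu); apply: eq_mean => x.
  rewrite -(mean_translate (- x)); last by cont.
  by apply: eq_mean => y; rewrite opprD opprK addrC.
rewrite (@mean_fubini _ _ mu cG (fun z => f (z.1 - z.2))); last by cont.
rewrite -[RHS](mean_cst mu); apply: eq_mean => y /=.
by rewrite (mean_translate (- y)).
Qed.

(** Haar measure charges every nonempty open set: translates of an open null set cover G and finite
    unions of open null sets are null, so compactness would make G null. *)
Lemma mean_gt0 f : continuous f -> (forall x, 0 <= f x) -> (exists x, 0 < f x) ->
  0 < mean mu f.
Proof.
move=> cf f0 [x0 fx0]; have [tr _ _] := haar.
pose U := [set x | f x0 / 2 < f x].
have oU : open U by exact: open_gt_fun.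
have mU := open_borel_measurable oU.
have muU : (0 < mu U)%E.
  rewrite lt0e measure_ge0 andbT; apply/negP => /eqP U0.
  have Ut y : mu (translate y @^-1` U) = 0%E by rewrite haar_translate.
  pose D := [set W : set G | open W /\ mu W = 0%E].
  have [] := @compact_directed_cover _ [set: G] D cG.
  - by exists U.
  - move=> V W [oV V0] [oW W0]; split; first exact: openU.
    have mV := open_borel_measurable oV; have mW := open_borel_measurable oW.
    apply/eqP; rewrite eq_le measure_ge0 andbT.
    have := measureU2 mu mV mW.
    by rewrite [X in (_ <= X + _)%E]V0 [X in (_ <= _ + X)%E]W0 adde0.
  - by move=> V [].
  - move=> x _; exists (translate (x0 - x) @^-1` U : set G); last first.
      by rewrite /U /= /translate addrCA subrr addr0 ltr_pdivrMr// ltr_pMr// ltr1n.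
    split; last exact: Ut.
    suff /continuousP : continuous (fun z : G => z + (x0 - x)) by exact.
    by gcont.
  - move=> W [oW W0] TW; have WT : W = setT by apply/seteqP; split.
    by have := mu_setT mu; rewrite -[X in mu X]WT W0 => /eqP; rewrite eq_sym onee_eq0.
apply: (@lt_le_trans _ _ (f x0 / 2 * fine (mu U))).
  rewrite mulr_gt0 ?divr_gt0// fine_gt0// muU/=.
  by rewrite (le_lt_trans (probability_le1 _ _))// ltry.
have cfi := continuous_integrable mu cG cf.
rewrite -lee_fin /mean EFinM fineK; last first.
  by rewrite ge0_fin_numE// (le_lt_trans (probability_le1 _ _))// ltry.
rewrite /Rintegral fineK; last exact: integrable_fin_num.
rewrite -integral_cst//.
apply: (@le_trans _ _ (\int[mu]_(x in U) (f x)%:E)%E).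
  apply: ge0_le_integral => //.
  - by move=> x _; rewrite lee_fin divr_ge0// ltW.
  - by apply: measurable_funS (measurable_int _ cfi).
  - by move=> x; rewrite /U/= lee_fin => /ltW.
apply: ge0_subset_integral => //.
- exact: (measurable_int _ cfi).
- by move=> x _; rewrite lee_fin.
Qed.

End haar.

(** * Convolution powers and projections *)

Section convolution.
Context {R : realType} {G : topologicalZmodType}.
Variable mu : probability (borel G) R.
Hypothesis cG : compact [set: G].
Hypothesis haar : haar_probability mu.
Implicit Types f g k a b c : G -> R.
Local Notation E := (mean mu).

Definition conv a b (x : G) : R := E (fun y => a y * b (x - y)).

Lemma continuous_conv a b : continuous a -> continuous b -> continuous (conv a b).
Proof.
move=> ca cb.
by apply: (@continuous_mean _ _ mu cG (fun z => a z.2 * b (z.1 - z.2))); cont.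
Qed.

Lemma convC a b : continuous a -> continuous b -> conv a b = conv b a.
Proof.
move=> ca cb; apply/funext => x; rewrite /conv.
rewrite -(mean_inv cG haar); last by cont.
rewrite -(mean_translate cG haar (- x)); last by cont.
by apply: eq_mean => y; rewrite !opprB mulrC addrCA subrr addr0.
Qed.

Lemma conv_translate a b z : conv a (fun x => b (x + z)) = fun x => conv a b (x + z).
Proof. by apply/funext => x; apply: eq_mean => y; rewrite addrAC. Qed.

Lemma convA a b c : continuous a -> continuous b -> continuous c ->
  conv (conv a b) c = conv a (conv b c).
Proof.
move=> ca cb cc; apply/funext => x; rewrite /conv.
transitivity (E (fun z => E (fun y => a y * b (z - y) * c (x - z)))).
  apply: eq_mean => z; rewrite mulrC -meanZ//; last by cont.
  by apply: eq_mean => y; rewrite mulrC.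
rewrite (@mean_fubini _ _ mu cG (fun z => a z.2 * b (z.1 - z.2) * c (x - z.1))); last by cont.
apply: eq_mean => y /=; rewrite -meanZ//; last by cont.
rewrite -(mean_translate cG haar y); last by cont.
by apply: eq_mean => z; rewrite addrK mulrA opprD addrA addrAC.
Qed.

Lemma convDl a b c : continuous a -> continuous b -> continuous c ->
  conv (fun x => a x + b x) c = fun x => conv a c x + conv b c x.
Proof.
move=> ca cb cc; apply/funext => x; rewrite /conv -meanD; cont.
by apply: eq_mean => y; rewrite mulrDl.
Qed.

Lemma convDr a b c : continuous a -> continuous b -> continuous c ->
  conv c (fun x => a x + b x) = fun x => conv c a x + conv c b x.
Proof.
move=> ca cb cc; apply/funext => x; rewrite /conv -meanD; cont.
by apply: eq_mean => y; rewrite mulrDr.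
Qed.

Lemma convZl (s : R) a b : continuous a -> continuous b ->
  conv (fun x => s * a x) b = fun x => s * conv a b x.
Proof.
move=> ca cb; apply/funext => x; rewrite /conv -meanZ; cont.
by apply: eq_mean => y; rewrite mulrA.
Qed.

Lemma convZr (s : R) a b : continuous a -> continuous b ->
  conv a (fun x => s * b x) = fun x => s * conv a b x.
Proof.
move=> ca cb; apply/funext => x; rewrite /conv -meanZ; cont.
by apply: eq_mean => y; rewrite mulrCA.
Qed.

Lemma conv_even a b : continuous a -> continuous b ->
  (forall x, a (- x) = a x) -> (forall x, b (- x) = b x) ->
  forall x, conv a b (- x) = conv a b x.
Proof.
move=> ca cb ea eb x; rewrite /conv -(mean_inv cG haar); last by cont.
by apply: eq_mean => y; rewrite ea -opprB opprK eb addrC -[x in b x]opprK opprD opprK eb addrC.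
Qed.

(** Values at 0 become L^2 inner products; this is how values of convolution powers at 0 serve as
    norms and traces. *)
Lemma conv0 a b : (forall x, b (- x) = b x) -> conv a b 0 = E (fun x => a x * b x).
Proof. by move=> eb; apply: eq_mean => y; rewrite sub0r eb. Qed.

(** Cauchy-Schwarz bounds the uniform norm of a convolution by L^2 norms. It upgrades L^2
    convergence to uniform convergence in the power iteration. *)
Lemma conv_sq_le a b x : continuous a -> continuous b ->
  conv a b x ^+ 2 <= E (fun x => a x ^+ 2) * E (fun x => b x ^+ 2).
Proof.
move=> ca cb.
rewrite -(mean_inv cG haar (f := fun y => b y ^+ 2)); last by cont.
rewrite -[X in _ * X](mean_translate cG haar (- x)); last by cont.
apply: le_trans (mean_sqM_le mu cG ca (g := fun y => b (x - y)) _) _; first by cont.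
by rewrite (_ : (fun y => b (- (y - x)) ^+ 2) = fun y => b (x - y) ^+ 2)//;
  apply/funext => y; rewrite opprB.
Qed.

End convolution.

Lemma uniform_cauchy_limit {R : realType} (X : Type) (f : nat -> X -> R) (d : nat -> R) :
  (forall n m x, (n <= m)%N -> `|f n x - f m x| <= d n) ->
  exists g : X -> R, forall n x, `|f n x - g x| <= d n.
Proof.
move=> fd.
have le2 n m x : f n x - d n <= f m x + d m.
  have [nm|/ltnW mn] := leqP n m.
    have := fd _ _ x nm; have := fd _ _ x (leqnn m); rewrite subrr normr0.
    by rewrite ler_norml; lra.
  have := fd _ _ x mn; have := fd _ _ x (leqnn n); rewrite subrr normr0.
  by rewrite ler_norml; lra.
(* A limit has to lie between f n x - d n and f n x + d n for every n. By [le2] each lower bound is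
   below every upper bound, so the supremum of the lower bounds qualifies. *)
exists (fun x => sup (range (fun n => f n x - d n))) => n x.
have hs : has_sup (range (fun n => f n x - d n)).
  split; first by exists (f 0%N x - d 0%N), 0%N.
  by exists (f 0%N x + d 0%N) => _ [m _ <-]; exact: le2.
have h1 : f n x - d n <= sup (range (fun n => f n x - d n)).
  by apply: ub_le_sup; [exact: hs.2|exists n].
have h2 : sup (range (fun n => f n x - d n)) <= f n x + d n.
  by apply: ge_sup; [exact: hs.1|move=> _ [m _ <-]; exact: le2].
by rewrite ler_norml; apply/andP; split; lra.
Qed.

Lemma continuous_uniform_limit {R : realType} (X : topologicalType)
    (f : nat -> X -> R) (g : X -> R) (d : nat -> R) :
  d n @[n --> \oo] --> 0 -> (forall n, continuous (f n)) ->
  (forall n x, `|f n x - g x| <= d n) -> continuous g.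
Proof.
move=> d0 cf fg x; apply/cvgrPdist_le => e e0.
have e30 : 0 < e / 3 by rewrite divr_gt0.
have [n _ /(_ n (leqnn _)) dn] : \forall n \near \oo, `|d n| <= e / 3.
  exact: cvgr0_norm_le.
have dn' : d n <= e / 3 by exact: le_trans (ler_norm _) dn.
have /cvgrPdist_le/(_ _ e30) := cf n x.
apply: filterS => y fxy.
have := fg n x; have := fg n y; move: fxy; rewrite !ler_norml; lra.
Qed.

Lemma le0_of_le_cvg0 {R : realType} (a c : R) (d : nat -> R) :
  d n @[n --> \oo] --> 0 -> (forall n, a <= c * d n) -> a <= 0.
Proof.
move=> d0 ad; rewrite -(mulr0 c).
have cd : c * d n @[n --> \oo] --> c * 0 by apply: cvgM => //; exact: cvg_cst.
by apply: (cvgr_to_ge cd); apply: nearW.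
Qed.

(* For t n = \sum_i m_i ^+ n.+1 with 0 <= m_i the limit is the multiplicity of
   the largest m_i, which is lam. *)
Lemma logconvex_submul_growth {R : realType} (t : nat -> R) :
  (forall n, 0 < t n) -> (forall n, t n.+1 ^+ 2 <= t n * t n.+2) ->
  (forall n m, t (n + m).+1 <= t n * t m) ->
  exists2 lam, 0 < lam & (forall n, 1 <= t n / lam ^+ n.+1) /\
    {homo (fun n => t n / lam ^+ n.+1) : n m / (n <= m)%N >-> m <= n}.
Proof.
move=> t_gt0 t_logconvex t_submul.
(* Log-convexity makes the ratios increase and submultiplicativity bounds them by t 0, so they
   converge to the growth rate [lam]. *)
pose r n := t n.+1 / t n.
have r_nd : {homo r : n m / (n <= m)%N >-> n <= m}.
  apply/nondecreasing_seqP => n.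
  rewrite /r ler_pdivrMr// mulrAC ler_pdivlMr// -expr2 mulrC.
  exact: t_logconvex.
have r_ub n : r n <= t 0%N.
  rewrite /r ler_pdivrMr//.
  by have := t_submul 0%N n; rewrite add0n.
have r_cvg : cvgn r.
  apply: nondecreasing_is_cvgn => //; exists (t 0%N) => _ [n _ <-]; exact: r_ub.
pose lam := limn r.
have r_le n : r n <= lam by exact: nondecreasing_cvgn_le.
have lam_gt0 : 0 < lam by apply: lt_le_trans (r_le 0%N); rewrite divr_gt0.
have t_ge_lam n : lam ^+ n.+1 <= t n.
  (* Increasing ratios give r m ^ k * t m <= t (m + k). For k = n + 1 the right side is at most t n
     * t m, and cancelling t m leaves r m ^ (n + 1) <= t n, whose limit in m is wanted. *)
  have tr m k : r m ^+ k * t m <= t (m + k)%N.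
    elim: k => [|k IH]; first by rewrite expr0 mul1r addn0.
    rewrite exprS -mulrA addnS.
    have r0 i : 0 <= r i by rewrite divr_ge0// ltW.
    apply: (@le_trans _ _ (r (m + k)%N * t (m + k)%N)).
      apply: ler_pM => //; first by rewrite mulr_ge0// ?exprn_ge0// ltW.
      exact/r_nd/leq_addr.
    by rewrite /r divfK// gt_eqF.
  have rt m : r m ^+ n.+1 <= t n.
    rewrite -(ler_pM2r (t_gt0 m)); apply: le_trans (tr m n.+1) _.
    by rewrite addnS addnC; exact: t_submul.
  have rX : r m ^+ n.+1 @[m --> \oo] --> lam ^+ n.+1.
    exact: (cvg_comp _ _ r_cvg (@exprn_continuous _ n.+1 lam)).
  by apply: (cvgr_to_le rX); exact: nearW.
exists lam => //; have lamX n : 0 < lam ^+ n by rewrite exprn_gt0.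
split=> [n|]; first by rewrite ler_pdivlMr// mul1r.
apply/nonincreasing_seqP => n; rewrite ler_pdivrMr// mulrAC ler_pdivlMr//.
rewrite [lam ^+ n.+2]exprS mulrA ler_pM2r//.
by have := r_le n; rewrite /r ler_pdivrMr// mulrC.
Qed.

(** * Power iteration in the convolution algebra *)

Section power_limit.
Context {R : realType} {G : topologicalZmodType}.
Variable mu : probability (borel G) R.
Hypothesis cG : compact [set: G].
Hypothesis haar : haar_probability mu.
Local Notation E := (mean mu).
Local Notation conv := (conv mu).
(** [p n] stands for the (n + 1)-st convolution power of [p 0], whence the successor in [pconv]. *)
Variable p : nat -> G -> R.
Hypothesis cp : forall n, continuous (p n).
Hypothesis ep : forall n x, p n (- x) = p n x.
Hypothesis pconv : forall i j, conv (p i) (p j) = p (i + j).+1.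
Hypothesis p0 : exists x, p 0%N x != 0.

(** The squared L^2 norm of [p n], equally the trace of the (n + 1)-st power of convolution by
    [p 1]. That operator is the square of convolution by [p 0], so its eigenvalues are
    nonnegative. *)
Let t n := p n.*2.+1 0.

Let tE n m : E (fun x => p n.*2.+1 x * p m.*2.+1 x) = t (n + m).+1.
Proof.
rewrite -conv0; last by move=> x; exact: ep.
by rewrite pconv /t; congr (p _ _); rewrite doubleS doubleD addSn addnS.
Qed.

Let tsq n : t n = E (fun x => p n x ^+ 2).
Proof.
rewrite /t -addnn -pconv conv0; last by move=> x; exact: ep.
by apply: eq_mean => x; rewrite expr2.
Qed.

Let t_ge0 n : 0 <= t n.
Proof. by rewrite tsq; apply: mean_ge0 => x; exact: sqr_ge0. Qed.

Let le_theta n x : `|p n.*2.+1 x| <= t n.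
Proof.
rewrite -(ler_pXn2r (n := 2)) ?nnegrE ?normr_ge0 ?t_ge0// real_normK ?num_real//.
rewrite -[X in p X x]/((n.*2).+1) -{1}addnn -pconv expr2 !tsq.
exact: (conv_sq_le cG haar x (@cp n) (@cp n)).
Qed.

Let t_submul n m : t (n + m).+1 <= t n * t m.
Proof.
rewrite -tE; apply: le_trans (ler_norm _) _; apply: norm_mean_le.
- exact: cG.
- exact: (contM (@cp _) (@cp _)).
- by move=> x; rewrite normrM; apply: ler_pM.
Qed.

Let t_logconvex n : t n.+1 ^+ 2 <= t n * t n.+2.
Proof.
have -> : t n.+1 = E (fun x => p n x * p n.+2 x).
  rewrite -conv0; last by move=> x; exact: ep.
  by rewrite pconv /t; congr (p _ _); rewrite -addnn !addnS addSn.
by rewrite !tsq; apply: mean_sqM_le; [exact: cG|exact: cp|exact: cp].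
Qed.

Let t0_gt0 : 0 < t 0%N.
Proof.
rewrite tsq; apply: (mean_gt0 cG haar) => /=.
- exact: (contX (@cp _)).
- by move=> x; exact: sqr_ge0.
- by case: p0 => x px; exists x; rewrite exprn_even_gt0.
Qed.

Let t1_gt0 : 0 < t 1%N.
Proof.
rewrite tsq; apply: (mean_gt0 cG haar).
- exact: (contX (@cp _)).
- by move=> x; exact: sqr_ge0.
- by exists 0; rewrite exprn_even_gt0//= gt_eqF//; exact: t0_gt0.
Qed.

Let t_gt0 n : 0 < t n.
Proof.
suff : 0 < t n /\ 0 < t n.+1 by case.
elim: n => [|n [tn tn1]]; split; [exact: t0_gt0|exact: t1_gt0|exact: tn1|].
have h := lt_le_trans (exprn_gt0 2 tn1) (t_logconvex n).
by rewrite pmulr_rgt0 in h.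
Qed.

(** The normalised powers K n of theta = [p 1] have inner products E (K n * K m) = b (n + m + 1)
    with b decreasing to a limit, so they are Cauchy in L^2. One more convolution by theta makes the
    convergence uniform. The limit is the idempotent onto the top eigenspace. *)
Lemma power_limit : exists2 g : G -> R,
  [/\ continuous g, forall x, g (- x) = g x, conv g g = g & 1 <= g 0] &
  exists2 lam, 0 < lam & conv (p 1%N) g = fun x => lam * g x.
Proof.
have [lam lam_gt0 [b_ge1 b_ni]] := logconvex_submul_growth t_gt0 t_logconvex t_submul.
pose b n := t n / lam ^+ n.+1.
rewrite -/b in b_ni; have {}b_ge1 n : 1 <= b n by exact: b_ge1.
have b_cvg : cvgn b.
  by apply: nonincreasing_is_cvgn => //; exists 1 => _ [n _ <-]; exact: b_ge1.
pose c := limn b.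
have b_ge n : c <= b n by exact: nonincreasing_cvgn_ge.
pose K n : G -> R := fun x => (lam ^+ n.+1)^-1 * p n.*2.+1 x.
have cK n : continuous (K n) by apply: contM; [exact: contC|exact: cp].
have KE n m : E (fun x => K n x * K m x) = b (n + m).+1.
  rewrite /b -tE mulrC -meanZ; [|exact: cG|exact: (contM (@cp _) (@cp _))].
  by apply: eq_mean => x; rewrite /K mulrACA -invfM -exprD addSn addnS.
pose theta := p 1%N.
have ctheta : continuous theta by exact: cp.
have KS n : conv theta (K n) = fun x => lam * K n.+1 x.
  rewrite /K /theta convZr; [|exact: cG|exact: cp|exact: cp].
  apply/funext => x; rewrite pconv add1n doubleS mulrA; congr (_ * _).
  by rewrite [lam ^+ n.+2]exprS invfM mulrA divff ?mul1r// gt_eqF.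
have cZ (s : R) n : continuous (fun x => s * K n x) by apply: contM; [exact: contC|exact: cK].
pose M := E (fun x => theta x ^+ 2).
have M_ge0 : 0 <= M by apply: mean_ge0 => x; exact: sqr_ge0.
have lamV : 0 < (lam ^+ 2)^-1 by rewrite invr_gt0 exprn_gt0.
(* For n <= m the squared L^2 distance of K n and K m is b (2n + 1) - 2 b (n + m + 1) + b (2m + 1),
   at most b (2n + 1) - c by monotonicity. The factor M / lam^2 is the cost of passing to the
   uniform norm. *)
pose eps n := (lam ^+ 2)^-1 * M * (b n.*2.+1 - c).
have K_cauchy n m x : (n <= m)%N -> (K n.+1 x - K m.+1 x) ^+ 2 <= eps n.
  move=> nm.
  have cD : continuous (fun x => K n x + -1 * K m x) by apply: contD.
  have e1 : lam * (K n.+1 x - K m.+1 x) = conv theta (fun x => K n x + -1 * K m x) x.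
    rewrite convDr; [|exact: cG|exact: cK|exact: cZ|exact: ctheta].
    rewrite (@convZr _ _ mu cG (-1) theta (K m) ctheta (@cK m)).
    by rewrite !KS mulN1r mulrBr.
  rewrite /eps -mulrA -(ler_pM2l (exprn_gt0 2 lam_gt0)) mulVKf ?gt_eqF ?exprn_gt0//.
  rewrite -exprMn e1; apply: le_trans (conv_sq_le cG haar x ctheta cD) _.
  rewrite -/M; apply: ler_wpM2l => //.
  have -> : E (fun x => (K n x + -1 * K m x) ^+ 2) =
      b n.*2.+1 + (- 2 * b (n + m).+1 + b m.*2.+1).
    have cnm := contM (@cK n) (@cK m); have cnn := contM (@cK n) (@cK n).
    have cmm := contM (@cK m) (@cK m).
    have c2 : continuous (fun x => -2 * (K n x * K m x)) by apply: contM; [exact: contC|exact: cnm].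
    rewrite -!addnn -!KE -(meanZ _ cG _ cnm) -(meanD _ cG c2 cmm) -(meanD _ cG cnn (contD c2 cmm)).
    by apply: eq_mean => y; ring.
  have h1 : b m.*2.+1 <= b (n + m).+1 by apply: b_ni; rewrite ltnS -addnn leq_add2r.
  have := b_ge (n + m).+1; lra.
pose d n := Num.sqrt (eps n).
have eps_ge0 n : 0 <= eps n.
  by apply: le_trans (K_cauchy n n 0 (leqnn _)); exact: sqr_ge0.
have d2 n : d n ^+ 2 = eps n by rewrite sqr_sqrtr.
have d_ge0 n : 0 <= d n by exact: sqrtr_ge0.
have eps_cvg : eps n @[n --> \oo] --> 0.
  rewrite -[X in _ --> X](mulr0 ((lam ^+ 2)^-1 * M)).
  apply: cvgM; first exact: cvg_cst.
  rewrite -[X in _ --> X](subrr c); apply: cvgB; last exact: cvg_cst.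
  apply: (@cvg_comp _ _ _ (fun n => n.*2.+1) b _ _ _ _ b_cvg).
  apply/cvgnyPge => A; exists A => // n /= An.
  by rewrite (leq_trans An)// (leq_trans _ (leqnSn _))// -addnn leq_addr.
have d_cvg : d n @[n --> \oo] --> 0.
  by rewrite -[X in _ --> X]sqrtr0; apply: (cvg_comp _ _ eps_cvg); exact: sqrt_continuous.
have [g Kg] : exists g : G -> R, forall n x, `|K n.+1 x - g x| <= d n.
  apply: uniform_cauchy_limit => n m x nm.
  by rewrite -sqrtr_sqr ler_wsqrtr// K_cauchy.
have cg : continuous g.
  by apply: (continuous_uniform_limit d_cvg _ Kg) => n; exact: cK.
have cKg n : continuous (fun x => g x + -1 * K n x) by apply: contD => //; exact: cZ.
have Kg2 n : E (fun x => (g x + -1 * K n.+1 x) ^+ 2) <= eps n.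
  rewrite -[leRHS](mean_cst mu); apply: le_mean => //.
  - exact: (contX (@cKg _)).
  - exact: cst_continuous.
  - move=> x; rewrite -d2 -real_normK ?num_real//.
    by rewrite ler_pXn2r ?nnegrE// mulN1r distrC.
have eg x : g (- x) = g x.
  apply/eqP; rewrite -subr_eq0 -normr_le0.
  apply: (@le0_of_le_cvg0 _ _ 2 _ d_cvg) => n.
  have := Kg n x; have := Kg n (- x); rewrite /K ep.
  set y := _ * p _ _; rewrite !ler_norml; lra.
have tg : conv theta g = fun x => lam * g x.
  apply/funext => x; apply/eqP; rewrite -subr_eq0 -sqrf_eq0 eq_le sqr_ge0 andbT.
  have eps1_cvg : eps n + eps n.+1 @[n --> \oo] --> 0.
    by rewrite -[X in _ --> X]addr0; apply: cvgD => //; rewrite cvg_shiftS.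
  apply: (@le0_of_le_cvg0 _ _ (2 * M + 2 * lam ^+ 2) _ eps1_cvg) => n.
  have e1 : conv theta g x - lam * g x =
      conv theta (fun x => g x + -1 * K n.+1 x) x - lam * (g x - K n.+2 x).
    rewrite convDr; [|exact: cG|exact: cg|exact: cZ|exact: ctheta].
    rewrite (@convZr _ _ mu cG (-1) theta (K n.+1) ctheta (@cK n.+1)).
    by rewrite KS; ring.
  have h1 := le_trans (conv_sq_le cG haar x ctheta (@cKg n.+1)) (ler_wpM2l M_ge0 (Kg2 n)).
  have h2 : (g x - K n.+2 x) ^+ 2 <= eps n.+1.
    by rewrite -d2 -real_normK ?num_real// ler_pXn2r ?nnegrE// distrC.
  have h3 : (lam * (g x - K n.+2 x)) ^+ 2 <= lam ^+ 2 * eps n.+1.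
    by rewrite exprMn ler_pM2l// exprn_gt0.
  rewrite e1; move: h1 h3; set A := conv _ _ _; set B := lam * (_ - _) => h1 h3.
  have h4 : 0 <= M * eps n.+1 by rewrite mulr_ge0.
  have h5 : 0 <= lam ^+ 2 * eps n by rewrite mulr_ge0// exprn_ge0// ltW.
  have h6 := sqr_ge0 (A + B); rewrite -/M in h1; nra.
(* By the eigenvalue equation [tg] every K n acts on [g] as the identity, so g is idempotent in the
   limit; K n 0 = b n >= 1 passes to [g 0]. *)
have Kgg n : conv (K n) g = g.
  elim: n => [|n IH].
    rewrite /K convZl; [|exact: cG|exact: cp|exact: cg].
    rewrite -[p _]/theta tg; apply/funext => x.
    by rewrite expr1 mulrA mulVf ?mul1r// gt_eqF.
  have : conv (fun x => lam * K n.+1 x) g = fun x => lam * g x.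
    by rewrite -KS convA ?IH ?tg.
  rewrite (@convZl _ _ mu cG lam (K n.+1) g (@cK n.+1) cg).
  by move=> h; apply/funext => x; apply: (mulfI (lt0r_neq0 lam_gt0)); exact: (congr1 (@^~ x) h).
exists g; first split => //.
- apply/funext => x; apply/eqP; rewrite -subr_eq0 -sqrf_eq0 eq_le sqr_ge0 andbT.
  apply: (@le0_of_le_cvg0 _ _ (E (fun x => g x ^+ 2)) _ eps_cvg) => n.
  have -> : conv g g x - g x = conv (fun x => g x + -1 * K n.+1 x) g x.
    rewrite convDl; [|exact: cG|exact: cg|exact: cZ|exact: cg].
    rewrite (@convZl _ _ mu cG (-1) (K n.+1) g (@cK n.+1) cg).
    by rewrite Kgg mulN1r.
  apply: le_trans (conv_sq_le cG haar x (@cKg _) cg) _.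
  rewrite mulrC ler_wpM2l//; first by apply: mean_ge0 => y; exact: sqr_ge0.
- rewrite -subr_ge0 -oppr_le0.
  apply: (@le0_of_le_cvg0 _ _ 1 _ d_cvg) => n.
  have := Kg n 0; have := b_ge1 n.+1; rewrite /K mulrC -/(t n.+1) -/(b n.+1).
  rewrite !ler_norml; lra.
- by exists lam.
Qed.

End power_limit.

Section power_projection.
Context {R : realType} {G : topologicalZmodType}.
Variable mu : probability (borel G) R.
Hypothesis cG : compact [set: G].
Hypothesis haar : haar_probability mu.
Local Notation conv := (conv mu).

(** [lam] is the largest eigenvalue of convolution by [conv phi phi] and [g] the kernel of the
    projection onto its eigenspace; [g 0] is the trace of that projection, which explains the lower
    bound 1. *)
Lemma power_projection (phi : G -> R) : continuous phi ->
  (forall x, phi (- x) = phi x) -> (exists x, phi x != 0) ->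
  exists2 g : G -> R,
  [/\ continuous g, forall x, g (- x) = g x, conv g g = g & 1 <= g 0] &
  exists2 lam, 0 < lam & conv (conv phi phi) g = fun x => lam * g x.
Proof.
move=> cphi ephi phi0.
pose cpow := fix cpow n := if n is n'.+1 then conv phi (cpow n') else phi.
have cp n : continuous (cpow n).
  by elim: n => [|n IH]; [exact: cphi|apply: continuous_conv].
apply: (@power_limit _ _ mu cG haar cpow) => //.
- elim=> [|n IH]; first exact: ephi.
  by apply: (conv_even cG haar cphi (cp n) ephi).
- elim=> [|i IH] j; first by [].
  rewrite -[cpow i.+1]/(conv phi (cpow i)) convA; [|exact: cG|exact: haar|exact: cphi|exact: cp|exact: cp].
  by rewrite IH.
Qed.

End power_projection.

(** * Characters *)

Section complex_modulus.
Context {R : realType}.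
Implicit Types z : R[i].
Local Notation Re := (@complex.Re R).
Local Notation Im := (@complex.Im R).

Lemma ler_Re_normc z : `|Re z| <= Normc.normc z.
Proof.
case: z => a b /=; rewrite -sqrtr_sqr ler_wsqrtr// lerDl; exact: sqr_ge0.
Qed.

Lemma ler_Im_normc z : `|Im z| <= Normc.normc z.
Proof.
case: z => a b /=; rewrite -sqrtr_sqr ler_wsqrtr// lerDr; exact: sqr_ge0.
Qed.

Lemma normc_ge0 z : 0 <= Normc.normc z.
Proof. by case: z => a b; exact: sqrtr_ge0. Qed.

Lemma normc_le_ReIm z : Normc.normc z <= `|Re z| + `|Im z|.
Proof.
case: z => a b /=; rewrite -(ler_pXn2r (n := 2))// ?nnegrE ?sqrtr_ge0 ?addr_ge0//.
rewrite sqr_sqrtr ?addr_ge0 ?sqr_ge0// sqrrD !real_normK ?num_real//.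
by rewrite addrAC lerDl mulrn_wge0// mulr_ge0.
Qed.

Lemma normrc z : `|z| = (Normc.normc z)%:C.
Proof. by rewrite normc_def; case: z. Qed.

Lemma cvg_complex T (F : set_system T) (FF : Filter F) (f g : T -> R) (a b : R) :
  f x @[x --> F] --> a -> g x @[x --> F] --> b ->
  (fun x => f x +i* g x : R[i]^o) @ F --> (a +i* b : R[i]^o).
Proof.
(* The norm of R[i] takes values in R[i], so a positive [e] is a complex number with zero imaginary
   part. *)
move=> fa gb; apply/cvgrPdist_le => e; rewrite ltcE => /andP[/eqP/= e1 e0].
have e20 : 0 < Re e / 2 by rewrite divr_gt0.
have /cvgrPdist_le/(_ _ e20) fa' := fa; have /cvgrPdist_le/(_ _ e20) gb' := gb.
near=> x; rewrite normrc lecE /= -e1 eqxx/=.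
apply: (le_trans (normc_le_ReIm ((a - f x) +i* (b - g x)))).
rewrite (splitr (Re e)) lerD//=.
  by near: x.
by near: x.
Unshelve. all: by end_near. Qed.

Lemma cvg_Re T (F : set_system T) (FF : Filter F) (f : T -> R[i]^o) (z : R[i]^o) :
  f x @[x --> F] --> z -> Re (f x) @[x --> F] --> Re z.
Proof.
move=> fz; apply/cvgrPdist_le => e e0.
have e0' : 0 < e%:C :> R[i] by rewrite ltcR.
have /cvgrPdist_le/(_ _ e0') := fz; apply: filterS => x.
rewrite normrc lecR; apply: le_trans.
by have := ler_Re_normc (z - f x); case: z {fz} => a b; case: (f x).
Qed.

Lemma cvg_Im T (F : set_system T) (FF : Filter F) (f : T -> R[i]^o) (z : R[i]^o) :
  f x @[x --> F] --> z -> Im (f x) @[x --> F] --> Im z.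
Proof.
move=> fz; apply/cvgrPdist_le => e e0.
have e0' : 0 < e%:C :> R[i] by rewrite ltcR.
have /cvgrPdist_le/(_ _ e0') := fz; apply: filterS => x.
rewrite normrc lecR; apply: le_trans.
by have := ler_Im_normc (z - f x); case: z {fz} => a b; case: (f x).
Qed.

End complex_modulus.

Section characters.
Context {R : realType} {G : topologicalZmodType}.
Implicit Types chi : G -> R[i].
Local Notation Re := (@complex.Re R).
Local Notation Im := (@complex.Im R).

Lemma character_Re_continuous chi : character chi -> continuous (fun x => Re (chi x)).
Proof. by move=> [cchi _ _] x; apply: cvg_Re; exact: cchi. Qed.

Lemma character_Im_continuous chi : character chi -> continuous (fun x => Im (chi x)).
Proof. by move=> [cchi _ _] x; apply: cvg_Im; exact: cchi. Qed.

Lemma character_ReD chi x y : character chi ->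
  Re (chi (x + y)) = Re (chi x) * Re (chi y) - Im (chi x) * Im (chi y).
Proof. by move=> [_ -> _]; case: (chi x) => a b; case: (chi y). Qed.

Lemma character_ImD chi x y : character chi ->
  Im (chi (x + y)) = Re (chi x) * Im (chi y) + Im (chi x) * Re (chi y).
Proof. by move=> [_ -> _]; case: (chi x) => a b; case: (chi y). Qed.

Lemma character_normc chi x : character chi -> Normc.normc (chi x) = 1.
Proof. by move=> [_ _ /(_ x)]; rewrite normrc => -[]. Qed.

Lemma character_sqr chi x : character chi -> Re (chi x) ^+ 2 + Im (chi x) ^+ 2 = 1.
Proof.
move=> hchi; move: (character_normc x hchi); case: (chi x) => a b /= h.
by rewrite -[LHS]sqr_sqrtr ?addr_ge0 ?sqr_ge0// h expr1n.
Qed.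

Lemma character0 chi : character chi -> chi 0 = 1.
Proof.
move=> hchi; have [_ cM _] := hchi.
have c0 : chi 0 != 0.
  by apply/eqP => c0; have := character_normc 0 hchi; rewrite c0 Normc.normc0 => /eqP; rewrite eq_sym oner_eq0.
by apply: (mulfI c0); rewrite mulr1 -cM addr0.
Qed.

Lemma characterN chi x : character chi -> chi (- x) = (chi x)^*.
Proof.
move=> hchi; have [_ cM _] := hchi.
have := cM x (- x); rewrite subrr character0// => h.
have e := character_sqr x hchi.
have cx : chi x * (chi x)^* = 1.
  case: (chi x) e => a b /= e; apply/eqP; rewrite eq_complex /=.
  by apply/andP; split; apply/eqP; [rewrite -e|]; ring.
have c0 : chi x != 0.
  by apply/eqP => c0; move: cx; rewrite c0 mul0r => /eqP; rewrite eq_sym oner_eq0.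
by apply: (mulfI c0); rewrite -h cx.
Qed.

Lemma character_ReN chi x : character chi -> Re (chi (- x)) = Re (chi x).
Proof. by move=> hchi; rewrite characterN//; case: (chi x). Qed.

Lemma character_ImN chi x : character chi -> Im (chi (- x)) = - Im (chi x).
Proof. by move=> hchi; rewrite characterN//; case: (chi x). Qed.

Lemma character_conj chi : character chi -> character (fun x => (chi x)^*).
Proof.
move=> hchi; split.
- move=> x; rewrite (_ : (fun x => _) = fun x => Re (chi x) +i* (- Im (chi x))).
    apply: cvg_complex; first exact: character_Re_continuous.
    by apply: cvgN; exact: character_Im_continuous.
  by apply/funext => y; case: (chi y).
- by move=> x y; have [_ -> _] := hchi; rewrite rmorphM.
- by move=> x; have [_ _ /(_ x)] := hchi; rewrite normcJ.
Qed.

(* The sine belonging to the cosine C is S x = (C (x - y0) - C (x + y0)) / (2 * S y0),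
   where y0 is any point with C y0 ^+ 2 < 1. *)
Lemma dalembert_character (C : G -> R) : continuous C -> C 0 = 1 ->
  (forall x, `|C x| <= 1) ->
  (forall x y, C (x + y) + C (x - y) = 2 * C x * C y) ->
  exists chi, character chi /\ forall x, Re (chi x) = C x.
Proof.
move=> cC C0 C1 CD.
have CN y : C (- y) = C y by have := CD 0 y; rewrite add0r sub0r C0; lra.
have C2 x : C (x + x) = 2 * C x ^+ 2 - 1.
  by have := CD x x; rewrite subrr C0 expr2 mulrA; lra.
(* If C^2 = 1 everywhere, no sine can be formed, but C is itself a character: C (x + y) and C (x -
   y) are signs whose sum 2 C x C y is 2 or -2, so both equal C x C y. *)
have [[y0 Cy0]|noy] := pselect (exists y, C y ^+ 2 < 1); last first.
  have Csq y : C y ^+ 2 = 1.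
    apply/eqP; rewrite eq_le; apply/andP; split.
      by rewrite -real_normK ?num_real// expr_le1.
    by rewrite leNgt; apply/negP => h; apply: noy; exists y.
  have CM x y : C (x + y) = C x * C y.
    have := CD x y; have := Csq (x + y); have := Csq (x - y).
    have := Csq x; have := Csq y.
    move: (C _) (C _) (C x) (C y) => a b c d; rewrite !expr2 => hd hc hb ha h.
    nra.
  exists (fun x => (C x)%:C); split=> //; split.
  - by move=> x; apply: cvg_complex; [exact: cC|exact: cvg_cst].
  - by move=> x y; rewrite CM rmorphM.
  - move=> x; rewrite normrc /= expr0n/= addr0 sqrtr_sqr.
    suff -> : `|C x| = 1 by [].
    by apply/eqP; rewrite -(@eqrXn2 _ 2)// expr1n real_normK ?num_real// Csq.
pose s := Num.sqrt (1 - C y0 ^+ 2).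
have s2 : s ^+ 2 = 1 - C y0 ^+ 2 by rewrite sqr_sqrtr// subr_ge0 ltW.
have s0 : s != 0 by rewrite sqrtr_eq0 -ltNge subr_gt0.
pose S x := (C (x - y0) - C (x + y0)) / (2 * s).
have cS : continuous S.
  rewrite /S; apply: contM; last exact: contC.
  by cont.
have SN y : S (- y) = - S y.
  rewrite /S -mulNr opprB; congr (_ / _); rewrite -[C (- y - y0)]CN -[C (- y + y0)]CN.
  by rewrite !opprD !opprK.
have SD x y : S (x + y) + S (x - y) = 2 * S x * C y.
  have h1 := CD (x - y0) y; have h2 := CD (x + y0) y.
  rewrite /S (addrAC x y) (addrAC x y y0) (addrAC x (- y)) (addrAC x (- y) y0).
  rewrite -mulrDl mulrA mulrAC; congr (_ / _).
  by rewrite mulrBr mulrBl -h1 -h2; ring.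
(* Expand the product of the two numerators by d'Alembert's equation: the shifts by 2 y0 recombine
   into a factor 1 - C (2 y0) = 2 s^2, which cancels against the denominators. *)
have SS x y : S x * S y = (C (x - y) - C (x + y)) / 2.
  have h1 := CD (x - y0) (y - y0); have h2 := CD (x - y0) (y + y0).
  have h3 := CD (x + y0) (y - y0); have h4 := CD (x + y0) (y + y0).
  have e1 : x - y0 + (y - y0) = x + y - (y0 + y0) by rewrite addrACA opprD.
  have e2 : x - y0 - (y - y0) = x - y by rewrite opprB addrA subrK.
  have e3 : x - y0 + (y + y0) = x + y by rewrite addrACA addNr addr0.
  have e4 : x - y0 - (y + y0) = x - y - (y0 + y0) by rewrite opprD addrACA opprD.
  have e5 : x + y0 + (y - y0) = x + y by rewrite addrACA subrr addr0.
  have e6 : x + y0 - (y - y0) = x - y + (y0 + y0) by rewrite opprB addrACA [y0 - y]addrC addrA -addrA addrACA.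
  have e7 : x + y0 + (y + y0) = x + y + (y0 + y0) by rewrite addrACA.
  have e8 : x + y0 - (y + y0) = x - y by rewrite opprD addrACA subrr addr0.
  rewrite e1 e2 in h1; rewrite e3 e4 in h2; rewrite e5 e6 in h3; rewrite e7 e8 in h4.
  have h5 := CD (x + y) (y0 + y0); have h6 := CD (x - y) (y0 + y0).
  rewrite C2 in h5 h6.
  apply: (@mulfI _ (4 * s ^+ 2)); first by rewrite mulf_neq0// expf_neq0.
  have -> : 4 * s ^+ 2 * (S x * S y) =
    (C (x - y0) - C (x + y0)) * (C (y - y0) - C (y + y0)).
    by rewrite /S; field.
  have -> : 4 * s ^+ 2 * ((C (x - y) - C (x + y)) / 2) =
    2 * s ^+ 2 * (C (x - y) - C (x + y)) by field.
  rewrite s2; lra.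
have SDx x y : S (x + y) = S x * C y + C x * S y.
  have h1 := SD x y; have h2 := SD y x.
  rewrite -opprB SN addrC in h2; rewrite [y + x]addrC in h2; lra.
exists (fun x => C x +i* S x); split=> //; split.
- by move=> x; apply: cvg_complex; [exact: cC|exact: cS].
- move=> x y; have h1 := SS x y; have h2 := CD x y; simpc; congr (_ +i* _).
    by rewrite h1; lra.
  by rewrite SDx addrC.
- move=> x; rewrite normrc /=; suff -> : C x ^+ 2 + S x ^+ 2 = 1 by rewrite sqrtr1.
  have := SS x x; rewrite -!expr2 subrr C0 C2; lra.
Qed.

End characters.

(** * Minimal idempotents of a translation-invariant convolution ideal *)

Section minimal_projection.
Context {R : realType} {G : topologicalZmodType}.
Variable mu : probability (borel G) R.
Hypothesis cG : compact [set: G].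
Hypothesis haar : haar_probability mu.
Local Notation E := (mean mu).
Local Notation conv := (conv mu).
Variable I : (G -> R) -> Prop.
Hypothesis Icont : forall f, I f -> continuous f.
Hypothesis ID : forall f g, I f -> I g -> I (fun x => f x + g x).
Hypothesis IZ : forall a f, I f -> I (fun x => a * f x).
Hypothesis Itr : forall y f, I f -> I (fun x => f (x + y)).
Hypothesis Iconv : forall a f, continuous a -> I f -> I (conv a f).

Let projection K :=
  [/\ I K, forall x, K (- x) = K x, conv K K = K & 1 <= K 0].

Let exists_projection phi : I phi -> (forall x, phi (- x) = phi x) ->
  (exists x, phi x != 0) ->
  exists2 K, projection K &
  exists2 lam, 0 < lam & conv (conv phi phi) K = fun x => lam * K x.
Proof.
move=> Iphi ephi phi0; have cphi := Icont Iphi.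
have [K [cK eK KK K0] [lam lam0 phiK]] := power_projection cG haar cphi ephi phi0.
exists K; last by exists lam.
split => //.
(* [I] is not assumed closed under limits; the eigenvalue equation puts the limit [K] back into [I]
   as a multiple of a convolution with [phi]. *)
have -> : K = fun x => lam^-1 * conv (conv phi phi) K x.
  by rewrite phiK; apply/funext => x; rewrite mulKf// gt_eqF.
apply: IZ; rewrite convC; [|exact: cG|exact: haar|exact: continuous_conv|exact: cK].
by apply: Iconv => //; exact: Iconv.
Qed.

Let le_projection0 K x : projection K -> `|K x| <= K 0.
Proof.
move=> [IK eK KK K0]; have cK := Icont IK.
have K00 : 0 <= K 0 by rewrite (le_trans _ K0).
rewrite -(ler_pXn2r (n := 2)) ?nnegrE// real_normK ?num_real//.
rewrite expr2 -{1 2 3}KK conv0//.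
have -> : E (fun y => K y * K y) = E (fun y => K y ^+ 2) by apply: eq_mean => y; rewrite expr2.
exact: (conv_sq_le cG haar x cK cK).
Qed.

(** Values at 0 are ranks. If K 0 is within 1 of the infimum, a proper subprojection K' would leave
    a nonzero idempotent L = K - K' with L 0 >= 1, and K' 0 would drop below the infimum. *)
Let minimal_projection phi : I phi -> (forall x, phi (- x) = phi x) ->
  (exists x, phi x != 0) ->
  exists2 K, projection K & forall K', projection K' -> conv K' K = K' -> K' = K.
Proof.
move=> Iphi ephi phi0.
have [K0 pK0 _] := exists_projection Iphi ephi phi0.
pose A := [set K 0 | K in projection].
have hA : has_inf A.
  split; first by exists (K0 0), K0.
  by exists 1 => _ [K [_ _ _ K1] <-].
have [_ [K pK <-] KA] := inf_adherent (ltr01 : 0 < 1 :> R) hA.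
exists K => // K' pK' K'K; apply: contrapT => neK.
have [IK eK KK K1] := pK; have [IK' eK' KK' K1'] := pK'.
have cK := Icont IK; have cK' := Icont IK'.
pose L x := K x + -1 * K' x.
have IL : I L by apply: ID => //; exact: IZ.
have cL := Icont IL.
have eL x : L (- x) = L x by rewrite /L eK eK'.
have KLl f : continuous f -> conv f L = fun x => conv f K x + -1 * conv f K' x.
  move=> cf; rewrite /L convDr; [|exact: cG|exact: cK|exact: (Icont (IZ (-1) IK'))|exact: cf].
  by rewrite (@convZr _ _ mu cG (-1) f K' cf cK').
have KK'2 : conv K K' = K' by rewrite convC.
have LL : conv L L = L.
  rewrite KLl// (convC cG haar cL cK) (convC cG haar cL cK') !KLl// KK K'K KK' KK'2.
  by apply/funext => x; rewrite /L; ring.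
have L0E : L 0 = E (fun x => L x ^+ 2).
  by rewrite -{1}LL conv0//; apply: eq_mean => y; rewrite expr2.
have L0_gt0 : 0 < L 0.
  rewrite L0E; apply: (mean_gt0 cG haar); first exact: contX.
    by move=> x; exact: sqr_ge0.
  apply: contrapT => L0; apply: neK; apply/funext => x.
  have : ~ (0 < L x ^+ 2) by move=> h; apply: L0; exists x.
  by rewrite exprn_even_gt0//= => /negP; rewrite negbK /L => /eqP; lra.
(* L 0 is the mean of L^2 and |L x| <= L 0 everywhere, so L 0 <= L 0 ^ 2 with L 0 > 0. *)
have L1 : 1 <= L 0.
  have Lle x : L x ^+ 2 <= L 0 ^+ 2.
    by rewrite [in leRHS]expr2 !L0E -{1}LL; exact: conv_sq_le.
  have : L 0 <= L 0 ^+ 2.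
    rewrite {1}L0E -[leRHS](mean_cst mu); apply: le_mean => //.
      exact: contX.
    exact: cst_continuous.
  by rewrite expr2 ler_pMr.
have : inf A <= K' 0 by apply: ge_inf; [exact: hA.2|exists K'].
by move: L1 KA; rewrite /L; lra.
Qed.

(** By minimality the even functions of [I] fixed by convolution with [K] form a line. K (x + y) + K
    (x - y), as a function of x, is one of them, and x = 0 identifies the multiple as 2 K y / K
    0. *)
Lemma exists_dalembert phi : I phi -> (forall x, phi (- x) = phi x) ->
  (exists x, phi x != 0) ->
  exists K, [/\ I K, 1 <= K 0, forall x, `|K x| <= K 0 &
    forall x y, K 0 * (K (x + y) + K (x - y)) = 2 * K x * K y].
Proof.
move=> Iphi ephi phi0.
have [K pK Kmin] := minimal_projection Iphi ephi phi0.
have [IK eK KK K1] := pK; have cK := Icont IK.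
(* The top projection of [D] is below [K], hence equal to [K]; so D * D, which is fixed by [K], is a
   multiple of [K] (products are convolutions). *)
have sq D : I D -> (forall x, D (- x) = D x) -> conv D K = D ->
    exists s, conv D D = fun x => s * K x.
  move=> I_D eD DK; have cD := Icont I_D.
  have [D0|D0] := pselect (exists x, D x != 0); last first.
    exists 0; apply/funext => x; rewrite mul0r -[RHS](mean_cst mu); apply: eq_mean => y.
    suff -> : D y = 0 by rewrite mul0r.
    by apply/eqP; apply: contrapT => /negP h; apply: D0; exists y.
  have [K' pK' [s s0 DK']] := exists_projection I_D eD D0.
  have [IK' eK' KK' K1'] := pK'; have cK' := Icont IK'.
  have cDD : continuous (conv D D) := continuous_conv cG cD cD.
  have KD : conv K D = D by rewrite convC.
  have K'K : conv K' K = K'.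
    have : conv K (conv (conv D D) K') = conv (conv D D) K'.
      by rewrite -(convA cG haar cK cDD cK') -(convA cG haar cK cD cD) KD.
    rewrite DK' (@convZr _ _ mu cG s K K' cK cK') (convC cG haar cK cK') => h.
    apply/funext => x; apply: (mulfI (lt0r_neq0 s0)); exact: (congr1 (@^~ x) h).
  rewrite (Kmin _ pK' K'K) in DK'.
  by exists s; rewrite -DK' (convA cG haar cD cD cK) DK.
(* Polarisation: the convolution squares of D and D + K are multiples of [K], and they determine 2 D
   = (D + K)^2 - D^2 - K because [K] is a unit for [D] and idempotent. *)
have scal D : I D -> (forall x, D (- x) = D x) -> conv D K = D ->
    exists s, D = fun x => s * K x.
  move=> I_D eD DK; have cD := Icont I_D.
  have KD : conv K D = D by rewrite convC.
  have [s1 h1] := sq _ I_D eD DK.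
  have I_DK := ID I_D IK; have cDK := Icont I_DK.
  have [s2 h2] : exists s, conv (fun x => D x + K x) (fun x => D x + K x) = fun x => s * K x.
    apply: sq => // [x|]; first by rewrite eD eK.
    by rewrite convDl// DK KK.
  exists ((s2 - s1 - 1) / 2); apply/funext => x.
  have := congr1 (@^~ x) h2; rewrite /= convDl// convDr// convDr// h1 DK KD KK => h.
  have -> : (s2 - s1 - 1) / 2 * K x = (s2 * K x - s1 * K x - K x) / 2 by field.
  by rewrite -h; field.
exists K; split => // [x|x y]; first exact: le_projection0.
have [s] : exists s, (fun x => K (x + y) + K (x - y)) = fun x => s * K x.
  have I1 := Itr y IK; have I2 := Itr (- y) IK.
  apply: scal; first exact: ID.
    by move=> z; rewrite -[K (- z + y)]eK -[K (- z - y)]eK !opprD !opprK addrC.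
  have c1 := Icont I1; have c2 := Icont I2.
  rewrite convC; [|exact: cG|exact: haar|exact: contD|exact: cK].
  by rewrite convDr// !conv_translate KK.
move=> h; have hx := congr1 (@^~ x) h; have h0 := congr1 (@^~ 0) h.
move: hx h0; rewrite /= add0r sub0r eK => -> h0.
have -> : 2 * K x * K y = (K y + K y) * K x by ring.
by rewrite h0; ring.
Qed.

End minimal_projection.

(** * Continuous functions orthogonal to all characters *)

Section uniqueness_continuous.
Context {R : realType} {G : topologicalZmodType}.
Variable mu : probability (borel G) R.
Hypothesis cG : compact [set: G].
Hypothesis haar : haar_probability mu.
Local Notation E := (mean mu).
Local Notation conv := (conv mu).
Local Notation Re := (@complex.Re R).
Local Notation Im := (@complex.Im R).

(** Real and imaginary parts are tested separately so that the convolution algebra stays real. *)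
Definition character_free (f : G -> R) := continuous f /\
  forall chi, character chi ->
    E (fun x => f x * Re (chi x)) = 0 /\ E (fun x => f x * Im (chi x)) = 0.

Let cRe := @character_Re_continuous R G.
Let cIm := @character_Im_continuous R G.

Lemma character_freeD f g : character_free f -> character_free g ->
  character_free (fun x => f x + g x).
Proof.
move=> [cf f0] [cg g0]; split => [|chi hchi]; first exact: contD.
have [fr fi] := f0 _ hchi; have [gr gi] := g0 _ hchi.
have c1 := cRe hchi; have c2 := cIm hchi.
split; [rewrite -[RHS]addr0 -{1}fr -gr|rewrite -[RHS]addr0 -{1}fi -gi];
  (rewrite -meanD//; [|exact: contM|exact: contM]);
  by apply: eq_mean => x; rewrite mulrDl.
Qed.

Lemma character_freeZ a f : character_free f -> character_free (fun x => a * f x).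
Proof.
move=> [cf f0]; split => [|chi hchi]; first by apply: contM => //; exact: contC.
have [fr fi] := f0 _ hchi.
have c1 := cRe hchi; have c2 := cIm hchi.
split; [rewrite -[RHS](mulr0 a) -fr|rewrite -[RHS](mulr0 a) -fi];
  (rewrite -meanZ//; last exact: contM);
  by apply: eq_mean => x; rewrite mulrA.
Qed.

Lemma character_free_translate y f : character_free f ->
  character_free (fun x => f (x + y)).
Proof.
move=> [cf f0]; split => [|chi hchi]; first by cont.
have [fr fi] := f0 _ hchi.
have c1 := cRe hchi; have c2 := cIm hchi.
have cA := contM cf c1; have cB := contM cf c2.
split.
- rewrite -(mean_translate cG haar (- y)); last first.
    by apply: contM; [cont|exact: cRe].
  transitivity (E (fun x => Re (chi (- y)) * (f x * Re (chi x)) - Im (chi (- y)) * (f x * Im (chi x)))).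
    apply: eq_mean => x; rewrite subrK character_ReD//; ring.
  rewrite meanB; [|exact: cG|by apply: contM; [exact: contC|]|by apply: contM; [exact: contC|]].
  by rewrite !meanZ// fr fi !mulr0 subr0.
- rewrite -(mean_translate cG haar (- y)); last first.
    by apply: contM; [cont|exact: cIm].
  transitivity (E (fun x => Im (chi (- y)) * (f x * Re (chi x)) + Re (chi (- y)) * (f x * Im (chi x)))).
    apply: eq_mean => x; rewrite subrK character_ImD//; ring.
  rewrite meanD; [|exact: cG|by apply: contM; [exact: contC|]|by apply: contM; [exact: contC|]].
  by rewrite !meanZ// fr fi !mulr0 addr0.
Qed.

Lemma character_free_conv a f : continuous a -> character_free f ->
  character_free (conv a f).
Proof.
move=> ca hf; have [cf f0] := hf; split => [|chi hchi]; first exact: continuous_conv.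
have c1 := cRe hchi; have c2 := cIm hchi.
have key (c : G -> R) : continuous c -> (forall y, E (fun x => f (x - y) * c x) = 0) ->
    E (fun x => conv a f x * c x) = 0.
  move=> cc h.
  transitivity (E (fun x => E (fun y => a y * f (x - y) * c x))).
    apply: eq_mean => x; rewrite mulrC -meanZ; [|exact: cG|by cont].
    by apply: eq_mean => y; rewrite mulrC.
  rewrite (@mean_fubini _ _ mu cG (fun z => a z.2 * f (z.1 - z.2) * c z.1)); last by cont.
  rewrite -[RHS](mean_cst mu); apply: eq_mean => y /=.
  rewrite -[RHS](mulr0 (a y)) -(h y) -meanZ; [|exact: cG|by cont].
  by apply: eq_mean => x; rewrite mulrA.
by split; apply: key => // y; have [] := (character_free_translate (- y) hf).2 _ hchi.
Qed.

Lemma character_free_eq0 f : character_free f -> forall x, f x = 0.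
Proof.
move=> hf x0; apply/eqP; apply: contrapT => /negP fx0.
have [cf _] := hf.
pose fN x := f (- x).
have cfN : continuous fN by rewrite /fN; cont.
pose phi := conv fN f.
have hphi : character_free phi by exact: character_free_conv.
have cphi := hphi.1.
have ephi x : phi (- x) = phi x.
  rewrite /phi {2}(convC cG haar cfN cf) /conv -(mean_inv cG haar); last by rewrite /fN; cont.
  by apply: eq_mean => y; rewrite /fN !opprK opprB [- x + y]addrC.
have phi0 : phi 0 = E (fun x => f x ^+ 2).
  rewrite -(mean_inv cG haar); last exact: contX.
  by apply: eq_mean => y; rewrite /fN sub0r expr2.
have [K [hK K1 KK Kd]] : exists K, [/\ character_free K, 1 <= K 0, forall x, `|K x| <= K 0 &
    forall x y, K 0 * (K (x + y) + K (x - y)) = 2 * K x * K y].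
  apply: (exists_dalembert cG haar (I := character_free)) hphi ephi _.
  - by move=> g [].
  - exact: character_freeD.
  - exact: character_freeZ.
  - exact: character_free_translate.
  - exact: character_free_conv.
  - exists 0; rewrite phi0 gt_eqF//; apply: (mean_gt0 cG haar); first exact: contX.
      by move=> x; exact: sqr_ge0.
    by exists x0; rewrite exprn_even_gt0.
have [cK hKc] := hK.
have K0 : 0 < K 0 by rewrite (lt_le_trans _ K1).
have [chi [hchi chiE]] : exists chi, character chi /\ forall x, Re (chi x) = K x / K 0.
  apply: dalembert_character.
  - by apply: contM => //; exact: contC.
  - by rewrite divff// gt_eqF.
  - by move=> x; rewrite normrM normfV [`|K 0|]gtr0_norm// ler_pdivrMr// mul1r.
  - move=> x y; rewrite -mulrDl; apply: (mulIf (lt0r_neq0 K0)); rewrite divfK ?gt_eqF//.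
    apply: (mulfI (lt0r_neq0 K0)); rewrite Kd; field.
    by rewrite gt_eqF.
(* [K] is orthogonal to [chi], yet its mean against Re chi = K / K 0 is the mean of K^2 / K 0, which
   is positive. *)
have [h _] := hKc _ hchi.
suff : 0 < E (fun x => K x * Re (chi x)) by rewrite h ltxx.
apply: (mean_gt0 cG haar); first by apply: contM => //; exact: cRe.
- by move=> x; rewrite chiE mulrA -expr2 divr_ge0 ?sqr_ge0// ltW.
- by exists 0; rewrite chiE divff ?mulr1// gt_eqF.
Qed.

End uniqueness_continuous.

(** * Uniqueness of Fourier coefficients *)

Lemma normr_indic_le1 {R : realType} T (A : set T) (x : T) : `|\1_A x : R| <= 1.
Proof. by rewrite indicE; case: (_ \in _); rewrite ?normr1// normr0 ler01. Qed.

Section integrable_real.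
Context d (T : measurableType d) (R : realType) (mu : {measure set T -> \bar R}).
Implicit Types f b : T -> R.

Lemma integrable_measurable f : mu.-integrable setT (EFin \o f) ->
  measurable_fun setT f.
Proof. by move=> /integrableP[/measurable_EFinP]. Qed.

Lemma le_integrable_normr f g : measurable_fun setT f -> (forall x, `|f x| <= g x) ->
  mu.-integrable setT (EFin \o g) -> mu.-integrable setT (EFin \o f).
Proof.
move=> mf fg; apply: le_integrable => //; first exact/measurable_EFinP.
by move=> x _; rewrite /= lee_fin (le_trans (fg x))// ler_norm.
Qed.

Lemma integrableMr_bounded f b (M : R) : mu.-integrable setT (EFin \o f) ->
  measurable_fun setT b -> (forall x, `|b x| <= M) ->
  mu.-integrable setT (EFin \o (fun x => f x * b x)).
Proof.
move=> fi mb bM; apply: (@le_integrable_normr _ (fun x => M * `|f x|)).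
- by apply: measurable_funM => //; exact: integrable_measurable.
- by move=> x; rewrite normrM mulrC; apply: ler_wpM2r.
- rewrite (_ : _ \o _ = (fun x => M%:E * `|(EFin \o f) x|)%E).
    by apply: integrableZl => //; exact: integrable_abse.
  by apply/funext => x /=; rewrite EFinM.
Qed.

Lemma integrable_normr f : mu.-integrable setT (EFin \o f) ->
  mu.-integrable setT (EFin \o (fun x => `|f x|)).
Proof. exact: integrable_norm. Qed.

Lemma integrable_real_D f g : mu.-integrable setT (EFin \o f) ->
  mu.-integrable setT (EFin \o g) -> mu.-integrable setT (EFin \o (fun x => f x + g x)).
Proof. exact: integrableD. Qed.

Lemma integrable_real_B f g : mu.-integrable setT (EFin \o f) ->
  mu.-integrable setT (EFin \o g) -> mu.-integrable setT (EFin \o (fun x => f x - g x)).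
Proof. exact: integrableB. Qed.

Lemma integrable_real_Z (a : R) f : mu.-integrable setT (EFin \o f) ->
  mu.-integrable setT (EFin \o (fun x => a * f x)).
Proof. exact: integrableZl. Qed.

End integrable_real.

Section integrable_product.
Context d1 d2 (T1 : measurableType d1) (T2 : measurableType d2) (R : realType).
Variables (m1 : {sigma_finite_measure set T1 -> \bar R})
  (m2 : {sigma_finite_measure set T2 -> \bar R}).

Lemma integrable_prod (a : T1 -> R) (b : T2 -> R) :
  m1.-integrable setT (EFin \o a) -> m2.-integrable setT (EFin \o b) ->
  (m1 \x m2)%E.-integrable setT (EFin \o (fun z => a z.1 * b z.2)).
Proof.
move=> ai bi.
have ma := integrable_measurable ai; have mb := integrable_measurable bi.
have mab : measurable_fun setT (fun z : T1 * T2 => a z.1 * b z.2).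
  by apply: measurable_funM; apply: measurableT_comp.
apply/integrable12ltyP; first exact/measurable_EFinP.
rewrite (_ : integral _ _ _ = (\int[m1]_x (`|(a x)%:E| * \int[m2]_y `|(b y)%:E|))%E); last first.
  apply: eq_integral => x _; rewrite -ge0_integralZl//; last first.
    by apply: measurableT_comp => //; exact/measurable_EFinP.
  by apply: eq_integral => y _; rewrite /= normrM EFinM.
rewrite ge0_integralZr//; last 2 first.
- by apply: measurableT_comp => //; exact/measurable_EFinP.
- by apply: integral_ge0 => y _; exact: abse_ge0.
have [_ fa] := integrableP _ _ _ ai; have [_ fb] := integrableP _ _ _ bi.
by rewrite lte_mul_pinfty// ?integral_ge0// ge0_fin_numE// integral_ge0.
Qed.

End integrable_product.

Section integral_tail.
Context d (T : measurableType d) (R : realType) (mu : probability T R).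

(** Truncation: |f| <= max (|f| - n, 0) + n, and the integral of the first term tends to 0 by
    dominated convergence. M is a level n at which it is at most e. *)
Lemma integrable_uniformly_absolutely_continuous (f : T -> R) (e : R) :
  mu.-integrable setT (EFin \o f) -> 0 < e -> exists2 M : R, 0 <= M &
    forall A, measurable A -> Rintegral mu setT (fun x => `|f x| * \1_A x) <= e + M * fine (mu A).
Proof.
move=> fi e0; have mf := integrable_measurable fi.
have nfi := integrable_normr fi.
pose g (n : nat) (x : T) := Num.max (`|f x| - n%:R) 0.
have g0 n x : 0 <= g n x by rewrite /g le_max lexx orbT.
have gf n x : g n x <= `|f x| by rewrite /g ge_max normr_ge0 andbT lerBlDr lerDl.
have mg n : measurable_fun setT (g n).
  apply: measurable_maxr => //; apply: measurable_funB => //.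
  exact: measurableT_comp.
have gi n : mu.-integrable setT (EFin \o g n).
  apply: (le_integrable_normr (mg n) _ nfi) => x; rewrite ger0_norm//; exact: gf.
have gcvg0 : {ae mu, forall x, setT x -> (EFin \o g n) x @[n --> \oo] --> 0%E}.
  apply: nearW => x _; apply: cvg_near_cst.
  have hn : `|f x| <= (Num.truncn `|f x|).+1%:R by rewrite ltW// truncnS_gt.
  exists (Num.truncn `|f x|).+1 => // m /= nm; congr EFin; apply/max_idPr.
  by rewrite subr_le0 (le_trans hn)// ler_nat.
have gdom : {ae mu, forall x n, setT x -> (`|(EFin \o g n) x| <= (`|f x|%R)%:E)%E}.
  by apply: nearW => x n _; rewrite /= lee_fin ger0_norm//; exact: gf.
have [_ _] := dominated_convergence measurableT
  (fun n => proj2 (measurable_EFinP _ _) (mg n)) (measurable_cst 0%E) gcvg0 nfi gdom.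
rewrite integral0 => gcvg.
have [n gn] : exists n, Rintegral mu setT (g n) <= e.
  have /fine_cvgP[_ /cvgrPdist_le/(_ _ e0)] := gcvg.
  move=> [n _ /(_ n (leqnn _))]; rewrite /= sub0r normrN => h.
  by exists n; rewrite (le_trans (ler_norm _)).
exists n%:R => // A mA.
have iA : mu.-integrable setT (EFin \o \1_A).
  apply: (le_integrable_normr _ (normr_indic_le1 A)) => //.
  exact: finite_measure_integrable_cst.
have e1 : Rintegral mu setT \1_A = fine (mu A).
  by rewrite /Rintegral integral_indic// setIT.
rewrite -e1 -RintegralZl//.
apply: (@le_trans _ _ (Rintegral mu setT (g n) + Rintegral mu setT (fun x => n%:R * \1_A x))); last exact: lerD.
have iZ := integrable_real_Z n%:R iA.
rewrite -(RintegralD measurableT (gi n) iZ).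
apply: (le_Rintegral measurableT _ (integrable_real_D (gi n) iZ)) => [|x _].
  by apply: (integrableMr_bounded nfi _ (normr_indic_le1 A)); exact: measurable_indic.
rewrite indicE; case: (_ \in _); rewrite ?mulr1 ?mulr0 ?addr0//.
by rewrite -lerBlDr /g le_max lexx.
Qed.

End integral_tail.

Section uniqueness_L1.
Context {R : realType} {G : topologicalZmodType}.
Variable mu : probability (borel G) R.
Hypothesis cG : compact [set: G].
Hypothesis hG : hausdorff_space G.
Hypothesis haar : haar_probability mu.
Local Notation E := (mean mu).
Local Notation Re := (@complex.Re R).
Local Notation Im := (@complex.Im R).
Variable r : G -> R.
Hypothesis ri : mu.-integrable setT (EFin \o r : borel G -> \bar R).

Let r_mul (k : G -> R) : continuous k ->
  mu.-integrable setT (EFin \o (fun x => r x * k x) : borel G -> \bar R).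
Proof.
move=> ck; have [M _ kM] := continuous_bounded cG ck.
exact: (integrableMr_bounded ri (continuous_borel_measurable_fun ck) kM).
Qed.

Let correlation_continuous (k : G * G -> R) : continuous k ->
  continuous (fun x => E (fun y => r y * k (x, y))).
Proof.
move=> ck x; apply/cvgrPdist_le => /= e e0.
have ckl x' : continuous (fun y => k (x', y)).
  by apply: contcomp => // y; apply: cvg_pair; [exact: cvg_cst|exact: cvg_id].
pose N := E (fun x => `|r x|).
have N0 : 0 <= N by exact: mean_ge0.
have e1 : 0 < e / (N + 1) by rewrite divr_gt0// ltr_pwDr.
apply: filterS (near_uniform_dist_le cG x ck e1) => x' kx'.
have i1 := r_mul (ckl x); have i2 := r_mul (ckl x').
rewrite /mean -RintegralB//.
apply: (le_trans (le_normr_Rintegral measurableT (integrable_real_B i1 i2))).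
apply: (@le_trans _ _ (e / (N + 1) * N)).
  rewrite -RintegralZl//; last exact: integrable_normr.
  apply: le_Rintegral => //.
  - by apply: integrable_normr; exact: integrable_real_B.
  - by apply: integrable_real_Z; exact: integrable_normr.
  - by move=> y _; rewrite -mulrBr normrM mulrC ler_wpM2r.
by rewrite mulrAC ler_pdivrMr ?ltr_pwDr// ler_pM2l// lerDl.
Qed.

Let correlation_fubini (k : G * G -> R) : continuous k ->
  E (fun x => E (fun y => r y * k (x, y))) = E (fun y => r y * E (fun x => k (x, y))).
Proof.
move=> ck.
have [M M0 kM] := continuous_prod_bounded cG ck.
have i1 : mu.-integrable setT (EFin \o (fun _ : borel G => 1 : R)).
  exact: finite_measure_integrable_cst.
have := integrableMr_bounded (integrable_prod i1 ri)
  (continuous_prod_borel_measurable_fun cG ck) kM.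
move=> /Rintegral_Fubini /= h.
transitivity (Rintegral mu setT (fun x => Rintegral mu setT (fun y => 1 * r y * k (x, y)))).
  by apply: eq_mean => x; apply: eq_mean => y; rewrite mul1r.
rewrite h; apply: eq_mean => y; rewrite -meanZ//; last first.
  by apply: contcomp => // x; apply: cvg_pair; [exact: cvg_id|exact: cvg_cst].
by apply: eq_mean => x; rewrite mul1r.
Qed.

Hypothesis rfree : forall chi, character chi ->
  E (fun x => r x * Re (chi x)) = 0 /\ E (fun x => r x * Im (chi x)) = 0.

(** The correlation of r with k is continuous and inherits orthogonality to characters, so it
    vanishes identically, in particular at 0. Orthogonality passes because convolving k with Re chi
    or Im chi gives a combination of the two. *)
Lemma fourier_free_mean_continuous (k : G -> R) : continuous k -> E (fun x => r x * k x) = 0.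
Proof.
move=> ck.
pose F x := E (fun y => r y * k (y - x)).
suff hF : character_free mu F.
  have := character_free_eq0 cG haar hF 0; rewrite /F => h; rewrite -[RHS]h.
  by apply: eq_mean => y; rewrite subr0.
split=> [|chi hchi].
  by apply: (@correlation_continuous (fun z => k (z.2 - z.1))); cont.
have c1 := character_Re_continuous hchi; have c2 := character_Im_continuous hchi.
have [rr rI] := rfree hchi.
have key (c : G -> R) (a b : R) : continuous c ->
    (forall y, E (fun x => c x * k (y - x)) = a * Re (chi y) + b * Im (chi y)) ->
    E (fun x => F x * c x) = 0.
  move=> cc hc.
  transitivity (E (fun x => E (fun y => r y * (c x * k (y - x))))).
    apply: eq_mean => x; rewrite mulrC /F /mean -RintegralZl//; last by apply: r_mul; cont.
    by apply: eq_mean => y; rewrite mulrCA.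
  rewrite (@correlation_fubini (fun z => c z.1 * k (z.2 - z.1))); last by cont.
  transitivity (E (fun y => a * (r y * Re (chi y)) + b * (r y * Im (chi y)))).
    by apply: eq_mean => y; rewrite /= hc; ring.
  have i1 := r_mul c1; have i2 := r_mul c2.
  rewrite /mean RintegralD//; try exact: integrable_real_Z.
  by rewrite !RintegralZl// -!/(mean mu _) rr rI !mulr0 addr0.
have kr : continuous (fun x => k x * Re (chi x)) by exact: contM.
have kI : continuous (fun x => k x * Im (chi x)) by exact: contM.
split.
- apply: (key _ (E (fun x => k x * Re (chi x))) (E (fun x => k x * Im (chi x)))) => // y.
  rewrite -[LHS]/(conv mu (fun x => Re (chi x)) k y) convC// /conv.
  transitivity (E (fun x => Re (chi y) * (k x * Re (chi x)) + Im (chi y) * (k x * Im (chi x)))).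
    by apply: eq_mean => x; rewrite character_ReD// character_ReN// character_ImN//; ring.
  rewrite meanD//; [|by apply: contM; [exact: contC|]|by apply: contM; [exact: contC|]].
  by rewrite !meanZ// mulrC [X in _ + X]mulrC.
- apply: (key _ (- E (fun x => k x * Im (chi x))) (E (fun x => k x * Re (chi x)))) => // y.
  rewrite -[LHS]/(conv mu (fun x => Im (chi x)) k y) convC// /conv.
  transitivity (E (fun x => Im (chi y) * (k x * Re (chi x)) - Re (chi y) * (k x * Im (chi x)))).
    by apply: eq_mean => x; rewrite character_ImD// character_ReN// character_ImN//; ring.
  rewrite meanB//; [|by apply: contM; [exact: contC|]|by apply: contM; [exact: contC|]].
  by rewrite !meanZ//; ring.
Qed.

Let r_indic (A : set (borel G)) : measurable A ->
  mu.-integrable setT (EFin \o (fun x => r x * \1_A x) : borel G -> \bar R).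
Proof.
by move=> mA; apply: (integrableMr_bounded ri) (normr_indic_le1 A); exact: measurable_indic.
Qed.

Let measure_diff_le (A B : set (borel G)) (e : R) : measurable A -> measurable B ->
  B `<=` A -> (mu A <= mu B + e%:E)%E -> fine (mu (A `\` B)) <= e.
Proof.
move=> mA mB BA AB.
have fA := fin_num_measure mu _ mA; have fB := fin_num_measure mu _ mB.
have := measureD mA mB; rewrite (setIidr BA) => -> //; last first.
  by rewrite -ge0_fin_numE.
by rewrite fineB// lerBlDl -lee_fin EFinD !fineK.
Qed.

(** Vanishing means against continuous functions pass to indicators of open sets through inner
    regularity and Urysohn functions, then to indicators of Borel sets through outer regularity. *)
Lemma fourier_free_ae_eq0 : {ae mu, forall x, r x = 0}.
Proof.
have [_ outer inner] := haar.
have small (A : set (borel G)) : measurable A ->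
    (forall e, 0 < e -> exists (B : set (borel G)) (k : G -> R),
      [/\ measurable B, fine (mu B) <= e & measurable_fun setT (k : borel G -> R)] /\
      [/\ forall x, `|k x| <= 1, E (fun x => r x * k x) = 0 &
          forall x, `|\1_A x - k x| <= \1_B x]) ->
    E (fun x => r x * \1_A x) = 0.
  move=> mA h; apply/eqP; rewrite -normr_le0; apply/ler_addgt0Pl => e e0; rewrite addr0.
  have e20 : 0 < e / 2 by rewrite divr_gt0.
  have [M M0 hM] := integrable_uniformly_absolutely_continuous ri e20.
  (* The error is at most e / 2 + M * mu B, and this bound on mu B keeps the second term below e /
     2; M + 1 avoids dividing by zero. *)
  have [|B [k [[mB Be mk] [k1 rk AB]]]] := h (e / 2 / (M + 1)).
    by rewrite divr_gt0// ltr_pwDr.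
  have ik := integrableMr_bounded ri mk k1; have iA := r_indic mA.
  rewrite -[E _]subr0 -rk /mean -RintegralB//.
  apply: (le_trans (le_normr_Rintegral measurableT (integrable_real_B iA ik))).
  apply: (@le_trans _ _ (Rintegral mu setT (fun x => `|r x| * \1_B x))).
    apply: le_Rintegral => //.
    - by apply: integrable_normr; exact: integrable_real_B.
    - apply: (integrableMr_bounded (integrable_normr ri) _ (normr_indic_le1 B)).
      exact: measurable_indic.
    - by move=> x _; rewrite -mulrBr normrM ler_wpM2l.
  apply: (le_trans (hM _ mB)); rewrite [leRHS](splitr e) lerD2l.
  apply: (@le_trans _ _ (M * (e / 2 / (M + 1)))); first exact: ler_wpM2l.
  by rewrite mulrA ler_pdivrMr ?ltr_pwDr// [leLHS]mulrC ler_pM2l// lerDl.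
have rO (U : set G) : open U -> E (fun x => r x * \1_U x) = 0.
  move=> oU; have mU := open_borel_measurable oU.
  apply: small => // e e0.
  have [_ [K [cK KU] <-]] : exists2 x, [set mu K | K in [set K : set G | compact K /\ K `<=` U]] x
      & (mu U - e%:E < x)%E.
    rewrite (inner _ oU); apply: ub_ereal_sup_adherent => //.
    rewrite -inner//; exact: fin_num_measure.
  rewrite lteBlDr// => /ltW hUK.
  have clK := compact_closed hG cK.
  have mK : measurable (K : set (borel G)).
    by rewrite -[K]setCK; apply: measurableC; apply: open_borel_measurable; exact: closed_openC.
  have clU : closed (~` U) by exact: open_closedC.
  have dis : ~` U `&` K = set0 by apply/seteqP; split=> // x [nU /KU].
  have [k [ck k0 k1 k01]] := urysohn_ext_itv (compact_normal hG cG) clU clK dis (@ltr01 R).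
  exists (U `\` K), k; split; split.
  - exact: measurableD.
  - exact: measure_diff_le.
  - exact: continuous_borel_measurable_fun.
  - move=> x; have : `[0, 1]%classic (k x) by apply: k01; exists x.
    by rewrite /= in_itv/= => /andP[h1 h2]; rewrite ger0_norm.
  - exact: fourier_free_mean_continuous.
  - move=> x; have : `[0, 1]%classic (k x) by apply: k01; exists x.
    rewrite /= in_itv/= => /andP[h1 h2]; rewrite !indicE in_setD.
    have [xU|xU] := boolP (x \in U); have [xK|xK] := boolP (x \in K) => /=.
    + by rewrite (_ : k x = 1) ?subrr ?normr0//; apply: k1; exists x => //; exact: set_mem.
    + by rewrite ler_norml; apply/andP; split; lra.
    + by have := KU _ (set_mem xK); move=> /mem_set; rewrite (negbTE xU).
    + rewrite (_ : k x = 0) ?subrr ?normr0//; apply: k0; exists x => //=.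
      by move=> /mem_set; rewrite (negbTE xU).
have rA (A : set (borel G)) : measurable A -> E (fun x => r x * \1_A x) = 0.
  move=> mA; apply: small => // e e0.
  have [_ [U [oU AU] <-]] : exists2 x, [set mu U | U in [set U : set G | open U /\ A `<=` U]] x
      & (x < mu A + e%:E)%E.
    rewrite (outer _ mA); apply: lb_ereal_inf_adherent => //.
    rewrite -outer//; exact: fin_num_measure.
  move=> /ltW hUA; have mU := open_borel_measurable oU.
  exists (U `\` A), \1_U; split; split.
  - exact: measurableD.
  - exact: measure_diff_le.
  - exact: measurable_indic.
  - exact: normr_indic_le1.
  - exact: rO.
  - move=> x; rewrite !indicE in_setD.
    have [xA|xA] := boolP (x \in A); have [xU|xU] := boolP (x \in U) => /=.
    + by rewrite subrr normr0.
    + by have := AU _ (set_mem xA); move=> /mem_set; rewrite (negbTE xU).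
    + by rewrite sub0r normrN normr1.
    + by rewrite subrr normr0.
have : ae_eq mu setT (EFin \o r) (cst 0%E).
  apply: integral_ae_eq => // A _ mA.
  rewrite integral0 integral_mkcond.
  have := rA A mA; rewrite /mean /Rintegral => h.
  rewrite -[RHS]/(0%:E) -h fineK; last exact: (integrable_fin_num measurableT (r_indic mA)).
  apply: eq_integral => x _; rewrite /patch indicE /=.
  by case: ifPn => xA; rewrite ?mulr1 ?mulr0.
by apply: filterS => x /(_ I) [].
Qed.

End uniqueness_L1.

(** * Kernels on the real line *)

Section dilation.
Context {R : realType}.
Local Notation leb := (@lebesgue_measure R).

(** b times the pushforward of Lebesgue measure under t |-> b t has the right value on half-open
    intervals, hence is Lebesgue measure by uniqueness. *)
Lemma ge0_integral_dilation (b : R) (f : R -> \bar R) : 0 < b ->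
  measurable_fun setT f -> (forall t, (0 <= f t)%E) ->
  (\int[leb]_t f t = b%:E * \int[leb]_t f (b * t)%R)%E.
Proof.
move=> b0 mf f0.
pose phi : measurableTypeR R -> measurableTypeR R := fun t => b * t.
have mphi : measurable_fun setT phi by exact: mulrl_measurable.
pose b' : {nonneg R} := NngNum (ltW b0).
have -> : (\int[leb]_t f (b * t)%R = \int[pushforward leb phi]_t f t)%E.
  by rewrite (ge0_integral_pushforward mphi).
rewrite -[b%:E]/((b'%:num)%:E) -ge0_integral_mscale//.
apply: eq_measure_integral => A mA _.
apply: lebesgue_measure_unique => // _ [[x y] _ <-].
rewrite /= /mscale /= /pushforward /=.
have -> : phi @^-1` `]x, y] = `](b^-1 * x), (b^-1 * y)]%classic.
  apply/seteqP; split => t; rewrite /= !in_itv /= /phi.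
    by rewrite ltr_pdivrMl// ler_pdivlMl.
  by rewrite ltr_pdivrMl// ler_pdivlMl.
rewrite !lebesgue_measure_itv/= !lte_fin ltr_pM2l ?invr_gt0//.
case: ifPn => _; last by rewrite mule0.
by rewrite -!EFinD -EFinM; congr EFin; field; rewrite gt_eqF.
Qed.

End dilation.

Section real_bounds.
Context {R : realType}.
Implicit Types x y : R.

Lemma ler_expR_sqr x : 0 <= x -> x ^+ 2 <= 2 * expR x.
Proof.
move=> x0; have := expR_ge1Dxn 1 x0; rewrite (_ : 2`!%:R = 2 :> R)//.
by move: (expR x) => y; lra.
Qed.

Lemma le_expR x : x <= expR x.
Proof. by rewrite (le_trans _ (expR_ge1Dx x))// lerDr. Qed.

Lemma ler_norm_sin x : `|sin x| <= `|x|.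
Proof.
wlog x0 : x / 0 <= x.
  move=> h; have [|/ltW x0] := leP 0 x; first exact: h.
  by rewrite -normrN -sinN -(normrN x); apply: h; rewrite oppr_ge0.
rewrite (ger0_norm x0).
have [->|xn0] := eqVneq x 0; first by rewrite sin0 normr0.
have xgt0 : 0 < x by rewrite lt_neqAle eq_sym xn0.
have [c _] : exists2 c, c \in `]0, x[%R & sin x - sin 0 = cos c * (x - 0).
  apply: (@MVT R sin cos) => //.
  by apply: continuous_subspaceT => t; exact: continuous_sin.
rewrite sin0 !subr0 => ->; rewrite normrM (gtr0_norm xgt0) ler_piMl//.
exact: cos_max.
Qed.

Lemma cosB_prod x y : cos x - cos y = 2 * sin ((y + x) / 2) * sin ((y - x) / 2).
Proof.
have -> : cos x = cos ((y + x) / 2 - (y - x) / 2) by congr cos; field.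
have -> : cos y = cos ((y + x) / 2 + (y - x) / 2) by congr cos; field.
by rewrite cosB cosD; ring.
Qed.

Lemma norm_cosB_le_mul x y : `|cos x - cos y| <= `|y + x| * `|y - x| / 2.
Proof.
rewrite cosB_prod !normrM ger0_norm//.
have := ler_norm_sin ((y + x) / 2); have := ler_norm_sin ((y - x) / 2).
rewrite !normrM (ger0_norm (_ : 0 <= 2^-1)) ?invr_ge0// => h1 h2.
apply: (@le_trans _ _ (2 * (`|y + x| / 2) * (`|y - x| / 2))); last by rewrite le_eqVlt; apply/orP; left; apply/eqP; field.
by apply: ler_pM; rewrite ?mulr_ge0 ?ler_pM2l.
Qed.

Lemma norm_cosB_le x y : `|cos x - cos y| <= `|y - x|.
Proof.
rewrite cosB_prod !normrM ger0_norm//.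
have := sin_max ((y + x) / 2); have := ler_norm_sin ((y - x) / 2).
rewrite !normrM (ger0_norm (_ : 0 <= 2^-1)) ?invr_ge0// => h1 h2.
apply: (@le_trans _ _ (2 * 1 * (`|y - x| / 2))); last by rewrite le_eqVlt; apply/orP; left; apply/eqP; field.
by apply: ler_pM; rewrite ?mulr_ge0 ?ler_pM2l.
Qed.

Lemma norm_cosB_le2 x y : `|cos x - cos y| <= 2.
Proof. by rewrite (le_trans (ler_normB _ _))// (natrD _ 1 1) lerD// cos_max. Qed.

End real_bounds.

(** * The integrable majorant *)

Section weight.
Context {R : realType}.
Local Notation leb := (@lebesgue_measure R).
Local Notation e := (expR 1 : R).

(* 1 / ((t + e) ln^2 (t + e)) is, up to a factor, the supremum over a of
   expR (- v * a) * minr t^-1 (expR (C * expR (v / 2 * a)) * t^-2). *)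
Definition weight (t : R) : R := if 0 < t then ((t + e) * ln (t + e) ^+ 2)^-1 else 0.

Let e_gt1 : 1 < e. Proof. by rewrite expR_gt1. Qed.

Let ln_ge1 (t : R) : 0 <= t -> 1 <= ln (t + e).
Proof.
move=> t0; rewrite -[leLHS](@expRK R) ler_ln ?posrE ?expR_gt0//.
  by rewrite lerDr.
by rewrite ltr_wpDl// expR_gt0.
Qed.

Lemma weight_ge0 t : 0 <= weight t.
Proof.
rewrite /weight; case: ifPn => // t0.
by rewrite invr_ge0 mulr_ge0 ?sqr_ge0// addr_ge0 ?expR_ge0// ltW.
Qed.

(** An antiderivative of [f] that tends to 0 at infinity. The shift by e keeps the logarithm at
    least 1, so nothing is singular at t = 0. *)
Let F (t : R) : R := - (ln (t + e))^-1.
Let f (t : R) : R := ((t + e) * ln (t + e) ^+ 2)^-1.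

Let te_gt0 (t : R) : 0 <= t -> 0 < t + e.
Proof. by move=> t0; rewrite ltr_wpDl// expR_gt0. Qed.

Let is_derive_F (t : R) : 0 <= t -> is_derive t 1 F (f t).
Proof.
move=> t0.
have d1 : is_derive t 1 (fun x : R => x + e) 1.
  by rewrite -[1 in X in is_derive _ _ _ X]addr0; apply: is_deriveD.
have d2 : is_derive t 1 (@ln R \o (fun x : R => x + e)) ((t + e)^-1 * 1).
  by apply: is_derive1_comp; exact/is_derive1_ln/te_gt0.
have ln0 : ln (t + e) != 0 by rewrite gt_eqF// (lt_le_trans _ (ln_ge1 t0)).
have d3 := is_deriveV (ln0 : (@ln R \o (fun x : R => x + e)) t != 0) d2.
have d4 := is_deriveN d3.
rewrite /F (_ : f t = - (- (@ln R \o (fun x : R => x + e)) t ^- 2 *: ((t + e)^-1 * 1)))//.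
by rewrite /f /= mulr1 scaleNr opprK -[RHS]/(_ * _) invfM mulrC.
Qed.

Let continuous_f (t : R) : 0 <= t -> {for t, continuous f}.
Proof.
move=> t0; apply: cvgV.
  by rewrite mulf_neq0 ?expf_neq0// gt_eqF ?te_gt0// (lt_le_trans _ (ln_ge1 t0)).
have c1 : {for t, continuous (fun x : R => x + e)}.
  by apply: cvgD; [exact: cvg_id|exact: cvg_cst].
apply: cvgM => //.
have c2 : {for t, continuous (fun x : R => ln (x + e))}.
  by apply: continuous_comp => //; exact/continuous_ln/te_gt0.
exact: (cvg_comp _ _ c2 (@exprn_continuous _ 2 _)).
Qed.

Let F_cvg : F t @[t --> +oo] --> 0.
Proof.
rewrite -oppr0; apply: cvgN; apply/cvgrPdist_le => eps eps0.
near=> t; rewrite sub0r normrN.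
have h : eps^-1 <= ln (t + e).
  rewrite -[leLHS](@expRK R) ler_ln ?posrE ?expR_gt0//.
    by rewrite ler_wpDr ?expR_ge0.
  by apply: te_gt0.
have ln_gt0 : 0 < ln (t + e) by rewrite (lt_le_trans _ h)// invr_gt0.
by rewrite normfV gtr0_norm// -[leRHS]invrK lef_pV2 ?posrE// invr_gt0.
Unshelve. all: by end_near. Qed.

Lemma measurable_weight : measurable_fun setT weight.
Proof.
apply: measurable_fun_if => //; rewrite ?setTI.
- exact: measurable_fun_ltr.
- rewrite (_ : _ @^-1` _ = `]0, +oo[%classic).
    apply: open_continuous_measurable_fun; first exact: interval_open.
    by move=> t; rewrite inE/= in_itv/= andbT => /ltW; exact: continuous_f.
  by apply/seteqP; split => t /=; rewrite in_itv/= andbT.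
Qed.

Lemma integrable_weight : leb.-integrable setT (EFin \o weight).
Proof.
apply/integrableP; split; first by apply/measurable_EFinP; exact: measurable_weight.
have -> : (\int[leb]_t `|(EFin \o weight) t| = \int[leb]_(t in `[0%R, +oo[) (f t)%:E)%E.
  rewrite -integral_itv_obnd_cbnd; last first.
    apply/measurable_EFinP; apply: open_continuous_measurable_fun; first exact: interval_open.
    by move=> t; rewrite inE/= in_itv/= andbT => /ltW; exact: continuous_f.
  rewrite [RHS]integral_mkcond; apply: eq_integral => t _.
  rewrite /patch /= ger0_norm ?weight_ge0// /weight.
  case: ifPn => t0; first by rewrite mem_set//= in_itv/= t0.
  by rewrite memNset//= in_itv/= andbT; exact/negP.
rewrite (@ge0_continuous_FTC2y _ f F 0 0).
- by rewrite -EFinB ltry.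
- move=> t t0; rewrite invr_ge0 mulr_ge0 ?sqr_ge0// ltW//; exact: te_gt0.
- apply/continuous_within_itvcyP; split.
    by move=> t; rewrite in_itv/= andbT => /ltW; exact: continuous_f.
  by apply: cvg_at_right_filter; exact: continuous_f.
- exact: F_cvg.
- by move=> t /ltW t0; have [] := is_derive_F t0.
- apply: cvg_at_right_filter; apply: differentiable_continuous.
  by apply/derivable1_diffP; have [] := is_derive_F (lexx 0).
- by move=> t; rewrite in_itv/= andbT => /ltW t0; rewrite derive1E; have [] := is_derive_F t0.
Qed.

(** The weight decays more slowly than t^-2, so a multiple of it dominates each Fejer kernel, which
    yields their integrability. *)
Lemma weight_lower_bound t : 0 < t -> (8 * (t ^+ 2 + e ^+ 2))^-1 <= weight t.
Proof.
move=> t0; rewrite /weight t0; have te0 := te_gt0 (ltW t0).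
have l1 := ln_ge1 (ltW t0).
have l0 : 0 < ln (t + e) by rewrite (lt_le_trans _ l1).
rewrite lef_pV2 ?posrE ?mulr_gt0 ?exprn_gt0 ?addr_gt0 ?exprn_gt0 ?expR_gt0//.
have : ln (t + e) ^+ 2 <= 4 * (t + e).
  have := @ler_expR_sqr _ (ln (t + e) / 1); rewrite divr1 lnK ?posrE// => h.
  have := h (le_trans ler01 l1); lra.
move: (ln _) => L h; have t2 := sqr_ge0 (t - e).
apply: (@le_trans _ _ ((t + e) * (4 * (t + e)))); first by rewrite ler_pM2l.
by nra.
Qed.

(** The quotient is at most a + 1, at most 1 / t and at most 2 / (d t^2). The first bound serves t
    <= e. Beyond e, the second serves ln t <= 2 C exp (v a / 2), where exp (v a) pays for ln^2 t,
    and the third serves larger t, where the hypothesis on d gives 1 / d <= sqrt t. *)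
Lemma fejer_ratio_bound (v C : R) : 0 < v -> 0 < C -> exists2 C1, 0 < C1 &
  forall a d t, 0 <= a -> 0 < d -> d <= 1 -> ln d^-1 <= C * expR (v / 2 * a) -> 0 < t ->
    `|cos (a * t) - cos ((a + d) * t)| / (d * t ^+ 2) <= C1 * expR (v * a) * weight t.
Proof.
move=> v0 C0.
(* One summand for each of the three ranges of t, in that order. *)
exists (8 * e * (1 + v^-1) + 32 * C ^+ 2 + 128).
  have e0 : 0 < e by exact: expR_gt0.
  have ev : 0 <= e * (1 + v^-1) by rewrite mulr_ge0 ?addr_ge0 ?invr_ge0// ltW.
  by have := sqr_ge0 C; lra.
move=> a d t a0 d0 d1 lnd t0.
have dt0 : 0 < d * t ^+ 2 by rewrite mulr_gt0// exprn_gt0.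
set kap := _ / _.
have e0 : 0 < e by exact: expR_gt0.
have va_ge1 : 1 <= expR (v * a) by rewrite -expR0 ler_expR mulr_ge0// ltW.
have kap0 : 0 <= kap by rewrite divr_ge0// ltW.
have kap1 : kap <= a + 1.
  rewrite ler_pdivrMr//; apply: (le_trans (norm_cosB_le_mul _ _)).
  have -> : (a + d) * t + a * t = (2 * a + d) * t by ring.
  have -> : (a + d) * t - a * t = d * t by ring.
  have d0' := ltW d0; have t0' := ltW t0.
  rewrite !ger0_norm ?mulr_ge0// ?addr_ge0 ?mulr_ge0//.
  have -> : (2 * a + d) * t * (d * t) / 2 = (a + d / 2) * (d * t ^+ 2) by field.
  by rewrite ler_pM2r// lerD2l; lra.
have kap2 : kap <= t^-1.
  rewrite ler_pdivrMr//; apply: (le_trans (norm_cosB_le _ _)).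
  have -> : (a + d) * t - a * t = d * t by ring.
  rewrite gtr0_norm ?mulr_gt0//.
  by rewrite (_ : t^-1 * _ = d * t)//; field; rewrite gt_eqF.
have kap3 : kap <= 2 / (d * t ^+ 2) by rewrite ler_pM2r ?invr_gt0// norm_cosB_le2.
have w0 := weight_ge0 t.
have te0 := te_gt0 (ltW t0).
have L1 := ln_ge1 (ltW t0).
have Lgt0 : 0 < ln (t + e) by rewrite (lt_le_trans _ L1).
pose W := (t + e) * ln (t + e) ^+ 2.
have W0 : 0 < W by rewrite mulr_gt0// exprn_gt0.
have wE : weight t = W^-1 by rewrite /weight t0.
rewrite wE ler_pdivlMr//.
have ln2 : ln 2 <= 1 :> R.
  rewrite -[leRHS](@expRK R) ler_ln ?posrE//.
  by have := expR_ge1Dx (1 : R); rewrite -(natrD _ 1 1).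
have [te|et] := leP t e.
  have We : W <= 8 * e.
    have l2 : ln (t + e) <= 2.
      have : ln (t + e) <= ln (2 * e).
        by rewrite ler_ln ?posrE ?mulr_gt0//; lra.
      by rewrite lnM ?posrE// expRK; lra.
    apply: (@le_trans _ _ ((2 * e) * (2 ^+ 2))); last by lra.
    apply: ler_pM; [exact: ltW|exact: sqr_ge0|by lra|].
    by rewrite ler_pXn2r ?nnegrE// ltW.
  have av : a + 1 <= (1 + v^-1) * expR (v * a).
    have : a <= v^-1 * expR (v * a) by rewrite ler_pdivlMl// le_expR.
    by rewrite mulrDl mul1r; lra.
  apply: (@le_trans _ _ ((1 + v^-1) * expR (v * a) * (8 * e))).
    by apply: ler_pM => //; [exact: ltW|exact: le_trans kap1 av].
  have -> : (1 + v^-1) * expR (v * a) * (8 * e) = (8 * e * (1 + v^-1)) * expR (v * a) by ring.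
  by rewrite ler_pM2r ?expR_gt0// -addrA lerDl addr_ge0// mulr_ge0// sqr_ge0.
pose L := ln t.
have tL : expR L = t by rewrite lnK ?posrE.
have Lg1 : 1 <= L by rewrite -[leLHS](@expRK R) ler_ln ?posrE// ltW.
have WL : W <= 8 * t * L ^+ 2.
  have l2 : ln (t + e) <= 2 * L.
    have : ln (t + e) <= ln (2 * t).
      by rewrite ler_ln ?posrE ?mulr_gt0//; lra.
    by rewrite lnM ?posrE// -/L; lra.
  apply: (@le_trans _ _ ((2 * t) * ((2 * L) ^+ 2))); last by rewrite exprMn; lra.
  apply: ler_pM; [exact: ltW|exact: sqr_ge0|by lra|].
  by rewrite ler_pXn2r ?nnegrE//; [exact: ltW|lra].
have L20 : 0 <= L ^+ 2 by exact: sqr_ge0.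
apply: (@le_trans _ _ (kap * (8 * t * L ^+ 2))); first by rewrite ler_wpM2l.
have tL2 : 0 <= 8 * t * L ^+ 2 by rewrite mulr_ge0// mulr_ge0// ltW.
have vaE : expR (v * a) = expR (v / 2 * a) ^+ 2.
  by rewrite -expRM_natl; congr expR; field.
have C20 := sqr_ge0 C.
have ev : 0 <= 8 * e * (1 + v^-1) by rewrite !mulr_ge0// ?ltW// addr_gt0// invr_gt0.
have [LC|CL] := leP L (2 * C * expR (v / 2 * a)).
  have L2C : L ^+ 2 <= 4 * C ^+ 2 * expR (v * a).
    have -> : 4 * C ^+ 2 * expR (v * a) = (2 * C * expR (v / 2 * a)) ^+ 2.
      by rewrite vaE; ring.
    by rewrite ler_pXn2r// nnegrE ?(le_trans ler01 Lg1)// !mulr_ge0 ?expR_ge0// ltW.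
  apply: (@le_trans _ _ (t^-1 * (8 * t * L ^+ 2))).
    exact: ler_wpM2r.
  have -> : t^-1 * (8 * t * L ^+ 2) = 8 * L ^+ 2 by field; rewrite gt_eqF.
  have va0 := expR_gt0 (v * a).
  move: (expR (v * a)) va0 L2C => X X0 L2C.
  have evX : 0 <= 8 * e * (1 + v^-1) * X by rewrite mulr_ge0// ltW.
  have -> : (8 * e * (1 + v^-1) + 32 * C ^+ 2 + 128) * X =
    8 * e * (1 + v^-1) * X + (8 * (4 * C ^+ 2 * X) + 128 * X) by ring.
  lra.
(* Here ln (1 / d) <= C exp (v a / 2) < L / 2, so 1 / (d t) <= t^(-1/2), and L^2 <= 8 sqrt t removes
   the logarithm. *)
have dV : d^-1 <= expR (L / 2).
  rewrite -ler_ln ?posrE ?invr_gt0 ?expR_gt0// expRK; lra.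
have Lexp : L ^+ 2 <= 8 * expR (L / 2).
  have h := @ler_expR_sqr _ (L / 2); move: h; rewrite exprMn => h.
  have : 0 <= L / 2 by lra.
  by move=> /h; rewrite exprVn; lra.
apply: (@le_trans _ _ (2 / (d * t ^+ 2) * (8 * t * L ^+ 2))).
  exact: ler_wpM2r.
have -> : 2 / (d * t ^+ 2) * (8 * t * L ^+ 2) = 16 * (d^-1 * t^-1 * L ^+ 2).
  by field; rewrite !gt_eqF.
apply: (@le_trans _ _ 128); last first.
  apply: (@le_trans _ _ ((8 * e * (1 + v^-1) + 32 * C ^+ 2 + 128) * 1)); first by lra.
  by rewrite ler_wpM2l//; lra.
have h1 : d^-1 * t^-1 * L ^+ 2 <= expR (L / 2) * t^-1 * (8 * expR (L / 2)).
  have tV : 0 <= t^-1 by rewrite invr_ge0 ltW.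
  have dV0 : 0 <= d^-1 by rewrite invr_ge0 ltW.
  by apply: ler_pM => //; [rewrite mulr_ge0|rewrite ler_wpM2r].
have h2 : expR (L / 2) * t^-1 * (8 * expR (L / 2)) = 8.
  have : expR (L / 2) * expR (L / 2) = t by rewrite -expRD -splitr.
  move=> h; have -> : expR (L / 2) * t^-1 * (8 * expR (L / 2)) = 8 * (expR (L / 2) * expR (L / 2)) / t by ring.
  by rewrite h mulfK// gt_eqF.
lra.
Qed.

End weight.

(** * Fejer and trapezoid kernels and their cosine transforms *)

Section fejer.
Context {R : realType}.
Local Notation leb := (@lebesgue_measure R).
Local Notation e := (expR 1 : R).

(** Kernels live on the positive half-line; the negative half enters later by running the flow
    backwards. *)
Definition fejer (b t : R) : R := if 0 < t then (1 - cos (b * t)) / t ^+ 2 else 0.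

Lemma fejer_ge0 b t : 0 <= fejer b t.
Proof.
rewrite /fejer; case: ifPn => // t0.
by rewrite divr_ge0 ?sqr_ge0// subr_ge0 cos_le1.
Qed.

Lemma fejerN b t : fejer (- b) t = fejer b t.
Proof. by rewrite /fejer mulNr cosN. Qed.

Lemma measurable_fejer b : measurable_fun setT (fejer b).
Proof.
apply: measurable_fun_if => //; rewrite ?setTI.
- exact: measurable_fun_ltr.
- rewrite (_ : _ @^-1` _ = `]0, +oo[%classic); last first.
    by apply/seteqP; split => t /=; rewrite in_itv/= andbT.
  apply: open_continuous_measurable_fun; first exact: interval_open.
  move=> t; rewrite inE/= in_itv/= andbT => t0.
  have c1 : {for t, continuous (fun t : R => cos (b * t))}.
    apply: continuous_comp; last exact: continuous_cos.
    by apply: cvgM; [exact: cvg_cst|exact: cvg_id].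
  apply: cvgM; first by apply: cvgB => //; exact: cvg_cst.
  apply: cvgV; first by rewrite expf_neq0// gt_eqF.
  exact: (@exprn_continuous _ 2 _).
Qed.

Lemma integrable_fejer b : leb.-integrable setT (EFin \o fejer b).
Proof.
pose c := 8 * (2 + e ^+ 2 * b ^+ 2).
apply: (@le_integrable_normr _ _ _ leb _ (fun t => c * weight t)).
- exact: measurable_fejer.
- move=> t; rewrite ger0_norm ?fejer_ge0// /fejer; case: ifPn => t0; last first.
    by rewrite mulr_ge0 ?weight_ge0// mulr_ge0// addr_ge0// mulr_ge0// sqr_ge0.
  have t20 : 0 < t ^+ 2 by rewrite exprn_gt0.
  have e20 : 0 < e ^+ 2 by rewrite exprn_gt0// expR_gt0.
  have te : 0 < t ^+ 2 + e ^+ 2 by rewrite addr_gt0.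
  have h1 : 1 - cos (b * t) <= 2.
    by have := norm_cosB_le2 0 (b * t); rewrite cos0; apply: le_trans; exact: ler_norm.
  have h2 : 1 - cos (b * t) <= b ^+ 2 * t ^+ 2.
    have := norm_cosB_le_mul 0 (b * t); rewrite cos0 addr0 subr0 -expr2 real_normK ?num_real// exprMn.
    have := ler_norm (1 - cos (b * t)); have : 0 <= b ^+ 2 * t ^+ 2 by rewrite mulr_ge0// ?sqr_ge0.
    lra.
  apply: (@le_trans _ _ (c * (8 * (t ^+ 2 + e ^+ 2))^-1)); last first.
    by rewrite ler_wpM2l ?weight_lower_bound// mulr_ge0// addr_ge0// mulr_ge0// sqr_ge0.
  rewrite (_ : c / _ = (2 + e ^+ 2 * b ^+ 2) / (t ^+ 2 + e ^+ 2)); last first.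
    by rewrite /c; field; rewrite gt_eqF.
  rewrite ler_pdivlMr// mulrAC ler_pdivrMr//.
  have h3 : (1 - cos (b * t)) * t ^+ 2 <= 2 * t ^+ 2 by rewrite ler_pM2r.
  have h4 : (1 - cos (b * t)) * e ^+ 2 <= b ^+ 2 * t ^+ 2 * e ^+ 2 by rewrite ler_pM2r.
  rewrite mulrDr; lra.
- by apply: integrable_real_Z; exact: integrable_weight.
Qed.

(** This is pi / 2. It stays unevaluated and is divided out in [trapezoid_kernel], for which its
    positivity suffices. *)
Definition fejer_mass : R := Rintegral leb setT (fejer 1).

Lemma fejer_mass_gt0 : 0 < fejer_mass.
Proof.
(* A lower bound of the integrand on ]1, 2], an interval of length 1. *)
pose c : R := (1 - cos 1) / 4.
have c0 : 0 < c.
  rewrite divr_gt0// subr_gt0 -[ltRHS]cos0 ltr_cos ?ltr01// in_itv/= ?lexx ?ler01 ?pi_ge0//.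
  by rewrite (le_trans _ (@pi_ge2 R))// ler1n.
apply: (lt_le_trans c0).
rewrite -lee_fin /fejer_mass /Rintegral fineK; last exact: (integrable_fin_num measurableT (integrable_fejer 1)).
have -> : c%:E = (\int[leb]_(t in `]1%R, 2%R]%classic) c%:E)%E.
  rewrite integral_cst//= lebesgue_measure_itv/= lte_fin ltr1n/= -EFinB.
  by rewrite (_ : 2 - 1 = 1 :> R) ?mule1//; ring.
apply: (@le_trans _ _ (\int[leb]_(t in `]1%R, 2%R]%classic) (fejer 1 t)%:E)%E).
  apply: ge0_le_integral => //.
  - by move=> t _; rewrite lee_fin ltW.
  - by apply/measurable_EFinP; apply: measurable_funTS; exact: measurable_fejer.
  - move=> t; rewrite /= in_itv/= => /andP[t1 t2]; rewrite lee_fin /fejer.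
    have t0 : 0 < t by rewrite (lt_trans _ t1).
    rewrite t0 mul1r /c.
    have h1 : cos t <= cos 1.
      have pi2 := @pi_ge2 R.
      apply: ltW; rewrite ltr_cos ?in_itv/= ?ler01 ?(ltW t0)//=; lra.
    have h2 : cos t <= 1 := cos_le1 t.
    apply: ler_pM; rewrite ?invr_ge0 ?subr_ge0 ?cos_le1//.
      by rewrite lerD2l lerN2.
    rewrite lef_pV2 ?posrE// ?exprn_gt0//.
    have : t ^+ 2 <= 2 ^+ 2 by rewrite ler_pXn2r ?nnegrE// ltW.
    lra.
apply: ge0_subset_integral => //.
- by apply/measurable_EFinP; exact: measurable_fejer.
- by move=> t _; rewrite lee_fin fejer_ge0.
Qed.

Lemma Rintegral_fejer b : Rintegral leb setT (fejer b) = fejer_mass * `|b|.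
Proof.
wlog b0 : b / 0 <= b.
  move=> h; have [|/ltW b0] := leP 0 b; first exact: h.
  rewrite -normrN -h ?oppr_ge0//; congr (Rintegral _ _ _).
  by apply/funext => t; rewrite fejerN.
rewrite ger0_norm//.
have [->|bn0] := eqVneq b 0.
  rewrite mulr0 /Rintegral integral0_eq// => t _.
  by rewrite /fejer mul0r cos0 subrr mul0r; case: ifP.
have bgt0 : 0 < b by rewrite lt_neqAle eq_sym bn0.
rewrite /fejer_mass /Rintegral.
rewrite [in RHS](ge0_integral_dilation bgt0); last 2 first.
- by apply/measurable_EFinP; exact: measurable_fejer.
- by move=> t; rewrite lee_fin fejer_ge0.
have -> : (\int[leb]_t (fejer b t)%:E = (b ^+ 2)%:E * \int[leb]_t (fejer 1 (b * t))%:E)%E.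
  rewrite -ge0_integralZl//; last 3 first.
  - apply/measurable_EFinP; apply: (measurableT_comp (measurable_fejer 1)).
    exact: mulrl_measurable.
  - by move=> t _; rewrite lee_fin fejer_ge0.
  - by rewrite lee_fin sqr_ge0.
  apply: eq_integral => t _; rewrite -EFinM; congr EFin.
  rewrite /fejer pmulr_rgt0// mul1r; case: ifPn => [t0|]; last by rewrite mulr0.
  by field; rewrite bn0 gt_eqF.
have J0 : (0 <= \int[leb]_t (fejer 1 (b * t))%:E)%E.
  by apply: integral_ge0 => t _; rewrite lee_fin fejer_ge0.
move: (integral _ _ _) J0 => [j||] // _ /=; first by ring.
by rewrite !gt0_muley ?lte_fin ?exprn_gt0//= mul0r.
Qed.

Definition trapezoid_kernel (a d t : R) : R :=
  if 0 < t then (cos (a * t) - cos ((a + d) * t)) / (2 * fejer_mass * (d * t ^+ 2)) else 0.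

(** For a >= 0 and d > 0 an even trapezoid in l, with plateau 1 up to a and value 0 beyond a + d. It
    is a difference of absolute values because the integral of [fejer b] is proportional to |b|. *)
Definition trapezoid (a d l : R) : R :=
  (`|a + d + l| + `|a + d - l| - `|a + l| - `|a - l|) / (2 * d).

Lemma trapezoid1 a d l : 0 < d -> 0 <= l <= a -> trapezoid a d l = 1.
Proof.
move=> d0 /andP[l0 la]; rewrite /trapezoid !ger0_norm; try lra.
by field; rewrite gt_eqF.
Qed.

Lemma trapezoid0 a d l : 0 < d -> 0 <= a -> a + d <= l -> trapezoid a d l = 0.
Proof.
move=> d0 a0 adl; rewrite /trapezoid (ger0_norm (_ : 0 <= a + d + l)); last lra.
rewrite (ger0_norm (_ : 0 <= a + l)); last lra.
rewrite (ler0_norm (_ : a + d - l <= 0)); last lra.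
rewrite (ler0_norm (_ : a - l <= 0)); last lra.
by field; rewrite gt_eqF.
Qed.

Lemma norm_trapezoid_le1 a d l : 0 < d -> `|trapezoid a d l| <= 1.
Proof.
move=> d0; rewrite /trapezoid normrM normfV (gtr0_norm (_ : 0 < 2 * d)) ?mulr_gt0//.
rewrite ler_pdivrMr ?mulr_gt0// mul1r.
have := ler_dist_dist (a + d + l) (a + l); have := ler_dist_dist (a + d - l) (a - l).
rewrite (_ : a + d + l - (a + l) = d); last by ring.
rewrite (_ : a + d - l - (a - l) = d); last by ring.
rewrite (gtr0_norm d0) !ler_norml; lra.
Qed.

(** The product-to-sum formula gives four cosines whose signs add up to 0, so each may be replaced
    by cos - 1, which is a Fejer numerator up to sign. *)
Let trapezoid_kernel_cosE a d l t : 0 < d -> trapezoid_kernel a d t * cos (l * t) =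
  (4 * fejer_mass * d)^-1 *
    (fejer (a + d + l) t + fejer (a + d - l) t - (fejer (a + l) t + fejer (a - l) t)).
Proof.
move=> d0; rewrite /trapezoid_kernel /fejer; case: ifPn => t0; last by rewrite mul0r addr0 subrr mulr0.
have m0 := fejer_mass_gt0.
have -> : (a + d + l) * t = (a + d) * t + l * t by ring.
have -> : (a + d - l) * t = (a + d) * t - l * t by ring.
have -> : (a + l) * t = a * t + l * t by ring.
have -> : (a - l) * t = a * t - l * t by ring.
rewrite !cosD !cosN !sinN; field.
by rewrite !gt_eqF.
Qed.

Lemma Rintegral_trapezoid_kernel a d l : 0 < d ->
  2 * Rintegral leb setT (fun t => trapezoid_kernel a d t * cos (l * t)) = trapezoid a d l.
Proof.
move=> d0; have i := integrable_fejer.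
have m0 := fejer_mass_gt0.
under eq_Rintegral do rewrite (trapezoid_kernel_cosE _ _ _ d0).
have i1 := integrable_real_D (i (a + d + l)) (i (a + d - l)).
have i2 := integrable_real_D (i (a + l)) (i (a - l)).
rewrite (RintegralZl _ measurableT (integrable_real_B i1 i2)).
rewrite (RintegralB measurableT i1 i2) !(RintegralD measurableT)// !Rintegral_fejer /trapezoid.
by field; rewrite !gt_eqF.
Qed.

Lemma measurable_trapezoid_kernel a d : measurable_fun setT (trapezoid_kernel a d).
Proof.
have [->|d0] := eqVneq d 0.
  rewrite (_ : trapezoid_kernel a 0 = cst 0)//; apply/funext => t.
  by rewrite /trapezoid_kernel mul0r mulr0 invr0 mulr0; case: ifP.
rewrite (_ : trapezoid_kernel a d = fun t => (2 * fejer_mass * d)^-1 * (fejer (a + d) t - fejer a t)).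
  apply: measurable_funM => //; apply: measurable_funB; exact: measurable_fejer.
apply/funext => t; rewrite /trapezoid_kernel /fejer; case: ifPn => t0; last by rewrite subrr mulr0.
by field; rewrite d0 !gt_eqF//= fejer_mass_gt0.
Qed.

Lemma trapezoid_kernel_bound (v C : R) : 0 < v -> 0 < C -> exists2 C1, 0 < C1 &
  forall a d t, 0 <= a -> 0 < d -> d <= 1 -> ln d^-1 <= C * expR (v / 2 * a) ->
    `|trapezoid_kernel a d t| <= C1 * expR (v * a) * weight t.
Proof.
move=> v0 C0; have [C1 C10 h] := fejer_ratio_bound v0 C0.
have m0 := fejer_mass_gt0.
exists ((2 * fejer_mass)^-1 * C1); first by rewrite mulr_gt0// invr_gt0 mulr_gt0.
move=> a d t a0 d0 d1 lnd; rewrite /trapezoid_kernel; case: ifPn => t0; last first.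
  by rewrite normr0 !mulr_ge0 ?weight_ge0 ?expR_ge0// ?invr_ge0 ?mulr_ge0// ltW.
have m20 : 0 < 2 * fejer_mass by rewrite mulr_gt0.
have dt0 : 0 < d * t ^+ 2 by rewrite mulr_gt0// exprn_gt0.
rewrite normrM normfV normrM (gtr0_norm m20) (gtr0_norm dt0) invfM mulrCA -!mulrA.
rewrite ler_pM2l ?invr_gt0//.
by have := h _ _ _ a0 d0 d1 lnd t0; rewrite -mulrA.
Qed.

End fejer.

(** * Averages along a flow *)

Lemma measurable_fun_powR d (T : measurableType d) (R : realType) (f : T -> R) (p : R) :
  measurable_fun setT f -> measurable_fun setT (fun x => f x `^ p).
Proof.
by move=> mf; apply: (@measurableT_comp _ _ _ _ _ _ (@powR R ^~ p) _ f) => //; exact: measurable_powR.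
Qed.

Section weighted_jensen.
Context d (T : measurableType d) (R : realType) (mu : {measure set T -> \bar R}).
Local Open Scope ereal_scope.

(** Hoelder's inequality for k^(1/r) h and k^(1/q) with 1/r + 1/q = 1. The weight k is not
    normalised, whence its mass to the power r / q = r - 1. *)
Lemma weighted_jensen (k h : T -> R) (r : R) : (1 <= r)%R ->
  measurable_fun setT k -> measurable_fun setT h ->
  (forall x, 0 <= k x)%R -> (forall x, 0 <= h x)%R ->
  (\int[mu]_x (k x * h x)%:E) `^ r <=
  (\int[mu]_x (k x)%:E) `^ (r - 1) * \int[mu]_x (k x * h x `^ r)%:E.
Proof.
move=> r1 mk mh k0 h0.
have r0 : (0 < r)%R by rewrite (lt_le_trans _ r1).
have [req1|rneq1] := eqVneq r 1%R.
  rewrite req1 subrr poweRe0 mul1e poweRe1.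
    by under [in leRHS]eq_integral do rewrite powRr1//.
  by apply: integral_ge0 => x _; rewrite lee_fin mulr_ge0.
have rgt1 : (1 < r)%R by rewrite lt_neqAle eq_sym rneq1.
pose q := (r / (r - 1))%R.
have rm1 : (0 < r - 1)%R by rewrite subr_gt0.
have q0 : (0 < q)%R by rewrite divr_gt0.
have rq : (r^-1 + q^-1 = 1)%R by rewrite /q; field; rewrite !gt_eqF.
pose f x := (k x `^ r^-1 * h x)%R; pose g x := (k x `^ q^-1)%R.
have mf : measurable_fun setT f.
  by apply: measurable_funM => //; exact: measurable_fun_powR.
have mg : measurable_fun setT g by exact: measurable_fun_powR.
have := hoelder mu mf mg r0 q0 rq.
rewrite Lnorm1.
have -> : \int[mu]_x `|(EFin \o (f \* g)%R) x| = \int[mu]_x (k x * h x)%:E.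
  apply: eq_integral => x _; rewrite /= /f /g; congr EFin.
  rewrite ger0_norm ?mulr_ge0 ?powR_ge0// mulrAC -powRD ?rq ?oner_eq0 ?implybT//.
  by rewrite powRr1.
have -> : 'N[mu]_r%:E[EFin \o f] = (\int[mu]_x (k x * h x `^ r)%:E) `^ r^-1.
  rewrite unlock /=; congr (_ `^ _); apply: eq_integral => x _.
  rewrite /f /= ger0_norm ?mulr_ge0 ?powR_ge0//; congr EFin.
  by rewrite powRM ?powR_ge0// -powRrM mulVf ?gt_eqF// powRr1.
have -> : 'N[mu]_q%:E[EFin \o g] = (\int[mu]_x (k x)%:E) `^ q^-1.
  rewrite unlock /=; congr (_ `^ _); apply: eq_integral => x _.
  rewrite /g /= ger0_norm ?powR_ge0//; congr EFin.
  by rewrite -powRrM mulVf ?gt_eqF// powRr1.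
have A0 : 0 <= \int[mu]_x (k x * h x)%:E by apply: integral_ge0 => x _; rewrite lee_fin mulr_ge0.
have B0 : 0 <= \int[mu]_x (k x * h x `^ r)%:E.
  by apply: integral_ge0 => x _; rewrite lee_fin mulr_ge0 ?powR_ge0.
have K0 : 0 <= \int[mu]_x (k x)%:E by apply: integral_ge0 => x _; rewrite lee_fin.
move=> h1; apply: le_trans (gt0_ler_poweR (ltW r0) _ _ h1) _.
- by rewrite in_itv/= A0 leey.
- by rewrite in_itv/= leey andbT mule_ge0// poweR_ge0.
rewrite poweRM ?poweR_ge0// -!poweRrM mulVf ?gt_eqF// poweRe1// muleC.
by rewrite (_ : q^-1 * r = r - 1)%R// /q; field; rewrite !gt_eqF.
Qed.

End weighted_jensen.

Lemma abse_fine_le (R : realDomainType) (y : \bar R) : (`|fine y|%:E <= `|y|)%E.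
Proof. by case: y => [r| |]//=; rewrite normr0 leey. Qed.

Section almost_everywhere.
Context d (T : measurableType d) (R : realType) (mu : {measure set T -> \bar R}).
Implicit Types P Q : T -> Prop.

Lemma ae_imp P Q : (forall x, P x -> Q x) ->
  {ae mu, forall x, P x} -> {ae mu, forall x, Q x}.
Proof. by move=> PQ; apply: filterS. Qed.

Lemma ae_imp2 P Q S : (forall x, P x -> Q x -> S x) ->
  {ae mu, forall x, P x} -> {ae mu, forall x, Q x} -> {ae mu, forall x, S x}.
Proof. by move=> PQ; apply: filterS2. Qed.

End almost_everywhere.

Section flow_measurability.
Context {R : realType} {G : topologicalZmodType}.

(** A countable base of the real factor is enough: for each rational ball B, all open W with W x B
    inside the open preimage merge into one open set V, and the preimage is the countable union of
    the boxes V x B. *)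
Lemma continuous_flow_measurable (phi : R -> G) : continuous phi ->
  measurable_fun setT ((fun z => (z.1 : G) + phi z.2) : borel G * measurableTypeR R -> borel G).
Proof.
move=> cphi; apply: measurable_fun_borel => U oU.
pose O := (fun z : G * R => z.1 + phi z.2) @^-1` U.
have oO : open O.
  suff /continuousP : continuous (fun z : G * R => z.1 + phi z.2) by exact.
  have c2 : continuous (fun z : G * R => phi z.2) by apply: contcomp => //; exact: contsnd.
  by apply: gcontD => //; exact: contfst.
pose B (q : rat) (n : nat) : set R := ball (ratr q : R) n.+1%:R^-1.
pose V q n : set G := \bigcup_(W in [set W : set G | open W /\ W `*` B q n `<=` O]) W.
have -> : (fun z : borel G * measurableTypeR R => (z.1 : G) + phi z.2) @^-1` U =
    \bigcup_q \bigcup_n (V q n `*` B q n).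
  apply/seteqP; split; last first.
    by move=> [x t] [q _ [n _ [/= [W [_ WO] Wx] Bt]]]; exact: (WO (x, t)).
  move=> [x t0] Oxt; pose t : R := t0; rewrite -[t0]/t in Oxt *.
  have [[W A] /= [Wx At] WAO] : nbhs (x, t) O by exact: open_nbhs_nbhs.
  move: Wx; rewrite nbhsE => -[W' [oW' W'x] W'W].
  move: At => /nbhs_ballP[e /= e0 eA].
  have e20 : 0 < e / 2 by rewrite divr_gt0.
  have [n] := ltr_add_invr e20; rewrite add0r => ne.
  have n0 : 0 < n.+1%:R^-1 :> R by rewrite invr_gt0.
  have [q] : exists q : rat, ratr q \in `]t - n.+1%:R^-1, t + n.+1%:R^-1[.
    by apply: rat_in_itvoo; rewrite ltrBlDr -addrA ltrDl addr_gt0.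
  rewrite in_itv/= => /andP[q1 q2].
  exists q => //; exists n => //; split; rewrite /=; last first.
    by rewrite /B /ball/= ltr_distl q1.
  exists W' => //; split=> // -[y s] [/= W'y qs].
  apply: WAO; split; first exact: W'W.
  apply: eA; rewrite /ball/= (splitr e); apply: le_lt_trans (ler_distD (ratr q) _ _) _.
  rewrite ltrD//; last exact: lt_trans qs ne.
  by apply: le_lt_trans ne; rewrite distrC ler_distl !ltW.
apply: bigcupT_measurable_rat => q; apply: bigcupT_measurable => n.
apply: measurableX; last exact: measurable_ball.
apply: open_borel_measurable; apply: bigcup_open => W [] //.
Qed.

Lemma measurable_flow (phi : R -> G) (x : G) : continuous phi ->
  measurable_fun setT ((fun t => x + phi t) : measurableTypeR R -> borel G).
Proof.
move=> cphi; have := @pair1_measurable _ _ (borel G) (measurableTypeR R) x.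
by move=> /(measurableT_comp (continuous_flow_measurable cphi)).
Qed.

End flow_measurability.

Section flow_average.
Context {R : realType} {G : topologicalZmodType}.
Variable mu : probability (borel G) R.
Hypothesis haar : haar_probability mu.
Variable phi : R -> G.
Hypothesis cphi : continuous phi.
Local Notation leb := (@lebesgue_measure R).
Local Notation E := (mean mu).
Implicit Types (w V : R -> R) (g F : G -> R).

(** Extended values are kept since the integral can be infinite at some x even when [g] is
    integrable. *)
Definition flow_average w g (x : borel G) : \bar R :=
  (\int[leb]_t (w t * g ((x : G) + phi t))%:E)%E.

Definition flow_conv V F (x : G) : R :=
  Rintegral leb setT (fun t => V t * F (x + phi t)).

Let flow_kernel_measurable w g : measurable_fun setT w ->
  measurable_fun setT (g : borel G -> R) ->
  measurable_fun setT ((fun z => w z.2 * g ((z.1 : G) + phi z.2)) : borel G * measurableTypeR R -> R).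
Proof.
move=> mw mg; apply: measurable_funM; first exact: measurableT_comp.
by apply: (measurableT_comp mg); exact: continuous_flow_measurable.
Qed.

Lemma measurable_flow_average w g : measurable_fun setT w -> (forall t, 0 <= w t) ->
  measurable_fun setT (g : borel G -> R) -> (forall x, 0 <= g x) ->
  measurable_fun setT (flow_average w g).
Proof.
move=> mw w0 mg g0.
apply: (measurable_fun_fubini_tonelli_F (m2 := leb)
  (EFin \o (fun z : borel G * measurableTypeR R => w z.2 * g ((z.1 : G) + phi z.2)))).
  by apply/measurable_EFinP; exact: flow_kernel_measurable.
by move=> z; rewrite /= lee_fin mulr_ge0.
Qed.

Lemma integral_flow_average w g : measurable_fun setT w -> (forall t, 0 <= w t) ->
  measurable_fun setT (g : borel G -> R) -> (forall x, 0 <= g x) ->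
  (\int[mu]_x flow_average w g x = \int[leb]_t (w t)%:E * \int[mu]_x (g x)%:E)%E.
Proof.
move=> mw w0 mg g0.
rewrite (fubini_tonelli (m1 := mu) (m2 := leb)
  (EFin \o (fun z : borel G * measurableTypeR R => w z.2 * g ((z.1 : G) + phi z.2)))); first last.
- by move=> z; rewrite /= lee_fin mulr_ge0.
- by apply/measurable_EFinP; exact: flow_kernel_measurable.
rewrite -ge0_integralZr//; first last.
- by apply: integral_ge0 => x _; rewrite lee_fin.
- by move=> t _; rewrite lee_fin.
- exact/measurable_EFinP.
apply: eq_integral => t _ /=.
rewrite -(ge0_integral_translate haar (phi t) (f := EFin \o g))//; last first.
  exact/measurable_EFinP.
rewrite -ge0_integralZl//.
- apply/measurable_EFinP; apply: (measurableT_comp mg); exact: measurable_translate.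
- by move=> x _; rewrite lee_fin.
- by rewrite lee_fin.
Qed.

(** Jensen in t at each x, then Tonelli and the invariance of mu, which replaces each translate of g
    by g. *)
Lemma integral_poweR_flow_average_le w g (r : R) : 1 <= r ->
  measurable_fun setT w -> (forall t, 0 <= w t) ->
  measurable_fun setT (g : borel G -> R) -> (forall x, 0 <= g x) ->
  (\int[mu]_x (flow_average w g x `^ r) <=
   (\int[leb]_t (w t)%:E) `^ r * \int[mu]_x (g x `^ r)%:E)%E.
Proof.
move=> r1 mw w0 mg g0.
have mgr : measurable_fun setT ((fun x => g x `^ r) : borel G -> R).
  exact: measurable_fun_powR.
have W0 : (0 <= \int[leb]_t (w t)%:E)%E by apply: integral_ge0 => t _; rewrite lee_fin.
apply: (@le_trans _ _ (\int[mu]_x ((\int[leb]_t (w t)%:E) `^ (r - 1) *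
    flow_average w (fun x => (g x) `^ r)%R x))%E).
  apply: ge0_le_integral => //.
  - by move=> x _; exact: poweR_ge0.
  - apply: (@measurableT_comp _ _ _ _ _ _ (fun y : \bar R => y `^ r)%E).
      exact: measurable_poweR.
    exact: measurable_flow_average.
  - apply: emeasurable_funM => //; apply: measurable_flow_average => // x.
    exact: powR_ge0.
  - move=> x _; apply: weighted_jensen => //.
    exact: (measurableT_comp mg (measurable_flow x cphi)).
rewrite ge0_integralZl//; last 3 first.
- by apply: measurable_flow_average => // x; exact: powR_ge0.
- by move=> x _; apply: integral_ge0 => t _; rewrite lee_fin mulr_ge0 ?powR_ge0.
- exact: poweR_ge0.
rewrite integral_flow_average//; last by move=> x; exact: powR_ge0.
rewrite muleA; apply: lee_wpmul2r; first by apply: integral_ge0 => x _; rewrite lee_fin powR_ge0.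
move: W0; set K := (\int[leb]_t _)%E => K0.
have [->|Kn0] := eqVneq K 0%E; first by rewrite mule0 poweR_ge0.
rewrite -{2}(poweRe1 K0) -poweRD ?subrK//.
by apply: nneg_neq0_poweRD_def => //; rewrite subr_ge0.
Qed.

(** The bound g <= M may fail along a whole orbit, so the integral at a given x cannot be estimated
    directly. The excess h = max (g - M, 0) has mean 0, its flow average therefore vanishes almost
    everywhere, and g <= M + h. *)
Lemma flow_average_le_ae w g (M : R) : 0 <= M ->
  measurable_fun setT w -> (forall t, 0 <= w t) ->
  measurable_fun setT (g : borel G -> R) -> (forall x, 0 <= g x) ->
  {ae mu, forall x, g x <= M} ->
  {ae mu, forall x, (flow_average w g x <= M%:E * \int[leb]_t (w t)%:E)%E}.
Proof.
move=> M0 mw w0 mg g0 gM.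
pose h x := Num.max (g x - M) 0.
have h0 x : 0 <= h x by rewrite le_max lexx orbT.
have mh : measurable_fun setT (h : borel G -> R).
  by apply: measurable_maxr => //; exact: measurable_funB.
have inth : (\int[mu]_x (h x)%:E = 0)%E.
  rewrite (ae_eq_integral (cst 0%E))// ?integral0//; first exact/measurable_EFinP.
  apply: (ae_imp _ gM) => x gx _.
  by congr EFin; apply/max_idPr; rewrite subr_le0.
have avg0 x : (0 <= flow_average w h x)%E.
  by apply: integral_ge0 => t _; rewrite lee_fin mulr_ge0.
have : (\int[mu]_x `|flow_average w h x| = 0)%E.
  under eq_integral => x _ do rewrite gee0_abs//.
  by rewrite integral_flow_average// inth mule0.
move=> /(ae_eq_integral_abs mu measurableT (measurable_flow_average mw w0 mh h0)).
apply: ae_imp => x /(_ I) hx.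
rewrite -[leRHS]adde0 -[X in (_ + X)%E]hx /flow_average -ge0_integralZl//; last 2 first.
- exact/measurable_EFinP.
- by move=> t _; rewrite lee_fin.
have mshift := measurable_flow x cphi.
rewrite -ge0_integralD//; last 4 first.
- by move=> t _; rewrite -EFinM lee_fin mulr_ge0.
- by apply/measurable_EFinP; apply: measurable_funM.
- by move=> t _; rewrite lee_fin mulr_ge0.
- by apply/measurable_EFinP; apply: measurable_funM => //; exact: (measurableT_comp mh mshift).
apply: ge0_le_integral => //.
- by move=> t _; rewrite lee_fin mulr_ge0.
- by apply/measurable_EFinP; apply: measurable_funM => //; exact: (measurableT_comp mg mshift).
- apply/measurable_EFinP; apply: measurable_funD; first exact: measurable_funM.
  by apply: measurable_funM => //; exact: (measurableT_comp mh mshift).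
- move=> t _; rewrite -EFinM -EFinD lee_fin [M * _]mulrC -mulrDr ler_wpM2l//.
  by rewrite /h -lerBlDl le_max lexx.
Qed.

Let flow_prod_integrable V F w : measurable_fun setT V -> (forall t, `|V t| <= w t) ->
  leb.-integrable setT (EFin \o w) -> mu.-integrable setT (EFin \o F : borel G -> _) ->
  (mu \x leb)%E.-integrable setT
    (EFin \o (fun z : borel G * measurableTypeR R => V z.2 * F ((z.1 : G) + phi z.2))).
Proof.
move=> mV Vw iw iF; have mw := integrable_measurable iw.
have mF : measurable_fun setT (F : borel G -> R) := integrable_measurable iF.
have w0 t : 0 <= w t by rewrite (le_trans _ (Vw t)).
have mFn : measurable_fun setT ((fun x => `|F x|) : borel G -> R) by exact: measurableT_comp.
apply: (@le_integrable_normr _ _ _ (mu \x leb)%E _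
  (fun z : borel G * measurableTypeR R => w z.2 * `|F ((z.1 : G) + phi z.2)|)).
- exact: flow_kernel_measurable.
- by move=> z; rewrite normrM ler_wpM2r.
apply/integrable12ltyP; first by apply/measurable_EFinP; exact: (flow_kernel_measurable mw mFn).
rewrite (_ : integral _ _ _ = (\int[mu]_x flow_average w (fun x => `|F x|%R) x)%E); last first.
  apply: eq_integral => x _; apply: eq_integral => t _ /=.
  by rewrite ger0_norm// mulr_ge0.
rewrite integral_flow_average//.
have [_ hF] := integrableP _ _ _ iF; have [_ hw] := integrableP _ _ _ iw.
apply: lte_mul_pinfty => //.
- by apply: integral_ge0 => t _; rewrite lee_fin.
- rewrite ge0_fin_numE; last by apply: integral_ge0 => t _; rewrite lee_fin.
  by move: hw; under eq_integral do rewrite /= ger0_norm//.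
Qed.

Lemma integrable_flow_conv V F w : measurable_fun setT V -> (forall t, `|V t| <= w t) ->
  leb.-integrable setT (EFin \o w) -> mu.-integrable setT (EFin \o F : borel G -> _) ->
  mu.-integrable setT (EFin \o flow_conv V F : borel G -> _).
Proof.
move=> mV Vw iw iF; have fi := flow_prod_integrable mV Vw iw iF.
have iFF := integrable_fubini_F fi.
have mFF := measurable_fubini_F fi.
have mc : measurable_fun setT (flow_conv V F : borel G -> R).
  by apply: measurableT_comp; [exact: fine_measurable|exact: mFF].
apply/integrableP; split; first exact/measurable_EFinP.
have [_] := integrableP _ _ _ iFF; apply: le_lt_trans.
apply: ge0_le_integral => //.
- by apply/measurable_EFinP; exact: measurableT_comp.
- exact: measurableT_comp.
- by move=> x _; exact: abse_fine_le.
Qed.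

Lemma flow_conv_le_average V F w x : measurable_fun setT V -> (forall t, `|V t| <= w t) ->
  measurable_fun setT w -> measurable_fun setT (F : borel G -> R) ->
  (`|flow_conv V F x|%:E <= flow_average w (fun x => `|F x|%R) x)%E.
Proof.
move=> mV Vw mw mF.
have w0 t : 0 <= w t by rewrite (le_trans _ (Vw t)).
have mFx := measurableT_comp mF (measurable_flow x cphi).
have mVF : measurable_fun setT (fun t : measurableTypeR R => V t * F (x + phi t)).
  exact: measurable_funM.
apply: (le_trans (abse_fine_le _)); apply: le_trans (le_abse_integral _ _ _) _ => //.
  exact/measurable_EFinP.
apply: ge0_le_integral => //.
- by apply: measurableT_comp => //; exact/measurable_EFinP.
- by apply/measurable_EFinP; apply: measurable_funM => //; exact: measurableT_comp.
- by move=> t _; rewrite /= lee_fin normrM ler_wpM2r.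
Qed.

(** Fubini and a translation move the flow from F onto the test function, where the addition
    formulas of characters apply. *)
Lemma mean_flow_conv V F w k (M : R) : measurable_fun setT V -> (forall t, `|V t| <= w t) ->
  leb.-integrable setT (EFin \o w) -> mu.-integrable setT (EFin \o F : borel G -> _) ->
  measurable_fun setT (k : borel G -> R) -> (forall x, `|k x| <= M) ->
  E (fun x => flow_conv V F x * k x) =
  Rintegral leb setT (fun t => V t * E (fun x => F x * k (x - phi t))).
Proof.
move=> mV Vw iw iF mk kM; have fi := flow_prod_integrable mV Vw iw iF.
pose f (z : borel G * measurableTypeR R) := V z.2 * F ((z.1 : G) + phi z.2) * k z.1.
have ifk : (mu \x leb)%E.-integrable setT (EFin \o f).
  apply: (@integrableMr_bounded _ _ _ (mu \x leb)%E
    (fun z : borel G * measurableTypeR R => V z.2 * F ((z.1 : G) + phi z.2)) (fun z => k z.1) M) => //.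
  exact: (measurableT_comp mk).
transitivity (Rintegral mu setT (fun x => Rintegral leb setT (fun t => f (x, t)))).
  rewrite /mean /Rintegral; congr fine; apply: ae_eq_integral => //.
  - apply/measurable_EFinP; apply: measurable_funM => //.
    exact: integrable_measurable (integrable_flow_conv mV Vw iw iF).
  - apply/measurable_EFinP; apply: measurableT_comp; first exact: fine_measurable.
    exact: (measurable_fubini_F ifk).
  - apply: ae_imp (ae_integrable1 fi) => x ix _.
    rewrite /flow_conv; congr EFin; rewrite -RintegralZr//.
rewrite (Rintegral_Fubini ifk); apply: eq_Rintegral => t _.
have iFk : mu.-integrable setT (EFin \o (fun x => F x * k (x - phi t)) : borel G -> _).
  apply: (@integrableMr_bounded _ _ _ mu F (fun x => k (x - phi t)) M) => //.
  exact: (measurableT_comp mk (measurable_translate (- phi t))).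
rewrite -(Rintegral_translate haar (phi t) iFk) -RintegralZl//; last first.
  exact: (integrable_translate haar (phi t) iFk).
by apply: eq_Rintegral => x _; rewrite /f/= addrK mulrA.
Qed.

End flow_average.

Section flow_transform.
Context {R : realType} {G : topologicalZmodType}.
Variable mu : probability (borel G) R.
Hypothesis haar : haar_probability mu.
Variable beta : R -> G.
Hypothesis cbeta : continuous beta.
Local Notation leb := (@lebesgue_measure R).
Local Notation E := (mean mu).
Local Notation Re := (@complex.Re R).
Local Notation Im := (@complex.Im R).
Variables (V w : R -> R) (F : G -> R) (chi : G -> R[i]).
Hypothesis mV : measurable_fun setT V.
Hypothesis Vw : forall t, `|V t| <= w t.
Hypothesis iw : leb.-integrable setT (EFin \o w).
Hypothesis iF : mu.-integrable setT (EFin \o F : borel G -> \bar R).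
Hypothesis cchi : character chi.

Let nbeta (t : R) : G := - beta t.

Let cnbeta : continuous nbeta.
Proof. exact: gcontN. Qed.

Let V_integrable (c : R -> R) : continuous c -> (forall t, `|c t| <= 1) ->
  leb.-integrable setT (EFin \o (fun t => V t * c t)).
Proof.
move=> cc c1; apply: (@le_integrable_normr _ (measurableTypeR R) R leb (fun t => V t * c t) w) => //.
  by apply: measurable_funM => //; exact: continuous_measurable_fun.
by move=> t; rewrite normrM (le_trans _ (Vw t))// ler_piMr.
Qed.

Let Re_le1 x : `|Re (chi x)| <= 1.
Proof. by rewrite -(character_normc x cchi) ler_Re_normc. Qed.

Let Im_le1 x : `|Im (chi x)| <= 1.
Proof. by rewrite -(character_normc x cchi) ler_Im_normc. Qed.

Let iFk (k : G -> R) : continuous k -> (forall x, `|k x| <= 1) ->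
  mu.-integrable setT (EFin \o (fun x => F x * k x) : borel G -> _).
Proof.
by move=> ck k1; apply: (integrableMr_bounded iF _ k1); exact: continuous_borel_measurable_fun.
Qed.

Let cRe : continuous (fun x => Re (chi x)) := character_Re_continuous cchi.
Let cIm : continuous (fun x => Im (chi x)) := character_Im_continuous cchi.

Let mean_sum (k k1 k2 : G -> R) (a b : R) :
  continuous k1 -> continuous k2 ->
  (forall x, `|k1 x| <= 1) -> (forall x, `|k2 x| <= 1) ->
  (forall x, k x = k1 x * a + k2 x * b) ->
  E (fun x => F x * k x) = a * E (fun x => F x * k1 x) + b * E (fun x => F x * k2 x).
Proof.
move=> c1 c2 k11 k21 kE.
rewrite /mean -[X in _ = X + _]RintegralZl//; last exact: iFk.
rewrite -[X in _ = _ + X]RintegralZl//; last exact: iFk.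
rewrite -RintegralD//; last 2 first.
- by apply: (integrable_real_Z a); exact: iFk.
- by apply: (integrable_real_Z b); exact: iFk.
by apply: eq_Rintegral => x _; rewrite kE; ring.
Qed.

Let Rintegral_sum (m c s : R -> R) (a b : R) : continuous c -> continuous s ->
  (forall t, `|c t| <= 1) -> (forall t, `|s t| <= 1) ->
  (forall t, m t = c t * a + s t * b) ->
  Rintegral leb setT (fun t => V t * m t) =
  Rintegral leb setT (fun t => V t * c t) * a + Rintegral leb setT (fun t => V t * s t) * b.
Proof.
move=> cc cs c1 s1 mE.
rewrite -[X in _ = X + _]RintegralZr//; last exact: V_integrable.
rewrite -[X in _ = _ + X]RintegralZr//; last exact: V_integrable.
rewrite -RintegralD//.
- by apply: eq_Rintegral => t _; rewrite mE; ring.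
- under [EFin \o _]eq_fun do rewrite mulrC.
  by apply: (integrable_real_Z a); exact: V_integrable.
- under [EFin \o _]eq_fun do rewrite mulrC.
  by apply: (integrable_real_Z b); exact: V_integrable.
Qed.

Local Notation gamma c := (Rintegral leb setT (fun t => V t * c t)).

Let mean_flow_conv_Re (phi : R -> G) : continuous phi ->
  E (fun x => flow_conv phi V F x * Re (chi x)) =
  gamma (fun t => Re (chi (phi t))) * E (fun x => F x * Re (chi x)) +
  gamma (fun t => Im (chi (phi t))) * E (fun x => F x * Im (chi x)).
Proof.
move=> cphi; rewrite (mean_flow_conv haar cphi mV Vw iw iF _ Re_le1); last first.
  exact: continuous_borel_measurable_fun.
apply: Rintegral_sum => //; [exact: (contcomp cRe cphi)|exact: (contcomp cIm cphi)|].
move=> t; apply: mean_sum => // x.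
by rewrite character_ReD// character_ReN// character_ImN//; ring.
Qed.

Let mean_flow_conv_Im (phi : R -> G) : continuous phi ->
  E (fun x => flow_conv phi V F x * Im (chi x)) =
  gamma (fun t => Re (chi (phi t))) * E (fun x => F x * Im (chi x)) -
  gamma (fun t => Im (chi (phi t))) * E (fun x => F x * Re (chi x)).
Proof.
move=> cphi; rewrite (mean_flow_conv haar cphi mV Vw iw iF _ Im_le1); last first.
  exact: continuous_borel_measurable_fun.
rewrite -mulrN; apply: Rintegral_sum => //; [exact: (contcomp cRe cphi)|exact: (contcomp cIm cphi)|].
move=> t; rewrite mulrN -mulNr; apply: mean_sum => // x.
by rewrite character_ImD// character_ReN// character_ImN//; ring.
Qed.

(** Adding the reversed flow cancels the transform of [V] against Im chi, so the Fourier coefficient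
    is multiplied by a real number. *)
Definition flow_symconv x : R := flow_conv beta V F x + flow_conv nbeta V F x.

Lemma integrable_flow_symconv :
  mu.-integrable setT (EFin \o flow_symconv : borel G -> \bar R).
Proof.
by apply: integrable_real_D; apply: (integrable_flow_conv haar _ mV Vw iw iF).
Qed.

Let gammaN : gamma (fun t => Im (chi (nbeta t))) = - gamma (fun t => Im (chi (beta t))).
Proof.
rewrite -mulN1r -RintegralZl//; last first.
  by apply: V_integrable => //; exact: (contcomp cIm cbeta).
by apply: eq_Rintegral => t _; rewrite character_ImN//; ring.
Qed.

Let gammaE : gamma (fun t => Re (chi (nbeta t))) = gamma (fun t => Re (chi (beta t))).
Proof. by apply: eq_Rintegral => t _; rewrite character_ReN. Qed.

Let split_sym (k : G -> R) : continuous k -> (forall x, `|k x| <= 1) ->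
  E (fun x => flow_symconv x * k x) =
  E (fun x => flow_conv beta V F x * k x) + E (fun x => flow_conv nbeta V F x * k x).
Proof.
move=> ck k1; have mk := continuous_borel_measurable_fun ck.
rewrite /mean -RintegralD//.
- by apply: eq_Rintegral => x _; rewrite mulrDl.
- exact: (integrableMr_bounded (integrable_flow_conv haar cbeta mV Vw iw iF) mk k1).
- exact: (integrableMr_bounded (integrable_flow_conv haar cnbeta mV Vw iw iF) mk k1).
Qed.

Lemma mean_flow_symconv_Re : E (fun x => flow_symconv x * Re (chi x)) =
  2 * gamma (fun t => Re (chi (beta t))) * E (fun x => F x * Re (chi x)).
Proof.
rewrite split_sym// !mean_flow_conv_Re// gammaN gammaE; ring.
Qed.

Lemma mean_flow_symconv_Im : E (fun x => flow_symconv x * Im (chi x)) =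
  2 * gamma (fun t => Re (chi (beta t))) * E (fun x => F x * Im (chi x)).
Proof.
rewrite split_sym// !mean_flow_conv_Im// gammaN gammaE; ring.
Qed.

End flow_transform.

(** * Fourier coefficients of complex functions *)

Section complex_integral.
Context {R : realType} {G : topologicalZmodType}.
Variable mu : probability (borel G) R.
Local Notation E := (mean mu).
Local Notation Re := (@complex.Re R).
Local Notation Im := (@complex.Im R).
Implicit Types (f g : G -> R[i]) (chi : G -> R[i]).

Definition cintegrable f :=
  mu.-integrable setT (EFin \o (Re \o f) : borel G -> \bar R) /\
  mu.-integrable setT (EFin \o (Im \o f) : borel G -> \bar R).

Lemma cintegrableD f g : cintegrable f -> cintegrable g -> cintegrable (fun x => f x + g x).
Proof.
move=> [f1 f2] [g1 g2]; split.
- rewrite (_ : Re \o _ = (fun x => Re (f x) + Re (g x))); first exact: integrable_real_D.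
  by apply/funext => x /=; rewrite raddfD.
- rewrite (_ : Im \o _ = (fun x => Im (f x) + Im (g x))); first exact: integrable_real_D.
  by apply/funext => x /=; rewrite raddfD.
Qed.

Lemma ReM (z w : R[i]) : Re (z * w) = Re z * Re w - Im z * Im w.
Proof. by case: z w => [a b] [c d]. Qed.

Lemma ImM (z w : R[i]) : Im (z * w) = Re z * Im w + Im z * Re w.
Proof. by case: z w => [a b] [c d]. Qed.

Lemma Re_conj (z : R[i]) : Re z^* = Re z. Proof. by case: z. Qed.

Lemma Im_conj (z : R[i]) : Im z^* = - Im z. Proof. by case: z. Qed.

Lemma complexE (z w : R[i]) : Re z = Re w -> Im z = Im w -> z = w.
Proof. by case: z w => [a b] [c d] /= -> ->. Qed.

Lemma cintegrableZ (c : R[i]) f : cintegrable f -> cintegrable (fun x => c * f x).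
Proof.
move=> [f1 f2]; split.
- rewrite (_ : Re \o _ = (fun x => Re c * Re (f x) - Im c * Im (f x))).
    by apply: integrable_real_B; exact: integrable_real_Z.
  by apply/funext => x /=; rewrite ReM.
- rewrite (_ : Im \o _ = (fun x => Re c * Im (f x) + Im c * Re (f x))).
    by apply: integrable_real_D; exact: integrable_real_Z.
  by apply/funext => x /=; rewrite ImM.
Qed.

Lemma cintegralD f g : cintegrable f -> cintegrable g ->
  cintegral mu (fun x => f x + g x) = cintegral mu f + cintegral mu g.
Proof.
move=> [f1 f2] [g1 g2]; apply: complexE => /=.
- by rewrite -RintegralD//; apply: eq_Rintegral => x _ /=; rewrite raddfD.
- by rewrite -RintegralD//; apply: eq_Rintegral => x _ /=; rewrite raddfD.
Qed.

Lemma cintegralZ (c : R[i]) f : cintegrable f ->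
  cintegral mu (fun x => c * f x) = c * cintegral mu f.
Proof.
move=> [f1 f2]; apply: complexE; rewrite ?ReM ?ImM /=.
- rewrite -!RintegralZl// -RintegralB//; try exact: integrable_real_Z.
  by apply: eq_Rintegral => x _ /=; rewrite ReM.
- rewrite -!RintegralZl// -RintegralD//; try exact: integrable_real_Z.
  by apply: eq_Rintegral => x _ /=; rewrite ImM.
Qed.

(** Real and imaginary parts are bounded separately; the resulting factor 2 reappears in the final
    constant. *)
Lemma norm_cintegral_le f (g : G -> R) : cintegrable f ->
  mu.-integrable setT (EFin \o g : borel G -> \bar R) ->
  (forall x, Normc.normc (f x) <= g x) -> Normc.normc (cintegral mu f) <= 2 * E g.
Proof.
move=> [f1 f2] ig fg; apply: le_trans (normc_le_ReIm _) _.
rewrite mulr_natl mulr2n /=.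
apply: lerD; apply: le_trans (le_normr_Rintegral _ _) _ => //;
  apply: le_Rintegral => //; try exact: integrable_normr.
- by move=> x _ /=; apply: le_trans (ler_Re_normc _) (fg x).
- by move=> x _ /=; apply: le_trans (ler_Im_normc _) (fg x).
Qed.

Section character_multiplication.
Variable chi : G -> R[i].
Hypothesis cchi : character chi.

Let Re_le1 x : `|Re (chi x)| <= 1.
Proof. by rewrite -(character_normc x cchi) ler_Re_normc. Qed.

Let Im_le1 x : `|Im (chi x)| <= 1.
Proof. by rewrite -(character_normc x cchi) ler_Im_normc. Qed.

Lemma integrable_mul_Re (F : G -> R) : mu.-integrable setT (EFin \o F : borel G -> \bar R) ->
  mu.-integrable setT (EFin \o (fun x => F x * Re (chi x)) : borel G -> \bar R).
Proof.
move=> iF; apply: (integrableMr_bounded iF _ Re_le1).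
exact: (continuous_borel_measurable_fun (character_Re_continuous cchi)).
Qed.

Lemma integrable_mul_Im (F : G -> R) : mu.-integrable setT (EFin \o F : borel G -> \bar R) ->
  mu.-integrable setT (EFin \o (fun x => F x * Im (chi x)) : borel G -> \bar R).
Proof.
move=> iF; apply: (integrableMr_bounded iF _ Im_le1).
exact: (continuous_borel_measurable_fun (character_Im_continuous cchi)).
Qed.

Lemma cintegrable_mul_conj f : cintegrable f -> cintegrable (fun x => f x * (chi x)^*).
Proof.
move=> [f1 f2]; split.
- rewrite (_ : Re \o _ = (fun x => Re (f x) * Re (chi x) + Im (f x) * Im (chi x))).
    by apply: integrable_real_D; [exact: integrable_mul_Re|exact: integrable_mul_Im].
  by apply/funext => x /=; rewrite ReM Re_conj Im_conj mulrN opprK.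
- rewrite (_ : Im \o _ = (fun x => Im (f x) * Re (chi x) - Re (f x) * Im (chi x))).
    by apply: integrable_real_B; [exact: integrable_mul_Re|exact: integrable_mul_Im].
  by apply/funext => x /=; rewrite ImM Re_conj Im_conj mulrN addrC.
Qed.

Lemma fourierE f : cintegrable f -> fourier mu f chi =
  (E (fun x => Re (f x) * Re (chi x)) + E (fun x => Im (f x) * Im (chi x))) +i*
  (E (fun x => Im (f x) * Re (chi x)) - E (fun x => Re (f x) * Im (chi x))).
Proof.
move=> [f1 f2]; apply: complexE => /=; rewrite /mean.
- rewrite -RintegralD//; first last.
  - exact: integrable_mul_Im.
  - exact: integrable_mul_Re.
  by apply: eq_Rintegral => x _ /=; rewrite ReM Re_conj Im_conj mulrN opprK.
- rewrite -RintegralB//; first last.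
  - exact: integrable_mul_Im.
  - exact: integrable_mul_Re.
  by apply: eq_Rintegral => x _ /=; rewrite ImM Re_conj Im_conj mulrN addrC.
Qed.

Lemma fourierD f g : cintegrable f -> cintegrable g ->
  fourier mu (fun x => f x + g x) chi = fourier mu f chi + fourier mu g chi.
Proof.
move=> fi gi; rewrite /fourier -cintegralD; try exact: cintegrable_mul_conj.
by congr cintegral; apply/funext => x; rewrite mulrDl.
Qed.

Lemma fourierZ c f : cintegrable f ->
  fourier mu (fun x => c * f x) chi = c * fourier mu f chi.
Proof.
move=> fi; rewrite /fourier -cintegralZ; last exact: cintegrable_mul_conj.
by congr cintegral; apply/funext => x; rewrite mulrA.
Qed.

Lemma normc_fourier_le f : cintegrable f ->
  mu.-integrable setT (EFin \o (fun x => Normc.normc (f x)) : borel G -> \bar R) ->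
  Normc.normc (fourier mu f chi) <= 2 * E (fun x => Normc.normc (f x)).
Proof.
move=> fi ig; apply: norm_cintegral_le => //; first exact: cintegrable_mul_conj.
move=> x; rewrite -(mulr1 (Normc.normc (f x))) -(character_normc x (character_conj cchi)).
by rewrite Normc.normcM.
Qed.

End character_multiplication.

Lemma cintegrable_sum (F : nat -> G -> R[i]) m : (forall j, cintegrable (F j)) ->
  cintegrable (fun x => \sum_(j < m) F j x).
Proof.
move=> iF; elim: m => [|m IH].
  rewrite (_ : (fun x => _) = (fun x => 0 * F 0%N x)); first exact: cintegrableZ.
  by apply/funext => x; rewrite big_ord0 mul0r.
rewrite (_ : (fun x => _) = (fun x => \sum_(j < m) F j x + F m x)); first exact: cintegrableD.
by apply/funext => x; rewrite big_ord_recr.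
Qed.

Lemma fourier_sum (F : nat -> G -> R[i]) m chi : character chi ->
  (forall j, cintegrable (F j)) ->
  fourier mu (fun x => \sum_(j < m) F j x) chi = \sum_(j < m) fourier mu (F j) chi.
Proof.
move=> cchi iF; elim: m => [|m IH].
  rewrite big_ord0 (_ : (fun x => _) = (fun x => 0 * F 0%N x)).
    by rewrite fourierZ// mul0r.
  by apply/funext => x; rewrite big_ord0 mul0r.
rewrite big_ord_recr /= -IH -fourierD//; last exact: cintegrable_sum.
by congr fourier; apply/funext => x; rewrite big_ord_recr.
Qed.

End complex_integral.

Section compact_fourier.
Context {R : realType} {G : topologicalZmodType}.
Variable mu : probability (borel G) R.
Hypothesis cG : compact [set: G].
Hypothesis hG : hausdorff_space G.
Hypothesis haar : haar_probability mu.
Local Notation E := (mean mu).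
Local Notation Re := (@complex.Re R).
Local Notation Im := (@complex.Im R).
Implicit Types (f g : G -> R[i]) (chi : G -> R[i]).

Lemma fourier_eq0_ae f : cintegrable mu f ->
  (forall chi, character chi -> fourier mu f chi = 0) -> {ae mu, forall x, f x = 0}.
Proof.
move=> fi f0; have [f1 f2] := fi.
(* Conjugation changes only the sign of Im chi, so the coefficients at chi and at its conjugate
   together isolate the four real means. *)
have key chi : character chi ->
    [/\ E (fun x => Re (f x) * Re (chi x)) = 0, E (fun x => Re (f x) * Im (chi x)) = 0,
        E (fun x => Im (f x) * Re (chi x)) = 0 & E (fun x => Im (f x) * Im (chi x)) = 0].
  move=> cchi; have := f0 _ cchi; have := f0 _ (character_conj cchi).
  rewrite (fourierE cchi fi) (fourierE (character_conj cchi) fi).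
  have EN (F : G -> R) : mu.-integrable setT (EFin \o F : borel G -> \bar R) ->
      E (fun x => F x * Im (chi x)^*) = - E (fun x => F x * Im (chi x)).
    move=> iF; rewrite -mulN1r -RintegralZl//; last exact: integrable_mul_Im.
    by apply: eq_Rintegral => x _; rewrite Im_conj mulrN mulN1r.
  have ER (F : G -> R) : E (fun x => F x * Re (chi x)^*) = E (fun x => F x * Re (chi x)).
    by apply: eq_mean => x; rewrite Re_conj.
  rewrite (EN _ f1) (EN _ f2) !ER => -[e1 e2] [e3 e4].
  split; lra.
have r1 : {ae mu, forall x, Re (f x) = 0}.
  by apply: (fourier_free_ae_eq0 cG hG haar f1) => chi /key[].
have r2 : {ae mu, forall x, Im (f x) = 0}.
  by apply: (fourier_free_ae_eq0 cG hG haar f2) => chi /key[].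
by apply: ae_imp2 r1 r2 => x e1 e2; apply: complexE.
Qed.

Lemma cintegrable_character chi : character chi -> cintegrable mu chi.
Proof.
move=> cchi; split.
- exact: (continuous_integrable _ cG (character_Re_continuous cchi)).
- exact: (continuous_integrable _ cG (character_Im_continuous cchi)).
Qed.

(** Translation by y multiplies the mean of chi by chi y. In real terms (A, B) solves a homogeneous
    linear system with determinant (1 - c)^2 + s^2, nonzero since chi y is not 1. *)
Lemma character_mean_eq0 chi y : character chi -> chi y != 1 ->
  E (fun x => Re (chi x)) = 0 /\ E (fun x => Im (chi x)) = 0.
Proof.
move=> cchi chiy.
have cR := character_Re_continuous cchi; have cI := character_Im_continuous cchi.
set A := E _; set B := E _; set c := Re (chi y); set s := Im (chi y).
have eA : A = c * A - s * B.
  rewrite {1}/A -(mean_translate cG haar y cR).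
  under eq_mean do rewrite character_ReD//.
  rewrite meanB//; try by apply: contM => //; exact: contC.
  congr (_ - _); first by rewrite -meanZ//; apply: eq_mean => x; rewrite mulrC.
  by rewrite -meanZ//; apply: eq_mean => x; rewrite mulrC.
have eB : B = s * A + c * B.
  rewrite {1}/B -(mean_translate cG haar y cI).
  under eq_mean do rewrite character_ImD//.
  rewrite meanD//; try by apply: contM => //; exact: contC.
  congr (_ + _); first by rewrite -meanZ//; apply: eq_mean => x; rewrite mulrC.
  by rewrite -meanZ//; apply: eq_mean => x; rewrite mulrC.
have D : (1 - c) ^+ 2 + s ^+ 2 != 0.
  apply: contra chiy; rewrite paddr_eq0 ?sqr_ge0// !sqrf_eq0 subr_eq0.
  by move=> /andP[/eqP c1 /eqP s0]; apply/eqP/complexE; rewrite -?c1 -?s0.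
have e1 : (1 - c) * A = - (s * B) by rewrite mulrBl mul1r {1}eA; ring.
have e2 : (1 - c) * B = s * A by rewrite mulrBl mul1r {1}eB; ring.
split; apply: (mulfI D); rewrite mulr0.
- have -> : ((1 - c) ^+ 2 + s ^+ 2) * A = (1 - c) * ((1 - c) * A) + s * (s * A) by ring.
  by rewrite e1 -e2; ring.
- have -> : ((1 - c) ^+ 2 + s ^+ 2) * B = (1 - c) * ((1 - c) * B) + s * (s * B) by ring.
  by rewrite e2 -(opprK (s * B)) -e1; ring.
Qed.

Lemma fourier_character chi psi : character chi -> character psi -> 
  fourier mu chi psi = (`[< chi = psi >])%:R.
Proof.
move=> cchi cpsi; case: asboolP => [->|neq].
  rewrite /fourier (_ : (fun x => _) = fun=> 1).
    by apply: complexE => /=; rewrite -[LHS]/(mean mu _) mean_cst.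
  apply/funext => x; rewrite -sqr_normc; have [_ _ ->] := cpsi.
  by rewrite expr1n.
have [ct tM t1] : character (fun x => chi x * (psi x)^*).
  have [c1 m1 n1] := cchi; have [c2 m2 n2] := character_conj cpsi; split.
  - move=> x; apply: cvgM; [exact: c1|exact: c2].
  - by move=> x y; rewrite m1 [X in _ * X]m2; ring.
  - by move=> x; rewrite normrM n1 n2 mulr1.
have [y yneq] : exists y, chi y * (psi y)^* != 1.
  apply: contrapT => H; apply: neq; apply/funext => x.
  have : chi x * (psi x)^* = 1.
    by apply/eqP; apply/negPn/negP => ne; apply: H; exists x.
  have [_ _ n2] := cpsi.
  move=> /(congr1 (fun z => z * psi x)).
  by rewrite mul1r -mulrA [_^* * _]mulrC -sqr_normc n2 expr1n mulr1.
have [e1 e2] := character_mean_eq0 (And3 ct tM t1) yneq.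
by apply: complexE.
Qed.

End compact_fourier.

(** * Abel summation *)

(** With y = exp (- (s - v) (b - a)), the condition s >= 2 v gives exp (- s (b - a)) >= y^2, and 1 -
    y^2 <= 2 (1 - y). The right side telescopes over consecutive frequencies. *)
Lemma abel_weight (R : realType) (v s a b : R) : 0 < v -> 2 * v <= s -> a <= b ->
  expR (v * a) * (expR (- (s * a)) - expR (- (s * b))) <=
  2 * (expR (- ((s - v) * a)) - expR (- ((s - v) * b))).
Proof.
move=> v0 vs ab; pose y := expR (- ((s - v) * (b - a))).
have y0 : 0 < y by rewrite expR_gt0.
have y1 : y <= 1.
  by rewrite -[leRHS]expR0 ler_expR oppr_le0 mulr_ge0 ?subr_ge0//; lra.
have e1 : expR (- ((s - v) * b)) = expR (- ((s - v) * a)) * y.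
  by rewrite /y -expRD; congr expR; ring.
have e2 : expR (v * a) * expR (- (s * a)) = expR (- ((s - v) * a)).
  by rewrite -expRD; congr expR; ring.
have e3 : expR (- ((s - v) * a)) * y ^+ 2 <= expR (v * a) * expR (- (s * b)).
  rewrite expr2 /y -!expRD ler_expR.
  have : 0 <= (s - 2 * v) * (b - a) by rewrite mulr_ge0 ?subr_ge0.
  by move=> ?; nra.
rewrite mulrBr e2 e1.
have := expR_gt0 (- ((s - v) * a)); move: (expR (- ((s - v) * a))) e3 => A e3 A0.
have : 0 <= A * (1 - y) ^+ 2 by rewrite mulr_ge0 ?sqr_ge0// ltW.
nra.
Qed.

Section abel_summation.
Context {R : realType}.
Variables (lam z : nat -> R) (v s Q : R).
Hypothesis lam_ge0 : forall n, 0 <= lam n.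
Hypothesis lam_homo : {homo lam : m n / (m < n)%N >-> m < n}.
Hypothesis lam_cvg : lam n @[n --> \oo] --> +oo.
Hypothesis v_gt0 : 0 < v.
Hypothesis vs : 2 * v <= s.
Let T n := \sum_(j < n) z j.
Hypothesis TQ : forall n, `|T n.+1| <= expR (v * lam n) * Q.

Let w n := expR (- (s * lam n)).
Let e n := expR (- ((s - v) * lam n)).
Let b n := T n.+1 * (w n - w n.+1).

Let s_gt0 : 0 < s.
Proof. by move: v_gt0 vs => ? ?; lra. Qed.

Let sv_gt0 : 0 < s - v.
Proof. by move: v_gt0 vs => ? ?; lra. Qed.

Let Q_ge0 : 0 <= Q.
Proof. by rewrite -(pmulr_rge0 _ (expR_gt0 (v * lam 0%N))) (le_trans _ (TQ 0%N)). Qed.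

Let abel_sum N : \sum_(j < N.+1) z j * w j = \sum_(j < N) b j + T N.+1 * w N.
Proof.
elim: N => [|N IH]; first by rewrite /T !big_ord_recr !big_ord0 /= !add0r.
rewrite big_ord_recr /= IH [in RHS]big_ord_recr /= /b -!addrA; congr (_ + _).
by rewrite [T N.+2]big_ord_recr /= -/(T N.+1); ring.
Qed.

Let b_le n : `|b n| <= 2 * Q * (e n - e n.+1).
Proof.
have le : lam n <= lam n.+1 by rewrite ltW// lam_homo.
have ww : 0 <= w n - w n.+1.
  by rewrite subr_ge0 ler_expR lerN2 ler_wpM2l// ltW.
rewrite /b normrM (ger0_norm ww).
apply: (le_trans (ler_wpM2r ww (TQ n))).
rewrite [X in X * _]mulrC -mulrA -mulrA [leRHS]mulrCA ler_wpM2l//.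
exact: abel_weight.
Qed.

Let sum_e N : \sum_(j < N) (e j - e j.+1) = e 0%N - e N.
Proof.
elim: N => [|N IH]; first by rewrite big_ord0 subrr.
by rewrite big_ord_recr /= IH; ring.
Qed.

Let e_le1 n : e n <= 1.
Proof. by rewrite -[leRHS]expR0 ler_expR oppr_le0 mulr_ge0// ltW. Qed.

Let e_gt0 n : 0 < e n. Proof. exact: expR_gt0. Qed.

Let sum_b_le N : \sum_(j < N) `|b j| <= 2 * Q * (e 0%N - e N).
Proof. by rewrite -sum_e mulr_sumr; apply: ler_sum => j _; exact: b_le. Qed.

Let tail_le N : `|T N.+1 * w N| <= Q * e N.
Proof.
rewrite normrM [`|w N|]ger0_norm ?expR_ge0//.
apply: (le_trans (ler_wpM2r (expR_ge0 _) (TQ N))).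
by rewrite mulrAC mulrC -expRD ler_wpM2l// ler_expR; lra.
Qed.

(** The telescoped part is at most 2 Q (e 0 - e N) and the boundary term at most Q e N. As e 0 <= 1,
    the bound is the same for all s >= 2 v, which allows a supremum over s. *)
Lemma abel_sum_le N : `|\sum_(j < N) z j * w j| <= 2 * Q.
Proof.
case: N => [|N]; first by rewrite big_ord0 normr0 mulr_ge0.
rewrite abel_sum; apply: le_trans (ler_normD _ _) _.
apply: le_trans (lerD (ler_norm_sum _ _ _) (tail_le N)) _.
apply: le_trans (lerD (sum_b_le N) (lexx _)) _.
have := e_le1 0%N; have := e_gt0 N; have := Q_ge0.
by move=> q0 eN e0; nra.
Qed.

Lemma abel_sum_cvg : cvgn (fun N => \sum_(j < N) z j * w j).
Proof.
have e0 : e n @[n --> \oo] --> 0.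
  apply: (@cvg_comp _ _ _ (fun n => (s - v) * lam n) (fun x => expR (- x)) _ (pinfty_nbhs R)).
    apply/cvgryPge => A; move/cvgryPge: lam_cvg => /(_ ((s - v)^-1 * A)).
    by apply: filterS => n; rewrite ler_pdivrMl.
  exact: cvgr_expR.
have cb : cvgn (series b).
  apply: normed_cvg; apply: nondecreasing_is_cvgn.
    by apply: nondecreasing_series => n _ _; exact: normr_ge0.
  exists (2 * Q) => _ [N _ <-]; rewrite /normed_series_of/= seriesEord/=.
  apply: le_trans (sum_b_le N) _.
  by rewrite ler_piMr ?mulr_ge0// lerBlDr (le_trans (e_le1 0%N))// lerDl ltW.
have ct : (fun N => T N.+1 * w N) n @[n --> \oo] --> 0.
  apply/cvgr0Pnorm_lt => eps eps0.
  have Qe : (fun n => Q * e n) n @[n --> \oo] --> Q * 0 by apply: cvgMr.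
  move: Qe; rewrite mulr0 => /cvgr0Pnorm_lt/(_ _ eps0); apply: filterS => n.
  apply: le_lt_trans; apply: le_trans (tail_le n) _; exact: ler_norm.
apply/cvg_ex; exists (limn (series b) + 0); rewrite -cvg_shiftS.
rewrite (_ : (fun n => _) = (fun n => series b n + T n.+1 * w n)).
  by apply: cvgD.
by apply/funext => n /=; rewrite abel_sum seriesEord.
Qed.

End abel_summation.

Section frequency_kernel.
Context {R : realType}.
Variable lam : nat -> R.
Hypothesis lam_freq : frequency lam.
Hypothesis lam_NC : condition_NC lam.

Lemma exists_dominated_trapezoid (v : R) : 0 < v -> exists2 K, 0 < K & forall n,
  exists m d, [/\ (n < m)%N, 0 < d, lam n + d <= lam m,
    forall t, `|trapezoid_kernel (lam n) d t| <= expR (v * lam n) * (K * weight t) &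
    m%:R - n%:R <= K * expR (v * lam n)].
Proof.
move=> v0; have [lam0 lamlt _] := lam_freq.
have v20 : 0 < v / 2 by rewrite divr_gt0.
have [C [C0 NC]] := lam_NC v20.
(* (NC) bounds the logarithm of a quotient whose numerator must be removed: - ln (lam m + lam n) <=
   - ln (lam 1). The second frequency lam 1 is positive, whereas lam 0 may be 0. *)
pose C' := C + `|ln (lam 1%N)|.
have C'0 : 0 < C' by rewrite ltr_pwDl.
have [C1 C10 C1P] := trapezoid_kernel_bound v0 C'0.
exists (C1 + C); first by rewrite addr_gt0.
move=> n; have [m [nm NCm]] := NC n.
have lnm : lam n < lam m by exact: lamlt.
have ln0 : 0 <= ln ((lam m + lam n) / (lam m - lam n)).
  rewrite ln_ge0// ler_pdivlMr ?subr_gt0// mul1r.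
  by have := lam0 n; lra.
have e1 : 1 <= expR (v / 2 * lam n).
  by rewrite -[leLHS]expR0 ler_expR mulr_ge0// ltW.
have mn0 : 0 <= m%:R - n%:R :> R by rewrite subr_ge0 ler_nat ltnW.
have ev : expR (v / 2 * lam n) <= expR (v * lam n).
  by rewrite ler_expR ler_wpM2r//; lra.
(* The kernel bound asks for d <= 1; a gap larger than 1 is simply not exhausted. *)
exists m, (Num.min (lam m - lam n) 1); split => //.
- by rewrite lt_min subr_gt0 lnm ltr01.
- by rewrite addrC -lerBrDr ge_min lexx.
- move=> t; apply: le_trans (C1P _ _ t (lam0 n) _ _ _) _.
  + by rewrite lt_min subr_gt0 lnm ltr01.
  + by rewrite ge_min lexx orbT.
  + case: (leP 1 (lam m - lam n)) => d1.
      by rewrite invr1 ln1 mulr_ge0// ?ltW// expR_gt0.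
    have lm : lam 1%N <= lam m + lam n.
      apply: (@le_trans _ _ (lam m)); last by rewrite lerDl.
      case: m nm {NCm lnm ln0 mn0 d1} => // -[|m] _ //.
      by rewrite ltW// lamlt.
    have l1 : 0 < lam 1%N by apply: le_lt_trans (lam0 0%N) _; exact: lamlt.
    have -> : ln (lam m - lam n)^-1 =
        ln ((lam m + lam n) / (lam m - lam n)) - ln (lam m + lam n).
      rewrite [ln (_ / _)]lnM ?posrE ?invr_gt0 ?subr_gt0//.
      - by rewrite addrAC subrr add0r.
      - exact: lt_le_trans lm.
    rewrite /C' [leRHS]mulrDl lerD//; first by rewrite (le_trans _ NCm)// lerDl.
    apply: (@le_trans _ _ (- ln (lam 1%N))).
      by rewrite lerN2 ler_ln// posrE//; exact: lt_le_trans lm.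
    by rewrite -normrN (le_trans (ler_norm _))// ler_peMr.
  + have := weight_ge0 t; have := expR_gt0 (v * lam n).
    move: (weight t) (expR _) => W X X0 W0.
    have : 0 <= C * X * W by rewrite !mulr_ge0// ltW.
    nra.
- have : C * expR (v / 2 * lam n) <= C * expR (v * lam n) by rewrite ler_wpM2l// ltW.
  have : 0 <= C1 * expR (v * lam n) by rewrite mulr_ge0 ?expR_ge0// ltW.
  rewrite mulrDl; lra.
Qed.

End frequency_kernel.

(** * Partial sums as flow averages *)

Lemma measurable_normc d (T : measurableType d) (R : realType) (f : T -> R[i]) :
  measurable_fun setT (@complex.Re R \o f) -> measurable_fun setT (@complex.Im R \o f) ->
  measurable_fun setT (fun x => Normc.normc (f x)).
Proof.
move=> m1 m2.
rewrite (_ : (fun x => _) = (fun x => Num.sqrt (complex.Re (f x) ^+ 2 + complex.Im (f x) ^+ 2))).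
  apply: (@measurableT_comp _ _ _ _ _ _ (@Num.sqrt R)).
    by apply: continuous_measurable_fun; exact: sqrt_continuous.
  by apply: measurable_funD; apply: measurable_funX.
by apply/funext => x; case: (f x).
Qed.

Lemma normcR (R : realType) (a : R) : Normc.normc a%:C = `|a|.
Proof. by rewrite /= expr0n addr0 sqrtr_sqr. Qed.

Lemma normc_sum_le (R : realType) (I : Type) (r : seq I) (P : pred I) (F : I -> R[i]) :
  Normc.normc (\sum_(i <- r | P i) F i) <= \sum_(i <- r | P i) Normc.normc (F i).
Proof.
elim/big_rec2: _ => [|i y x _ h]; first by rewrite /= expr0n addr0 sqrtr0.
by apply: le_trans (le_normcD _ _) _; rewrite lerD2l.
Qed.

Lemma flow_averageZ (R : realType) (G : topologicalZmodType) (phi : R -> G) (c : R)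
    (w : R -> R) (g : G -> R) x : continuous phi -> 0 <= c ->
  measurable_fun setT w -> (forall t, 0 <= w t) ->
  measurable_fun setT (g : borel G -> R) -> (forall x, 0 <= g x) ->
  flow_average phi (fun t => c * w t) g x = (c%:E * flow_average phi w g x)%E.
Proof.
move=> cphi c0 mw w0 mg g0; rewrite /flow_average -ge0_integralZl//.
- by apply: eq_integral => t _; rewrite -EFinM mulrA.
- apply/measurable_EFinP; apply: measurable_funM => //.
  exact: (measurableT_comp mg (measurable_flow x cphi)).
- by move=> t _; rewrite lee_fin mulr_ge0.
Qed.

Lemma le_flow_average (R : realType) (G : topologicalZmodType) (phi : R -> G)
    (w : R -> R) (g g' : G -> R) x : continuous phi ->
  measurable_fun setT w -> (forall t, 0 <= w t) ->
  measurable_fun setT (g : borel G -> R) -> measurable_fun setT (g' : borel G -> R) ->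
  (forall x, 0 <= g x <= g' x) -> (flow_average phi w g x <= flow_average phi w g' x)%E.
Proof.
move=> cphi mw w0 mg mg' gg; apply: ge0_le_integral => //.
- by move=> t _; rewrite lee_fin mulr_ge0// (andP (gg _)).1.
- apply/measurable_EFinP; apply: measurable_funM => //.
  exact: (measurableT_comp mg (measurable_flow x cphi)).
- apply/measurable_EFinP; apply: measurable_funM => //.
  exact: (measurableT_comp mg' (measurable_flow x cphi)).
- by move=> t _; rewrite lee_fin ler_wpM2l// (andP (gg _)).2.
Qed.

Section dirichlet.
Context {R : realType} {G : topologicalZmodType}.
Variable mu : probability (borel G) R.
Hypothesis cG : compact [set: G].
Hypothesis hG : hausdorff_space G.
Hypothesis haar : haar_probability mu.
Variable beta : R -> G.
Hypothesis cbeta : continuous beta.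
Local Notation leb := (@lebesgue_measure R).
Local Notation E := (mean mu).
Local Notation Re := (@complex.Re R).
Local Notation Im := (@complex.Im R).
Let nbeta (t : R) : G := - beta t.

Lemma dirichlet_character_inj (l l' : R) (chi : G -> R[i]) :
  dirichlet_character beta l chi -> dirichlet_character beta l' chi -> l = l'.
Proof.
move=> [_ h] [_ h']; apply/eqP/negPn/negP => neq.
have ll : l - l' != 0 by rewrite subr_eq0.
(* At this time the two characters would take opposite values. *)
pose t := pi / (l - l').
have := h t; rewrite h' => -[c s].
have : cos (l * t - l' * t) = -1.
  by rewrite -mulrBl mulrC divfK ?cospi.
rewrite cosB c (oppr_inj s) -!expr2 cos2Dsin2 => /eqP.
by rewrite -addr_eq0 (_ : 1 + 1 = 2%:R)// pnatr_eq0.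
Qed.

Variable lam : nat -> R.
Hypothesis lam_inj : injective lam.
Variable h : nat -> G -> R[i].
Hypothesis hh : forall n, dirichlet_character beta (lam n) (h n).
Variable f : G -> R[i].
Hypothesis fi : cintegrable mu f.
Hypothesis fsupp : forall chi, character chi -> fourier mu f chi != 0 -> exists n, chi = h n.

Definition cflow_symconv V (x : G) : R[i] :=
  flow_symconv beta V (Re \o f) x +i* flow_symconv beta V (Im \o f) x.

Let h_inj n m : h n = h m -> n = m.
Proof.
move=> e; apply: lam_inj; apply: (@dirichlet_character_inj _ _ (h n)); first exact: hh.
by rewrite e; exact: hh.
Qed.

Section transform.
Variables V w : R -> R.
Hypothesis mV : measurable_fun setT V.
Hypothesis Vw : forall t, `|V t| <= w t.
Hypothesis iw : leb.-integrable setT (EFin \o w).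

Lemma cintegrable_cflow_symconv : cintegrable mu (cflow_symconv V).
Proof.
have [f1 f2] := fi; split.
- exact: (integrable_flow_symconv haar cbeta mV Vw iw f1).
- exact: (integrable_flow_symconv haar cbeta mV Vw iw f2).
Qed.

Lemma fourier_cflow_symconv chi : character chi -> fourier mu (cflow_symconv V) chi =
  (2 * Rintegral leb setT (fun t => V t * Re (chi (beta t))))%:C * fourier mu f chi.
Proof.
move=> cchi; have [f1 f2] := fi.
rewrite (fourierE cchi cintegrable_cflow_symconv) (fourierE cchi fi) /cflow_symconv /=.
have R1 := mean_flow_symconv_Re haar cbeta mV Vw iw f1 cchi.
have R2 := mean_flow_symconv_Re haar cbeta mV Vw iw f2 cchi.
have I1 := mean_flow_symconv_Im haar cbeta mV Vw iw f1 cchi.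
have I2 := mean_flow_symconv_Im haar cbeta mV Vw iw f2 cchi.
rewrite R1 R2 I1 I2; apply: complexE; rewrite ?ReM ?ImM /=; ring.
Qed.

End transform.

Lemma spectral_identity (a d : R) (w : R -> R) m : 0 <= a -> 0 < d -> a + d <= lam m ->
  {homo lam : i j / (i <= j)%N >-> i <= j} ->
  (forall t, `|trapezoid_kernel a d t| <= w t) -> leb.-integrable setT (EFin \o w) ->
  {ae mu, forall x, cflow_symconv (trapezoid_kernel a d) x =
    \sum_(j < m) fourier mu f (h j) * (trapezoid a d (lam j))%:C * h j x}.
Proof.
move=> a0 d0 adm lam_le Vw iw; have mV := measurable_trapezoid_kernel a d.
have iA := cintegrable_cflow_symconv mV Vw iw.
pose c j := fourier mu f (h j) * (trapezoid a d (lam j))%:C.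
have ih j : cintegrable mu (fun x => c j * h j x).
  by apply: cintegrableZ; apply: cintegrable_character => //; exact: (hh j).1.
have iS := cintegrable_sum m ih.
have : {ae mu, forall x, cflow_symconv (trapezoid_kernel a d) x +
    (-1) * \sum_(j < m) c j * h j x = 0}.
  apply: (fourier_eq0_ae cG hG haar); first by apply: cintegrableD => //; exact: cintegrableZ.
  move=> chi cchi; rewrite fourierD//; last exact: cintegrableZ.
  rewrite fourierZ// (fourier_cflow_symconv mV Vw iw)//
    (fourier_sum m cchi ih) mulN1r.
  under eq_bigr => j _.
    rewrite fourierZ//; last by apply: cintegrable_character => //; exact: (hh j).1.
    rewrite (fourier_character cG haar (hh j).1 cchi).
    over.
  apply/eqP; rewrite subr_eq0; apply/eqP.
  (* Off the characters h n both sides vanish, by the spectral support of f. At h n the sum keeps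
     one term if n < m, and otherwise the trapezoid has already reached 0. *)
  have [[n chin]|nchi] := pselect (exists n, chi = h n); last first.
    have -> : fourier mu f chi = 0.
      by apply/eqP/negPn/negP => /(fsupp cchi).
    rewrite mulr0 big1// => j _; case: asboolP; last by rewrite mulr0.
    by move=> e; exfalso; apply: nchi; exists j.
  subst chi.
  rewrite (_ : 2 * _ = trapezoid a d (lam n)); last first.
    rewrite -Rintegral_trapezoid_kernel//; congr (_ * _); apply: eq_Rintegral => t _.
    by rewrite (hh n).2.
  have [nm|mn] := ltnP n m.
    rewrite (bigD1 (Ordinal nm))//= big1 ?addr0; last first.
      move=> j jn; case: asboolP; last by rewrite mulr0.
      by move=> /h_inj e; move: jn; rewrite -val_eqE /= e eqxx.
    by case: asboolP => // _; rewrite mulr1 mulrC.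
  rewrite trapezoid0//; last by rewrite (le_trans adm)// lam_le.
  rewrite mul0r big1// => j _; case: asboolP; last by rewrite mulr0.
  by move=> /h_inj e; move: mn; rewrite -e leqNgt ltn_ord.
by apply: ae_imp => x /eqP; rewrite mulN1r subr_eq0 => /eqP ->.
Qed.

Let g x := Normc.normc (f x).

Let g_ge0 x : 0 <= g x. Proof. exact: normc_ge0. Qed.

Let mf1 : measurable_fun setT (Re \o f : borel G -> R).
Proof. exact: integrable_measurable fi.1. Qed.

Let mf2 : measurable_fun setT (Im \o f : borel G -> R).
Proof. exact: integrable_measurable fi.2. Qed.

Let mg : measurable_fun setT (g : borel G -> R).
Proof. exact: measurable_normc. Qed.

Lemma integrable_normc : mu.-integrable setT (EFin \o g : borel G -> \bar R).
Proof.
apply: (@le_integrable_normr _ _ _ mu g (fun x => `|Re (f x)| + `|Im (f x)|)) => //.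
  by move=> x; rewrite ger0_norm// normc_le_ReIm.
by apply: integrable_real_D; apply: integrable_normr; [exact: fi.1|exact: fi.2].
Qed.

Lemma normc_cflow_symconv_le (V w : R -> R) (x : G) : measurable_fun setT V -> (forall t, `|V t| <= w t) ->
  measurable_fun setT w -> ((Normc.normc (cflow_symconv V x))%:E <=
    2%:E * (flow_average beta w g x + flow_average nbeta w g x))%E.
Proof.
move=> mV Vw mw; have w0 t : 0 <= w t by rewrite (le_trans _ (Vw t)).
have cnbeta : continuous nbeta by exact: gcontN.
have bound phi (F : G -> R) : continuous phi -> measurable_fun setT (F : borel G -> R) ->
    (forall x, `|F x| <= g x) -> (`|flow_conv phi V F x|%:E <= flow_average phi w g x)%E.
  move=> cphi mF Fg.
  apply: le_trans (flow_conv_le_average cphi _ mV Vw mw mF) _.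
  apply: le_flow_average => //; first exact: measurableT_comp.
  by move=> y; rewrite normr_ge0 Fg.
have sym (F : G -> R) : measurable_fun setT (F : borel G -> R) -> (forall x, `|F x| <= g x) ->
    (`|flow_symconv beta V F x|%:E <= flow_average beta w g x + flow_average nbeta w g x)%E.
  move=> mF Fg; apply: (@le_trans _ _ (`|flow_conv beta V F x|%:E + `|flow_conv nbeta V F x|%:E)%E).
    by rewrite -EFinD lee_fin ler_normD.
  by apply: leeD; exact: bound.
apply: (@le_trans _ _ (`|flow_symconv beta V (Re \o f) x|%:E +
    `|flow_symconv beta V (Im \o f) x|%:E)%E).
  by rewrite -EFinD lee_fin normc_le_ReIm.
rewrite mule_natl mule2n; apply: leeD; apply: sym => // y.
- exact: ler_Re_normc.
- exact: ler_Im_normc.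
Qed.

(** X stands for exp (v lam n). The trapezoid is 1 on the first n + 1 frequencies, so the partial
    sum is the average minus the terms with n < j < m. Each of these is at most 2 E g in modulus and
    their number is at most m - n <= K X. *)
Lemma normc_dirichlet_sum_le (w : R -> R) (K X d : R) n m : 
  measurable_fun setT w -> leb.-integrable setT (EFin \o w) ->
  (forall t, 0 <= w t) -> 0 <= X ->
  {homo lam : i j / (i <= j)%N >-> i <= j} ->
  (n < m)%N -> 0 < d -> lam n + d <= lam m -> (forall i, 0 <= lam i) ->
  (forall t, `|trapezoid_kernel (lam n) d t| <= X * w t) ->
  m%:R - n%:R <= K * X ->
  {ae mu, forall x, ((Normc.normc (\sum_(j < n.+1) fourier mu f (h j) * h j x))%:E <=
    X%:E * (2%:E * (flow_average beta w g x + flow_average nbeta w g x) +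
            (2 * K * E g)%:E))%E}.
Proof.
move=> mw iw w0 X0 lam_le nm d0 lnm lam0 Vw mnK; have ln0 := lam0 n.
have cnbeta : continuous nbeta by exact: gcontN.
have iXw : leb.-integrable setT (EFin \o (fun t => X * w t)) by exact: integrable_real_Z.
have mXw : measurable_fun setT (fun t => X * w t) by exact: measurable_funM.
apply: ae_imp (spectral_identity ln0 d0 lnm lam_le Vw iXw) => x.
have := normc_cflow_symconv_le x (measurable_trapezoid_kernel (lam n) d) Vw mXw.
have avg0 phi : (0 <= flow_average phi w g x)%E.
  by apply: integral_ge0 => t _; rewrite lee_fin mulr_ge0.
rewrite !flow_averageZ// -ge0_muleDr// muleCA => Ax.
rewrite -(big_mkord xpredT (fun j => fourier mu f (h j) * (trapezoid (lam n) d (lam j))%:C * h j x)).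
rewrite (big_cat_nat (n := n.+1))//= big_mkord.
rewrite [X in _ = X + _](eq_bigr (fun j : 'I_n.+1 => fourier mu f (h j) * h j x)); last first.
  by move=> j _; rewrite trapezoid1 ?mulr1// lam0 lam_le// -ltnS.
set S := \sum_(j < n.+1) _; set B := \sum_(_ <= _ < _) _ => AE.
have -> : S = cflow_symconv (trapezoid_kernel (lam n) d) x - B by rewrite AE addrK.
apply: (@le_trans _ _ ((Normc.normc (cflow_symconv (trapezoid_kernel (lam n) d) x))%:E +
    (Normc.normc B)%:E)%E).
  rewrite -EFinD lee_fin; apply: le_trans (le_normcD _ _) _.
  by rewrite normcN.
have B_le : Normc.normc B <= X * (2 * K * E g).
  have Eg0 : 0 <= E g by exact: mean_ge0.
  apply: le_trans (normc_sum_le _ _ _) _.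
  apply: (@le_trans _ _ (\sum_(n.+1 <= j < m) 2 * E g)).
    apply: ler_sum => j _; rewrite !Normc.normcM normcR (character_normc x (hh j).1) mulr1.
    apply: le_trans (normc_fourier_le (hh j).1 fi integrable_normc).
    by rewrite ler_piMr ?normc_ge0// norm_trapezoid_le1.
  rewrite sumr_const_nat -[leLHS]mulr_natl natrB//.
  have -> : X * (2 * K * E g) = (K * X) * (2 * E g) by ring.
  rewrite ler_wpM2r ?mulr_ge0//; apply: le_trans mnK.
  by rewrite lerD2l lerN2 ler_nat.
apply: (le_trans (leeD Ax (_ : (_ <= (X * (2 * K * E g))%:E)%E))); first by rewrite lee_fin.
by rewrite [leRHS]muleDr ?fin_num_adde_defl// [(X * (2 * K * E g))%:E]EFinM.
Qed.

End dirichlet.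

(** * The maximal inequality *)

Section integral_domination.
Context d (T : measurableType d) (R : realType) (mu : {measure set T -> \bar R}).
Local Open Scope ereal_scope.

(* No measurability: the integral of a nonnegative function is a supremum over simple functions. *)
Lemma ge0_le_integral_pointwise (f g : T -> \bar R) : (forall x, 0 <= f x) ->
  (forall x, f x <= g x) -> \int[mu]_x f x <= \int[mu]_x g x.
Proof.
move=> f0 fg; have g0 x : 0 <= g x by rewrite (le_trans (f0 x)).
rewrite !ge0_integralTE//; apply: ereal_sup_le => _ [h hf <-].
by exists h => // x; exact: le_trans (hf x) (fg x).
Qed.

(** [f] will be a power of the maximal function, a supremum over uncountably many s, so
    measurability is asked of [g] alone. Adding +oo to g on the exceptional null set gives a
    pointwise majorant with the same integral. *)
Lemma ge0_le_integral_ae (f g : T -> \bar R) : (forall x, 0 <= f x) ->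
  (forall x, 0 <= g x) -> measurable_fun setT g ->
  {ae mu, forall x, f x <= g x} -> \int[mu]_x f x <= \int[mu]_x g x.
Proof.
move=> f0 g0 mg [A [mA A0 fgA]].
pose k x := g x + +oo * (\1_A x)%:E.
have mk : measurable_fun setT k.
  apply: emeasurable_funD => //; apply: emeasurable_funM => //.
  by apply/measurable_EFinP; exact: measurable_indic.
have -> : \int[mu]_x g x = \int[mu]_x k x.
  apply: ae_eq_integral => //; exists A; split => // x; apply: contra_notP => Ax _.
  by rewrite /k indicE memNset// mule0 adde0.
apply: ge0_le_integral_pointwise => // x; rewrite /k indicE.
have [xA|xA] := boolP (x \in A).
  by rewrite mule1 addey ?leey// (gt_eqF (lt_le_trans ltNy0 (g0 x))).
rewrite mule0 adde0; apply: contrapT => nfg.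
by move: xA; rewrite notin_setE; apply; exact: fgA.
Qed.

Lemma le_Lnorm_ae (p : \bar R) (f : T -> \bar R) (g : T -> R) : 1 <= p ->
  measurable_fun setT g -> {ae mu, forall x, `|f x| <= (g x)%:E} ->
  Lnorm mu p f <= Lnorm mu p (EFin \o g).
Proof.
move=> p1 mg fg; case: p p1 => [r|_|//]; last first.
  rewrite unlock; case: ifPn => // _; apply: le_ess_sup.
  by apply: ae_imp fg => x; move/le_trans; apply; rewrite /= lee_fin ler_norm.
rewrite lee_fin => r1; have r0 : (0 <= r)%R by rewrite (le_trans _ r1).
rewrite unlock /=; apply: gt0_ler_poweR; rewrite ?invr_ge0//.
- by rewrite in_itv/= leey andbT; apply: integral_ge0 => x _; exact: poweR_ge0.
- by rewrite in_itv/= leey andbT; apply: integral_ge0 => x _; rewrite lee_fin powR_ge0.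
apply: ge0_le_integral_ae => //.
- by move=> x; exact: poweR_ge0.
- by apply/measurable_EFinP; apply: measurable_fun_powR; exact: measurableT_comp.
apply: ae_imp fg => x fgx; rewrite -poweR_EFin; apply: gt0_ler_poweR => //.
- by rewrite in_itv/= abse_ge0 leey.
- by rewrite in_itv/= leey lee_fin normr_ge0.
- by apply: le_trans fgx _; rewrite lee_fin ler_norm.
Qed.

End integral_domination.

Section probability_Lnorm.
Context d (T : measurableType d) (R : realType) (mu : probability T R).
Local Open Scope ereal_scope.

Lemma Lnorm_cst (p : \bar R) (c : R) : 1 <= p -> (0 <= c)%R ->
  Lnorm mu p (fun=> c%:E) = c%:E.
Proof.
move=> p1 c0; case: p p1 => [r|_|//]; last first.
  rewrite unlock /= probability_setT lte01 (_ : abse \o _ = cst c%:E).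
    by rewrite ess_sup_cst//= probability_setT lte01.
  by apply/funext => x /=; rewrite ger0_norm.
rewrite lee_fin => r1; have r0 : (r != 0)%R by rewrite gt_eqF// (lt_le_trans _ r1).
rewrite unlock /= integral_cst//= probability_setT mule1 ger0_norm//.
by rewrite poweR_EFin -powRrM mulfV// powRr1.
Qed.

Lemma integral_le_Lnorm (p : \bar R) (g : T -> R) : 1 <= p ->
  measurable_fun setT g -> (forall x, (0 <= g x)%R) ->
  \int[mu]_x (g x)%:E <= Lnorm mu p (EFin \o g).
Proof.
move=> p1 mg g0; case: p p1 => [r|_|//]; last first.
  rewrite unlock /= probability_setT lte01.
  set M := ess_sup _ _.
  have gM : {ae mu, forall x, (g x)%:E <= M}.
    by apply: ae_imp (ess_sup_ge mu (abse \o (EFin \o g))) => x; rewrite /= ger0_norm.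
  have -> : M = \int[mu]_x (cst M x) by rewrite integral_cst//= probability_setT mule1.
  apply: ge0_le_integral_ae => //.
  by move=> x /=; have := Lnorm_ge0 mu +oo (EFin \o g); rewrite unlock /= probability_setT lte01.
rewrite lee_fin => r1; have r0 : (r != 0)%R by rewrite gt_eqF// (lt_le_trans _ r1).
have I0 : 0 <= \int[mu]_x (g x)%:E by apply: integral_ge0 => x _; rewrite lee_fin.
have := @weighted_jensen _ _ _ mu (fun=> 1%R) g r r1 _ mg _ g0.
move=> /(_ (measurable_cst _) (fun=> ler01)).
under [X in X `^ _ <= _]eq_integral do rewrite mul1r.
rewrite [X in X `^ (r - 1)]integral_cst//= probability_setT mul1e poweR1r mul1e.
under [leRHS]eq_integral do rewrite mul1r.
move=> J; rewrite -[leLHS](poweRe1 I0) -(mulfV r0) poweRrM unlock /=.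
under [in leRHS]eq_integral do rewrite ger0_norm//.
apply: gt0_ler_poweR => //.
- by rewrite invr_ge0 (le_trans _ r1).
- by rewrite in_itv/= poweR_ge0 leey.
- by rewrite in_itv/= leey andbT; apply: integral_ge0 => x _; rewrite lee_fin powR_ge0.
Qed.

End probability_Lnorm.

Section Lnorm_flow_average.
Context {R : realType} {G : topologicalZmodType}.
Variable mu : probability (borel G) R.
Hypothesis haar : haar_probability mu.
Variable phi : R -> G.
Hypothesis cphi : continuous phi.
Local Notation leb := (@lebesgue_measure R).

(** [fine] sends +oo to 0, which only lowers the left side. Finite p uses Jensen; p = +oo uses the
    almost everywhere bound with M the essential supremum of g. *)
Lemma Lnorm_flow_average_le (p : \bar R) (w : R -> R) (g : G -> R) : (1 <= p)%E ->
  leb.-integrable setT (EFin \o w) -> (forall t, 0 <= w t) ->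
  measurable_fun setT (g : borel G -> R) -> (forall x, 0 <= g x) ->
  (Lnorm mu p (EFin \o g : borel G -> \bar R) < +oo)%E ->
  (Lnorm mu p (fun x => (fine (flow_average phi w g x))%:E) <=
   (Rintegral leb setT w)%:E * Lnorm mu p (EFin \o g : borel G -> \bar R))%E.
Proof.
move=> p1 iw w0 mg g0 gfin; have mw := integrable_measurable iw.
have avg0 x : (0 <= flow_average phi w g x)%E.
  by apply: integral_ge0 => t _; rewrite lee_fin mulr_ge0.
have W0 : (0 <= \int[leb]_t (w t)%:E)%E by apply: integral_ge0 => t _; rewrite lee_fin.
have WE : (Rintegral leb setT w)%:E = (\int[leb]_t (w t)%:E)%E.
  by rewrite /Rintegral fineK//; exact: integrable_fin_num.
case: p p1 gfin => [r|_|//]; last first.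
  have := Lnorm_ge0 mu +oo (EFin \o g : borel G -> \bar R).
  rewrite unlock /= probability_setT lte01.
  set M := ess_sup _ _ => M0 Mfin.
  have ME : M = (fine M)%:E by rewrite fineK// ge0_fin_numE.
  have gM : {ae mu, forall x, g x <= fine M}.
    apply: ae_imp (ess_sup_ge mu (abse \o (EFin \o g))) => x.
    by rewrite -/M ME /= ger0_norm.
  apply/ess_supP.
  apply: ae_imp (flow_average_le_ae haar cphi (fine_ge0 M0) mw w0 mg g0 gM) => x.
  by rewrite -ME -WE muleC; apply: le_trans; apply: le_trans (abse_fine_le _) _; rewrite gee0_abs.
rewrite lee_fin => r1 gfin; have r0 : r != 0 by rewrite gt_eqF// (lt_le_trans _ r1).
have I0 : (0 <= \int[mu]_x (g x `^ r)%:E)%E by apply: integral_ge0 => x _; rewrite lee_fin powR_ge0.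
rewrite unlock /=.
under [in leRHS]eq_integral do rewrite ger0_norm//.
rewrite WE -[X in (X * _)%E](poweRe1 W0) -(mulfV r0) poweRrM -poweRM ?poweR_ge0//.
apply: gt0_ler_poweR.
- by rewrite invr_ge0 (le_trans _ r1).
- by rewrite in_itv/= leey andbT; apply: integral_ge0 => x _; rewrite lee_fin powR_ge0.
- by rewrite in_itv/= leey andbT mule_ge0// poweR_ge0.
apply: le_trans (integral_poweR_flow_average_le haar cphi r1 mw w0 mg g0).
apply: ge0_le_integral_pointwise => x; first by rewrite lee_fin powR_ge0.
rewrite -poweR_EFin; apply: gt0_ler_poweR; first by rewrite (le_trans _ r1).
- by rewrite in_itv/= leey lee_fin normr_ge0.
- by rewrite in_itv/= leey avg0.
- by apply: le_trans (abse_fine_le _) _; rewrite gee0_abs.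
Qed.

End Lnorm_flow_average.

Lemma Re_mulR (R : realType) (z : R[i]) (a : R) :
  complex.Re (z * a%:C) = complex.Re z * a.
Proof. by rewrite ReM /= mulr0 subr0. Qed.

Lemma Im_mulR (R : realType) (z : R[i]) (a : R) :
  complex.Im (z * a%:C) = complex.Im z * a.
Proof. by rewrite ImM /= mulr0 add0r. Qed.

Section maximal_bound.
Context {R : realType} {G : topologicalZmodType}.
Variable mu : probability (borel G) R.
Variables (lam : nat -> R) (h : nat -> G -> R[i]) (f : G -> R[i]).
Hypothesis lam_freq : frequency lam.
Local Notation Re := (@complex.Re R).
Local Notation Im := (@complex.Im R).

Let z x n : R[i] := fourier mu f (h n) * h n x.

Let partial_sumE s N x : partial_sum mu lam h f s N x =
  (\sum_(n < N) Re (z x n) * expR (- (s * lam n))) +i*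
  (\sum_(n < N) Im (z x n) * expR (- (s * lam n))).
Proof.
apply: complexE; rewrite /partial_sum raddf_sum; apply: eq_bigr => n _.
- by rewrite mulrAC; exact: Re_mulR.
- by rewrite mulrAC; exact: Im_mulR.
Qed.

(** At a single x, Abel summation of the real and of the imaginary parts costs 2 Q each, uniformly
    in N and in s >= u. *)
Lemma partial_sum_bounded (v u : R) (Q : R) x : 0 < v -> 2 * v <= u ->
  (forall n, Normc.normc (\sum_(j < n.+1) fourier mu f (h j) * h j x) <= expR (v * lam n) * Q) ->
  (maximal_function mu lam h f u x <= (4 * Q)%:E)%E /\
  cvgn (partial_sum mu lam h f u ^~ x : nat -> R[i]^o).
Proof.
move=> v0 vu zQ; have [lam0 lam_lt lam_cvg] := lam_freq.
have rQ n : `|\sum_(j < n.+1) Re (z x j)| <= expR (v * lam n) * Q.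
  by rewrite -raddf_sum (le_trans _ (zQ n))// ler_Re_normc.
have iQ n : `|\sum_(j < n.+1) Im (z x j)| <= expR (v * lam n) * Q.
  by rewrite -raddf_sum (le_trans _ (zQ n))// ler_Im_normc.
split.
  apply: ge_ereal_sup => _ [s /= us <-]; apply: ge_ereal_sup => _ [N _ <-].
  rewrite lee_fin partial_sumE (le_trans (normc_le_ReIm _))//=.
  have vs : 2 * v <= s by rewrite (le_trans vu).
  rewrite (_ : 4 * Q = 2 * Q + 2 * Q); last by ring.
  apply: lerD.
    exact: (@abel_sum_le _ lam (fun j => Re (z x j)) v).
  exact: (@abel_sum_le _ lam (fun j => Im (z x j)) v).
have /cvg_ex[a ca] := @abel_sum_cvg _ lam (fun j => Re (z x j)) v u Q lam0 lam_lt lam_cvg v0 vu rQ.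
have /cvg_ex[b cb] := @abel_sum_cvg _ lam (fun j => Im (z x j)) v u Q lam0 lam_lt lam_cvg v0 vu iQ.
apply/cvg_ex; exists (a +i* b).
rewrite (_ : partial_sum _ _ _ _ _ ^~ x = (fun N =>
    (\sum_(n < N) Re (z x n) * expR (- (u * lam n))) +i*
    (\sum_(n < N) Im (z x n) * expR (- (u * lam n))))).
  exact: cvg_complex.
by apply/funext => N; exact: partial_sumE.
Qed.

Lemma maximal_function_ge0 u x : (0 <= maximal_function mu lam h f u x)%E.
Proof.
apply: (@le_trans _ _ (Normc.normc (partial_sum mu lam h f u 1 x))%:E).
  by rewrite lee_fin normc_ge0.
apply: le_trans (ereal_sup_ubound _); last by exists u => //=.
by apply: ereal_sup_ubound; exists 1%N.
Qed.

End maximal_bound.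

Theorem theorem4p1 (R : realType) (lam : nat -> R)
    (lam_freq : frequency lam) (lam_NC : condition_NC lam) (u : R) (u_gt0 : 0 < u) :
  exists C : R, 0 < C /\
    forall (G : topologicalZmodType) (mu : probability (borel G) R)
      (beta : R -> G) (h : nat -> G -> R[i]),
    haar_probability mu ->
    dirichlet_group lam beta ->
    (forall n, dirichlet_character beta (lam n) (h n)) ->
    forall (p : \bar R) (f : G -> R[i]), (1 <= p)%E -> in_Hp mu h p f ->
      (Lnorm mu p (maximal_function mu lam h f u) <= C%:E * cLnorm mu p f)%E /\
      {ae mu, forall x, cvgn (partial_sum mu lam h f u ^~ x : nat -> R[i]^o)}.
Proof.
(* The largest v for which Abel summation, which needs 2 v <= s, covers every s >= u. *)
pose v := u / 2; have v0 : 0 < v by rewrite divr_gt0.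
have vu : 2 * v <= u by rewrite /v mulrC divfK.
have [lam0 lam_lt lam_cvg] := lam_freq.
have lam_le : {homo lam : i j / (i <= j)%N >-> i <= j}.
  by apply: ltW_homo.
have lam_inj : injective lam.
  move=> i j; have [ij|ij|//] := ltngtP i j => e.
  - by have := lam_lt _ _ ij; rewrite e ltxx.
  - by have := lam_lt _ _ ij; rewrite e ltxx.
have [K K0 KP] := exists_dominated_trapezoid lam_freq lam_NC v0.
(* The pointwise bound will be 4 Q with Q = 2 (a + b) + 2 K E g, where a and b are the averages of g
   against [kw] in the two directions of the flow; the factor 8 = 4 * 2 goes into [w]. *)
pose kw t := K * weight t; pose w t := 8 * kw t.
have w0 t : 0 <= w t by rewrite !mulr_ge0 ?weight_ge0// ltW.
have iKw : (@lebesgue_measure R).-integrable setT (EFin \o kw).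
  by apply: integrable_real_Z; exact: integrable_weight.
have iw : (@lebesgue_measure R).-integrable setT (EFin \o w).
  exact: integrable_real_Z.
have mKw := integrable_measurable iKw; have mw := integrable_measurable iw.
have Kw0 t : 0 <= kw t by rewrite mulr_ge0 ?weight_ge0// ltW.
pose W := Rintegral (@lebesgue_measure R) setT w.
have W0 : 0 <= W by apply: Rintegral_ge0 => t _; exact: w0.
(* 2 W comes from the two directions of the flow and 8 K from E g <= |f|_p on a probability space; W
   and K are built from lam and u alone. *)
exists (2 * W + 8 * K); split; first by rewrite ltr_wpDl ?mulr_ge0 ?mulr_gt0.
move=> G mu beta h haar [[cG hG] cbeta _ _ _] hh p f p1 [[mf1 mf2 fp] fsupp].
pose g x := Normc.normc (f x).
have g0 x : 0 <= g x by exact: normc_ge0.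
have mg : measurable_fun setT (g : borel G -> R) by exact: measurable_normc.
have Ig_le := integral_le_Lnorm mu p1 mg g0.
have ig : mu.-integrable setT (EFin \o g : borel G -> \bar R).
  apply/integrableP; split; first exact/measurable_EFinP.
  under eq_integral do rewrite /= ger0_norm//.
  exact: le_lt_trans Ig_le fp.
have fi : cintegrable mu f.
  by split; apply: le_integrable_normr ig => // x; [exact: ler_Re_normc|exact: ler_Im_normc].
have EgE : (mean mu g)%:E = (\int[mu]_x (g x)%:E)%E.
  by rewrite /mean /Rintegral fineK//; exact: integrable_fin_num.
have Eg0 : 0 <= mean mu g by exact: mean_ge0.
pose nbeta t := - beta t; have cnbeta : continuous nbeta by exact: gcontN.
pose q phi (x : borel G) := fine (flow_average phi w g x).
have mq phi : continuous phi -> measurable_fun setT (q phi).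
  move=> cphi; apply: measurableT_comp; first exact: fine_measurable.
  exact: measurable_flow_average.
(* The averages have finite mean, hence are finite almost everywhere, and [fine] loses nothing
   there. *)
have qfin phi : continuous phi ->
    {ae mu, forall x, flow_average phi kw g x \is a fin_num}.
  move=> cphi.
  have ia : mu.-integrable setT (flow_average phi kw g).
    apply/integrableP; split; first exact: measurable_flow_average.
    under eq_integral => x _.
      rewrite gee0_abs; last by apply: integral_ge0 => t _; rewrite lee_fin mulr_ge0.
      over.
    rewrite integral_flow_average// -EgE.
    have -> : (\int[lebesgue_measure]_t (kw t)%:E =
        (Rintegral lebesgue_measure setT kw)%:E)%E.
      by rewrite /Rintegral fineK//; exact: integrable_fin_num.
    by rewrite -EFinM ltry.
  by apply: ae_imp (integrable_ae measurableT ia) => x; exact.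
pose H x := q beta x + q nbeta x + 8 * K * mean mu g.
have bound : {ae mu, forall x,
    (maximal_function mu lam h f u x <= (H x)%:E)%E /\
    cvgn (partial_sum mu lam h f u ^~ x : nat -> R[i]^o)}.
  have Tn n : {ae mu, forall x,
      ((Normc.normc (\sum_(j < n.+1) fourier mu f (h j) * h j x))%:E <=
       (expR (v * lam n))%:E * (2%:E * (flow_average beta kw g x +
         flow_average nbeta kw g x) + (2 * K * mean mu g)%:E))%E}.
    have [m [d [nm d0 dm Vw mn]]] := KP n.
    by apply: (normc_dirichlet_sum_le cG hG haar cbeta lam_inj hh fi fsupp mKw iKw Kw0 _ lam_le nm d0 dm).
  (* The exceptional sets, one for each n, merge into a single null set; off it the supremum over
     all s is a pointwise matter. *)
  have {}Tn := ae_foralln Tn.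
  apply: ae_imp2 (filterI (qfin _ cbeta) (qfin _ cnbeta)) Tn => x [fa fb] Tx.
  have qE phi : continuous phi -> flow_average phi kw g x \is a fin_num ->
      q phi x = 8 * fine (flow_average phi kw g x).
    by move=> cphi ?; rewrite /q (flow_averageZ x cphi _ mKw Kw0 mg g0)// fineM.
  rewrite /H !qE//.
  set a := fine (flow_average beta _ g x); set b := fine (flow_average nbeta _ g x).
  have -> : 8 * a + 8 * b + 8 * K * mean mu g = 4 * (2 * (a + b) + 2 * K * mean mu g) by ring.
  apply: (partial_sum_bounded lam_freq v0 vu) => n.
  have := Tx n; rewrite -/nbeta -(fineK fa) -(fineK fb) -/a -/b.
  by rewrite -EFinD -!EFinM lee_fin.
have Hnorm : (Lnorm mu p (EFin \o H) <= (2 * W + 8 * K)%:E * cLnorm mu p f)%E.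
  have nfin : cLnorm mu p f \is a fin_num by rewrite ge0_fin_numE// Lnorm_ge0.
  have N1 := Lnorm_flow_average_le haar cbeta p1 iw w0 mg g0 fp.
  have N2 := Lnorm_flow_average_le haar cnbeta p1 iw w0 mg g0 fp.
  apply: le_trans (eminkowski mu _ _ p1) _.
  - by apply: measurable_funD; exact: mq.
  - exact: measurable_cst.
  apply: le_trans (leeD (eminkowski mu (mq _ cbeta) (mq _ cnbeta) p1) (lexx _)) _.
  apply: (le_trans (leeD (leeD N1 N2) (lexx _))).
  rewrite Lnorm_cst ?mulr_ge0// -/W; last by rewrite ltW.
  move: Ig_le; rewrite -EgE -[X in (_ <= X)%E]/(cLnorm mu p f) -[Lnorm _ _ _]/(cLnorm mu p f).
  rewrite -(fineK nfin) lee_fin -!EFinM -!EFinD lee_fin => Ig.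
  have : 8 * K * mean mu g <= 8 * K * fine (cLnorm mu p f) by rewrite ler_wpM2l// mulr_ge0// ltW.
  by rewrite mulrDl; lra.
split.
  apply: le_trans Hnorm; apply: le_Lnorm_ae => //.
    by apply: measurable_funD => //; apply: measurable_funD; exact: mq.
  by apply: ae_imp bound => x [+ _]; rewrite gee0_abs// maximal_function_ge0.
by apply: ae_imp bound => x [].
Qed.
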